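(* Let $\mathcal V$ be a $d$-dimensional priority vector addition system (PVAS) with reachability relation $\mathbf R=\,\to_{\mathcal V}^{*}\,\subseteq\mathbb{N}^d\times\mathbb{N}^d$, and let $\mathbf S\subseteq\mathbb{N}^d\times\mathbb{N}^d$ be a semilinear relation. Then $\mathbf R\cap\mathbf S$ is a finite union of relations of the form $\mathbf b+\mathbf P$ with $\mathbf b\in\mathbb{N}^d\times\mathbb{N}^d$, where $\mathbf P\subseteq\mathbb{N}^d\times\mathbb{N}^d$ is smooth periodic and for every linear relation $\mathbf L\subseteq\mathbf b+\mathbf P$ there exists $\mathbf p\in\mathbf P$ such that $\mathbf p+\mathbf L$ is flattable with respect to $\mathcal V$.
   Context: $\mathbb{N}$ contains $0$. A priority vector addition system with states (PVASS) of dimension $d\in\mathbb{N}$ is a finite directed multigraph $\mathcal V=(Q,E)$ whose edges $e$ are labelled with a pair of a vector $f(e)\in\mathbb{Z}^d$ and a number $g(e)\in\{0,\dots,d\}$. Configurations are elements of $Q\times\mathbb{N}^d$. An edge $e$ from $p$ to $p'$ induces the relation $(q,\mathbf{x})\to_e(q',\mathbf{x}')$ iff $q=p$, $q'=p'$, $\mathbf{x}(j)=0$ for all $1\le j\le g(e)$, and $\mathbf{x}'=\mathbf{x}+f(e)$ (with $\mathbf{x},\mathbf{x}'\in\mathbb{N}^d$). Put $\to_{\mathcal V}=\bigcup_{e\in E}\to_e$, and let $\to_{\mathcal V}^{*}$ be its reflexive transitive closure (the reachability relation). A PVAS is a PVASS with exactly one state; its configurations are identified with vectors in $\mathbb{N}^d$.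 Composition is $\mathbf{R}_1\circ\mathbf{R}_2=\{(\mathbf v,\mathbf w)\mid\exists \mathbf x:(\mathbf v,\mathbf x)\in\mathbf R_1,(\mathbf x,\mathbf w)\in\mathbf R_2\}$. For $w=(e_1,\dots,e_k)\in E^{*}$, $\to_w:=\to_{e_1}\circ\dots\circ\to_{e_k}$, and $\to_w^{*}$ is its reflexive transitive closure. A relation $\mathbf T\subseteq\mathbb{N}^d\times\mathbb{N}^d$ is flattable with respect to $\mathcal V$ if there exist $w_1,\dots,w_r\in E^{*}$ with $\mathbf T\subseteq\,\to_{w_1}^{*}\circ\dots\circ\to_{w_r}^{*}$. Relations in $\mathbb{N}^{d}\times\mathbb{N}^{d}$ are viewed as subsets of $\mathbb{N}^{n}$ with $n=2d$ for the following notions. A set is linear if it has the form $\mathbf b+\mathbb{N}\mathbf p_1+\dots+\mathbb{N}\mathbf p_r$ with $\mathbf b,\mathbf p_i\in\mathbb{N}^n$; semilinear if it is a finite union of linear sets. A set $\mathbf P\subseteq\mathbb{N}^n$ is periodic if $\mathbf 0\in\mathbf P$ and $\mathbf P+\mathbf P\subseteq\mathbf P$. A vector $\mathbf v\in\mathbb{Q}^n$ is a direction of $\mathbf P$ if there exist $m\in\mathbb{N}_{>0}$ and a point $\mathbf x$ with $\mathbf x+\mathbb{N}\cdot m\mathbf v\subseteq\mathbf P$; $\mathrm{dir}(\mathbf P)$ is the set of directions. A cone is a set $\mathbf C\subseteq\mathbb{Q}^n$ with $\mathbf 0\in\mathbf C$, $\mathbf C+\mathbf C\subseteq\mathbf C$,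 $\mathbb{Q}_{>0}\mathbf C\subseteq\mathbf C$; it is definable if it is definable in $\mathrm{FO}(\mathbb{Q},+,\ge)$. A periodic set $\mathbf P$ is smooth if (i) $\mathrm{dir}(\mathbf P)$ is a definable cone and (ii) $\mathbf P$ is well-directed: every sequence $(\mathbf p_m)_{m\in\mathbb{N}}$ in $\mathbf P$ has an infinite subsequence $(\mathbf p_{m_k})_{k\in\mathbb{N}}$ such that $\mathbf p_{m_j}+\mathbb{N}(\mathbf p_{m_k}-\mathbf p_{m_j})\subseteq\mathbf P$ for all $k\ge j$. *)

(* Defs.v *)
From HB Require Import structures.
From Stdlib Require Export Relation_Definitions Relation_Operators.
From mathcomp Require Export all_boot all_order all_algebra.
From mathcomp Require Export boolp classical_sets.

Set Implicit Arguments.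
Unset Strict Implicit.
Unset Printing Implicit Defensive.

Import Order.TTheory GRing.Theory Num.Theory.
Local Open Scope classical_set_scope.
Local Open Scope ring_scope.

Definition toZ n (x : 'rV[nat]_n) : 'rV[int]_n := map_mx Posz x.

Definition toQ n (x : 'rV[nat]_n) : 'rV[rat]_n := map_mx (fun k => k%:R) x.

Definition translate n (b : 'rV[nat]_n) (P : set 'rV[nat]_n) : set 'rV[nat]_n :=
  [set b + x | x in P].

Definition linear_set n (L : set 'rV[nat]_n) : Prop :=
  exists (r : nat) (b : 'rV[nat]_n) (p : 'I_r -> 'rV[nat]_n),
    L = [set b + \sum_(i < r) p i *+ c i | c in [set: 'I_r -> nat]].

Definition semilinear_set n (S : set 'rV[nat]_n) : Prop :=
  exists (k : nat) (L : 'I_k -> set 'rV[nat]_n),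
    (forall i, linear_set (L i)) /\ S = \bigcup_i L i.

Definition periodic n (P : set 'rV[nat]_n) : Prop :=
  P 0 /\ forall x y, P x -> P y -> P (x + y).

Definition dir n (P : set 'rV[nat]_n) : set 'rV[rat]_n :=
  [set v | exists (m : nat) (x : 'rV[rat]_n), (0 < m)%N /\
             forall k : nat, (@toQ n @` P) (x + (m%:R *: v) *+ k)].

Definition cone n (C : set 'rV[rat]_n) : Prop :=
  [/\ C 0,
      forall u v, C u -> C v -> C (u + v) &
      forall (a : rat) v, 0 < a -> C v -> C (a *: v)].

(* First-order formulas over the signature (+, >=), without parameters.       *)
(* A formula in [fo_form n] has its free variables among 0, ..., n-1; the     *)
(* quantifier binds variable 0 of its body and shifts the others by one. The  *)
(* remaining connectives, the universal quantifier and equality are           *)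
(* classically expressible from these.                                        *)
Inductive fo_term (n : nat) : Type :=
  | FoVar of 'I_n
  | FoAdd of fo_term n & fo_term n.

Inductive fo_form : nat -> Type :=
  | FoGe n of fo_term n & fo_term n : fo_form n
  | FoNot n of fo_form n : fo_form n
  | FoAnd n of fo_form n & fo_form n : fo_form n
  | FoEx n of fo_form n.+1 : fo_form n.

Fixpoint fo_eval n (v : 'rV[rat]_n) (t : fo_term n) : rat :=
  match t with
  | FoVar i => v 0 i
  | FoAdd t1 t2 => fo_eval v t1 + fo_eval v t2
  end.

Fixpoint fo_holds n (phi : fo_form n) : 'rV[rat]_n -> Prop :=
  match phi with
  | FoGe _ t1 t2 => fun v => fo_eval v t1 >= fo_eval v t2
  | FoNot _ phi1 => fun v => ~ fo_holds phi1 v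
  | FoAnd _ phi1 phi2 => fun v => fo_holds phi1 v /\ fo_holds phi2 v
  | FoEx _ phi1 =>
      fun v => exists a : rat, fo_holds phi1 (row_mx (const_mx a : 'rV_1) v)
  end.

Definition fo_definable n (C : set 'rV[rat]_n) : Prop :=
  exists phi : fo_form n, C = [set v | fo_holds phi v].

Definition well_directed n (P : set 'rV[nat]_n) : Prop :=
  forall p : nat -> 'rV[nat]_n, (forall m, P (p m)) ->
    exists h : nat -> nat,
      (forall j k, (j < k)%N -> (h j < h k)%N) /\
      forall j k, (j <= k)%N -> forall l : nat,
        (@toZ n @` P) (toZ (p (h j)) + (toZ (p (h k)) - toZ (p (h j))) *+ l).

Definition smooth n (P : set 'rV[nat]_n) : Prop :=
  [/\ periodic P, cone (dir P), fo_definable (dir P) & well_directed P].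

Record pvass (d : nat) := Pvass {
  state : finType;
  edge : finType;
  source : edge -> state;
  target : edge -> state;
  effect : edge -> 'rV[int]_d;
  priority : edge -> 'I_d.+1
}.

Definition is_pvas d (V : pvass d) : Prop := #|state V| = 1%N.

Definition config d (V : pvass d) : Type := (state V * 'rV[nat]_d)%type.

(* Coordinates are numbered from 0, so that the first [priority e] of them    *)
(* are those with index strictly below [priority e].                          *)
Definition step d (V : pvass d) (e : edge V) : relation (config V) :=
  fun c c' =>
    [/\ c.1 = source e,
        c'.1 = target e,
        forall j : 'I_d, (j < priority e)%N -> c.2 0 j = 0%N &
        toZ c'.2 = toZ c.2 + effect e].

Definition rcomp T (R1 R2 : relation T) : relation T :=
  fun v w => exists x, R1 v x /\ R2 x w.

Definition run d (V : pvass d) (w : seq (edge V)) : relation (config V) :=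
  foldr (fun e R => rcomp (step e) R) eq w.

Definition reach d (V : pvass d) : relation (config V) :=
  clos_refl_trans _ (fun c c' => exists e : edge V, step e c c').

Definition flat_run d (V : pvass d) (ws : seq (seq (edge V))) :
    relation (config V) :=
  foldr (fun w R => rcomp (clos_refl_trans _ (run w)) R) eq ws.

(* A relation on configurations as a subset of N^(2d), forgetting the states; *)
(* this is the identification of configurations with vectors when [V] has     *)
(* exactly one state.                                                         *)
Definition vec_rel d (V : pvass d) (R : relation (config V)) :
    set 'rV[nat]_(d + d) :=
  [set z | exists q q' : state V, R (q, lsubmx z) (q', rsubmx z)].

Definition flattable d (V : pvass d) (T : set 'rV[nat]_(d + d)) : Prop :=
  exists ws : seq (seq (edge V)), T `<=` vec_rel (flat_run ws).

(* Main.v *)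
(** Relations are presented by families of pieces [(b, P)] with [P] periodic and
    [b + P] inside the relation. A family is good when its bases are closed
    under adding elements of [P], when every sequence of pieces has [i < j] with
    [b_j] in [b_i + P_i], and when the cones of the [P] are definable. A good
    family has a finite subcover, and its periods are well-directed.

    Good families are stable under affine images and preimages, intersection,
    composition and, for relations compatible with addition, reflexive
    transitive closure. For the latter, pieces are words of pieces of the given
    relation with production relations [{(z, z') | s + z ->* s + z'}] inserted
    at the visited points [s]; Higman's lemma compares the words. The cone of a
    production relation is definable by the argument for vector addition
    systems: the configurations visited by productions take finitely many values
    on the coordinates that stay bounded, the other coordinates can be pumped,
    and a Kirchhoff flow through the finite graph of bounded parts lifts to a
    run along an Eulerian circuit.

    Applying the same constructions to the doubled relation [{(b, q) | q in P}]
    shows that directions are definable, and that the presentation remembers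
    which words to iterate. The reachability relation is obtained by induction
    on the largest priority allowed: an edge that tests [m] coordinates, followed
    by runs of lower priority, is a step between configurations that vanish on
    those coordinates, and it is compatible with addition of such
    configurations. *)

Require Import Defs.
From mathcomp Require Import zify ring lra.

Set Implicit Arguments.
Unset Strict Implicit.
Unset Printing Implicit Defensive.

Import Order.TTheory GRing.Theory Num.Theory.
Local Open Scope classical_set_scope.
Local Open Scope ring_scope.

(** A flow argument determines the cone of a production relation only up to its boundary. A flow
    becomes a run when it uses every edge and the run may borrow tokens, so one obtains a polyhedral
    [K] containing the cone and a vector [w] of the cone such that [v + e w] is in the cone for all
    [v] in [K] and [e > 0]. The boundary is reached by asking for such a pair inside every subspace
    [V] and by induction on the dimension; this is why productions are restricted to [V]. Good
    families record the cone generated by the periods and not their directions, because generated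
    cones commute with preimages, intersections and images. Directions come back at the end: by
    almost-fullness every line in a relation contains two points whose difference is a period at the
    first one, and such pairs form the doubled relation. Flatness is tracked for sums of lines,
    since a linear set has several generators. Each generator has a multiple that is such a period,
    and the residues of the coefficients leave finitely many cases. *)

(** * Finite unions of projected polyhedral cones *)

Definition pr (T I J : Type) (x : I -> T) (y : J -> T) : I + J -> T :=
  fun k => match k with inl i => x i | inr j => y j end.

Lemma pr_eta (T I J : Type) (w : I + J -> T) : pr (w \o inl) (w \o inr) = w.
Proof. by apply/funext => -[]. Qed.

Definition lcomb (I : Type) (a b : rat) (u v : I -> rat) : I -> rat :=
  fun i => a * u i + b * v i.

Definition islin (I : Type) (f : (I -> rat) -> rat) :=
  forall a b u v, f (lcomb a b u v) = a * f u + b * f v.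

Definition islinm (I J : Type) (f : (I -> rat) -> J -> rat) :=
  forall a b u v, f (lcomb a b u v) = lcomb a b (f u) (f v).

Lemma islin_comp (I J : Type) (f : (J -> rat) -> rat) (g : (I -> rat) -> J -> rat) :
  islin f -> islinm g -> islin (f \o g).
Proof. by move=> lf lg a b u v /=; rewrite lg lf. Qed.

Lemma islinm_reindex (I J : Type) (s : J -> I) :
  islinm (fun w : I -> rat => w \o s).
Proof. by []. Qed.

Lemma islin_coord (I : Type) (i : I) : islin (fun w => w i).
Proof. by []. Qed.

Lemma islin_opp (I : Type) (f : (I -> rat) -> rat) :
  islin f -> islin (fun w => - f w).
Proof. by move=> lf a b u v; rewrite lf; ring. Qed.

Lemma islin_add (I : Type) (f g : (I -> rat) -> rat) :
  islin f -> islin g -> islin (fun w => f w + g w).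
Proof. by move=> lf lg a b u v; rewrite lf lg; ring. Qed.

Lemma islin_sum (I : Type) (T : finType) (f : T -> (I -> rat) -> rat) :
  (forall t, islin (f t)) -> islin (fun w => \sum_t f t w).
Proof.
move=> lf a b u v; rewrite !mulr_sumr -big_split /=.
by apply: eq_bigr => t _; rewrite lf.
Qed.

Definition sgnok (s : bool) (x : rat) : bool := if s then 0 < x else 0 <= x.

(* A basic set is the projection of a homogeneous system of linear            *)
(* inequalities; [b] allows strict ones.                                      *)
Definition basic (b : bool) (I : finType) (C : set (I -> rat)) : Prop :=
  exists (Y F : finType) (s : F -> bool) (f : F -> (I + Y -> rat) -> rat),
    [/\ forall k, islin (f k), forall k, s k -> b &
        forall v, C v <-> exists y, forall k, sgnok (s k) (f k (pr v y))].

Lemma basic_weak (I : finType) (C : set (I -> rat)) b : basic false C -> basic b C.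
Proof.
move=> [Y [F [s [f [lf hs h]]]]]; exists Y, F, s, f; split=> //.
by move=> k /hs.
Qed.

Lemma basic_sgn (b s : bool) (I : finType) (f : (I -> rat) -> rat) :
  islin f -> (s -> b) -> basic b [set v | sgnok s (f v)].
Proof.
move=> lf sb; exists void, unit, (fun=> s), (fun _ => f \o (fun w => w \o inl)).
split=> // [_|v].
  by apply: islin_comp => //; exact: islinm_reindex.
split=> [h|[y /(_ tt)]//].
by exists (of_void rat) => -[].
Qed.

Lemma basic_ge b (I : finType) (f : (I -> rat) -> rat) :
  islin f -> basic b [set v | 0 <= f v].
Proof. by move=> lf; apply: (@basic_sgn b false). Qed.

Lemma basic_gt (I : finType) (f : (I -> rat) -> rat) :
  islin f -> basic true [set v | 0 < f v].
Proof. by move=> lf; apply: (@basic_sgn true true). Qed.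

Lemma basicT b (I : finType) : basic b [set: I -> rat].
Proof.
exists void, void, (fun=> false), (fun _ _ => 0).
split; [by case|by case|].
by move=> v; split=> // _; exists (of_void rat) => -[].
Qed.

Lemma basicI b (I : finType) (C D : set (I -> rat)) :
  basic b C -> basic b D -> basic b (C `&` D).
Proof.
move=> [Y [F [s [f [lf hs h]]]]] [Y' [F' [s' [f' [lf' hs' h']]]]].
pose r1 (k : I + Y) : I + (Y + Y') :=
  match k with inl i => inl i | inr y => inr (inl y) end.
pose r2 (k : I + Y') : I + (Y + Y') :=
  match k with inl i => inl i | inr y => inr (inr y) end.
exists (Y + Y')%type, (F + F')%type,
  (fun k => match k with inl i => s i | inr j => s' j end),
  (fun k => match k with inl i => f i \o (fun w => w \o r1)
    | inr j => f' j \o (fun w => w \o r2) end).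
split.
- by case=> k; apply: islin_comp => //; exact: islinm_reindex.
- by case=> k; [exact: hs|exact: hs'].
- have e1 v y y' : pr v (pr y y') \o r1 = pr v y by apply/funext => -[].
  have e2 v y y' : pr v (pr y y') \o r2 = pr v y' by apply/funext => -[].
  move=> v; split.
    move=> [/h[y hy] /h'[y' hy']]; exists (pr y y') => -[k|k] /=.
      by rewrite e1.
    by rewrite e2.
  move=> [z]; rewrite -(pr_eta z) => hz; split.
    by apply/h; exists (z \o inl) => k; have := hz (inl k); rewrite /= e1.
  by apply/h'; exists (z \o inr) => k; have := hz (inr k); rewrite /= e2.
Qed.

Lemma basic_eq b (I : finType) (C D : set (I -> rat)) :
  (forall v, C v <-> D v) -> basic b C -> basic b D.
Proof.
by move=> e; have -> : C = D by apply/funext => v; apply/propext/e.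
Qed.

Lemma basic_zero b (I : finType) (f : (I -> rat) -> rat) :
  islin f -> basic b [set v | f v = 0].
Proof.
move=> lf; apply: basic_eq (basicI (basic_ge b lf) (basic_ge b (islin_opp lf))).
move=> v; split=> /=; last by move=> ->; split; lra.
by move=> [h1 h2]; lra.
Qed.

Lemma basic_bigI b (I T : finType) (C : T -> set (I -> rat)) :
  (forall t, basic b (C t)) -> basic b [set v | forall t, C t v].
Proof.
move=> h.
have : basic b [set v | forall t, t \in enum T -> C t v].
  elim: (enum T) => [|t l IH]; first by apply: basic_eq (basicT b I).
  apply: basic_eq (basicI (h t) IH) => v; split=> /=.
    by move=> [h1 h2] u; rewrite inE => /orP[/eqP->//|/h2].
  by move=> h1; split=> [|u ul]; apply: h1; rewrite inE ?eqxx ?ul ?orbT.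
apply: basic_eq => v; split=> /= hv t; last by [].
by apply: hv; rewrite mem_enum.
Qed.

Lemma basic_ex b (I J : finType) (C : set (I + J -> rat)) :
  basic b C -> basic b [set v | exists u, C (pr v u)].
Proof.
move=> [Y [F [s [f [lf hs h]]]]].
pose r (k : (I + J) + Y) : I + (J + Y) :=
  match k with inl (inl i) => inl i | inl (inr j) => inr (inl j)
  | inr y => inr (inr y) end.
exists (J + Y)%type, F, s, (fun k => f k \o (fun w => w \o r)).
split=> // [k|v].
  by apply: islin_comp => //; exact: islinm_reindex.
have e u y : pr v (pr u y) \o r = pr (pr v u) y by apply/funext => -[[]|].
split=> /=.
  by move=> [u /h[y hy]]; exists (pr u y) => k; rewrite e.
move=> [z]; rewrite -(pr_eta z) => hz; exists (z \o inl); apply/h.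
by exists (z \o inr) => k; have := hz k; rewrite e.
Qed.

Lemma basic_pre b (I J : finType) (g : (I -> rat) -> J -> rat) (C : set (J -> rat)) :
  islinm g -> basic b C -> basic b [set v | C (g v)].
Proof.
move=> lg [Y [F [s [f [lf hs h]]]]].
exists Y, F, s, (fun k => f k \o (fun w => pr (g (w \o inl)) (w \o inr))).
split=> // [k|v]; last exact: h.
apply: islin_comp => // a c u v; apply/funext => -[i|y] //=.
by rewrite -[RHS]/(lcomb a c (g (u \o inl)) (g (v \o inl)) i) -lg.
Qed.

(** Positive existential formulas in disjunctive form. Every operation used on cones preserves this
    class with the projections left in place, so quantifiers are never eliminated. *)
Definition edef (I : finType) (C : set (I -> rat)) : Prop :=
  exists (T : finType) (B : T -> set (I -> rat)),
    (forall t, basic true (B t)) /\ forall v, C v <-> exists t, B t v.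

Lemma edef_eq (I : finType) (C D : set (I -> rat)) :
  (forall v, C v <-> D v) -> edef C -> edef D.
Proof.
by move=> e; have -> : C = D by apply/funext => v; apply/propext/e.
Qed.

Lemma basic_edef b (I : finType) (C : set (I -> rat)) : basic b C -> edef C.
Proof.
move=> h; exists unit, (fun=> C); split=> [_|v].
  by case: b h => // /basic_weak; apply.
by split=> [|[]//]; exists tt.
Qed.

Lemma edef0 (I : finType) : edef (@set0 (I -> rat)).
Proof. by exists void, (fun=> set0); split=> [[]|v]; split=> [[]|[[]]]. Qed.

Lemma edef_bigU (I T : finType) (C : T -> set (I -> rat)) :
  (forall t, edef (C t)) -> edef [set v | exists t, C t v].
Proof.
move=> h; have /choice[S hS] : forall t, exists S : {S : finType & S -> set (I -> rat)},
    (forall x, basic true (projT2 S x)) /\ forall v, C t v <-> exists x, projT2 S x v.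
  by move=> t; have [S [B hB]] := h t; exists (existT _ S B).
exists {t : T & projT1 (S t)}, (fun x => projT2 (S (tag x)) (tagged x)); split.
  by move=> [t x] /=; apply: (hS t).1.
move=> v; split.
  by move=> [t /(hS t).2[x hx]]; exists (existT (fun t => Finite.sort (projT1 (S t))) t x).
by move=> [[t x] /= hx]; exists t; apply/(hS t).2; exists x.
Qed.

Lemma edefU (I : finType) (C D : set (I -> rat)) :
  edef C -> edef D -> edef (C `|` D).
Proof.
move=> hC hD; apply: edef_eq (_ : edef [set v | exists t, (if t then C else D) v]).
  by move=> v; split=> [[[] h]|[h|h]]; [left|right|exists true|exists false].
by apply: edef_bigU => -[].
Qed.

Lemma edefI (I : finType) (C D : set (I -> rat)) :
  edef C -> edef D -> edef (C `&` D).
Proof.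
move=> [T [B [hB h]]] [T' [B' [hB' h']]].
exists (T * T')%type, (fun x => B x.1 `&` B' x.2); split.
  by move=> x; apply: basicI.
move=> v; split.
  by move=> [/h[t ht] /h'[t' ht']]; exists (t, t').
by move=> [[t t'] [/= ? ?]]; split; [apply/h; exists t|apply/h'; exists t'].
Qed.

Lemma edef_bigI (I T : finType) (C : T -> set (I -> rat)) :
  (forall t, edef (C t)) -> edef [set v | forall t, C t v].
Proof.
move=> h.
have : edef [set v | forall t, t \in enum T -> C t v].
  elim: (enum T) => [|t l IH].
    by apply: edef_eq (basic_edef (basicT true I)).
  apply: edef_eq (edefI (h t) IH) => v; split=> /=.
    by move=> [h1 h2] u; rewrite inE => /orP[/eqP->//|/h2].
  by move=> h1; split=> [|u ul]; apply: h1; rewrite inE ?eqxx ?ul ?orbT.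
apply: edef_eq => v; split=> /= hv t; last by [].
by apply: hv; rewrite mem_enum.
Qed.

Lemma edef_ex (I J : finType) (C : set (I + J -> rat)) :
  edef C -> edef [set v | exists u, C (pr v u)].
Proof.
move=> [T [B [hB h]]]; exists T, (fun t => [set v | exists u, B t (pr v u)]).
split=> [t|v]; first exact: basic_ex.
split=> /=.
  by move=> [u /h[t ht]]; exists t, u.
by move=> [t [u hu]]; exists u; apply/h; exists t.
Qed.

Lemma edef_pre (I J : finType) (g : (I -> rat) -> J -> rat) (C : set (J -> rat)) :
  islinm g -> edef C -> edef [set v | C (g v)].
Proof.
move=> lg [T [B [hB h]]]; exists T, (fun t => [set v | B t (g v)]).
by split=> [t|v]; [exact: basic_pre|exact: h].
Qed.

Lemma edef_img (I J : finType) (g : (I -> rat) -> J -> rat) (C : set (I -> rat)) :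
  islinm g -> edef C -> edef [set g v | v in C].
Proof.
move=> lg hC.
have h1 : edef [set w : J + I -> rat | C (w \o inr)].
  by apply: edef_pre hC; exact: islinm_reindex.
have h2 : edef [set w : J + I -> rat | forall j, w (inl j) - g (w \o inr) j = 0].
  apply: edef_bigI => j; apply: (@basic_edef true).
  apply: (@basic_zero _ _ (fun w : J + I -> rat => w (inl j) - g (w \o inr) j)).
  apply: islin_add; first exact: islin_coord.
  apply: islin_opp => a b u v.
  by rewrite -[RHS]/(lcomb a b (g (u \o inr)) (g (v \o inr)) j) -lg.
apply: edef_eq (edef_ex (edefI h1 h2)) => v; split=> /=.
  move=> [u [hu e]]; exists u => //; apply/funext => j.
  by have := e j; rewrite /= -[_ \o inr]/u; lra.
by move=> [u hu <-]; exists u; split=> // j /=; rewrite -[_ \o inr]/u; lra.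
Qed.

(** * Definability of convex cones *)

Definition ccone (I : Type) (C : set (I -> rat)) : Prop :=
  C (fun=> 0) /\
  forall a b u v, 0 <= a -> 0 <= b -> C u -> C v -> C (lcomb a b u v).

Definition subsp (I : Type) (V : set (I -> rat)) : Prop :=
  V (fun=> 0) /\ forall a b u v, V u -> V v -> V (lcomb a b u v).

Definition indep (I : Type) (k : nat) (w : 'I_k -> I -> rat) : Prop :=
  forall c : 'I_k -> rat, (forall i, \sum_j c j * w j i = 0) -> forall j, c j = 0.

Lemma islin0 (I : Type) (f : (I -> rat) -> rat) : islin f -> f (fun=> 0) = 0.
Proof.
move=> lf; have := lf 0 0 (fun=> 0) (fun=> 0); rewrite !mul0r addr0.
by apply: etrans; congr f; apply/funext => i; rewrite /lcomb /=; ring.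
Qed.

Lemma ccone_sum (I : Type) (T : finType) (C : set (I -> rat)) (a : T -> rat)
    (u : T -> I -> rat) :
  ccone C -> (forall t, 0 <= a t) -> (forall t, C (u t)) ->
  C (fun i => \sum_t a t * u t i).
Proof.
move=> [C0 hC] ha hu.
have : forall l : seq T, C (fun i => \sum_(t <- l) a t * u t i).
  elim=> [|t l IH]; first by under eq_fun do rewrite big_nil.
  have := hC _ _ _ _ (ha t) (@ler01 rat) (hu t) IH; congr C.
  by apply/funext => i; rewrite /lcomb big_cons mul1r.
move=> /(_ (index_enum T)); exact.
Qed.

Lemma subsp_sum (I : Type) (T : finType) (V : set (I -> rat)) (a : T -> rat)
    (u : T -> I -> rat) :
  subsp V -> (forall t, V (u t)) -> V (fun i => \sum_t a t * u t i).
Proof.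
move=> [V0 hV] hu.
have : forall l : seq T, V (fun i => \sum_(t <- l) a t * u t i).
  elim=> [|t l IH]; first by under eq_fun do rewrite big_nil.
  have := hV (a t) 1 _ _ (hu t) IH; congr V.
  by apply/funext => i; rewrite /lcomb big_cons mul1r.
move=> /(_ (index_enum T)); exact.
Qed.

Lemma indep_bound (I : finType) k (w : 'I_k -> I -> rat) : indep w -> (k <= #|I|)%N.
Proof.
move=> hw; pose A : 'M[rat]_(k, #|I|) := \matrix_(j, i) w j (enum_val i).
suff : row_free A by rewrite /row_free => /eqP <-; exact: rank_leq_col.
rewrite -kermx_eq0; apply/eqP/matrixP => r j; rewrite [RHS]mxE.
apply: (hw (fun j => kermx A r j)) => i.
have /matrixP/(_ r (enum_rank i)) := mulmx_ker A; rewrite !mxE.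
by apply: etrans; apply: eq_bigr => j' _; rewrite !mxE enum_rankK.
Qed.

Definition fcons (T : Type) k (x : T) (w : 'I_k -> T) (j : 'I_k.+1) : T :=
  if unlift ord0 j is Some j' then w j' else x.

Lemma fcons0 (T : Type) k (x : T) (w : 'I_k -> T) : fcons x w ord0 = x.
Proof. by rewrite /fcons unlift_none. Qed.

Lemma fconsS (T : Type) k (x : T) (w : 'I_k -> T) j : fcons x w (lift ord0 j) = w j.
Proof. by rewrite /fcons liftK. Qed.

Lemma indep_cons (I : Type) (V : set (I -> rat)) k (x : I -> rat) (w : 'I_k -> I -> rat) :
  indep w -> (forall c, ~ (forall i, x i = \sum_j c j * w j i)) ->
  indep (fcons x w).
Proof.
move=> hw hx c hc.
have e i : c ord0 * x i + \sum_j c (lift ord0 j) * w j i = 0.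
  have := hc i; rewrite big_ord_recl fcons0; apply: etrans; congr (_ + _).
  by apply: eq_bigr => j _; rewrite fconsS.
have c0 : c ord0 = 0.
  apply/eqP/negPn/negP => nz; apply: (hx (fun j => - c (lift ord0 j) / c ord0)) => i.
  apply: (mulfI nz); rewrite mulr_sumr; under eq_bigr do rewrite mulrA mulrCA divff // mulr1 mulNr.
  by rewrite sumrN; have := e i; lra.
move=> j; case: (unliftP ord0 j) => [j'|] ->//.
by apply: (hw (fun j => c (lift ord0 j))) => i; have := e i; rewrite c0 mul0r add0r.
Qed.

(** Take a maximal independent family of elements of [S]; independence bounds its size by the number
    of coordinates. *)
Lemma span_exists (I : finType) (S : set (I -> rat)) :
  exists k (q : 'I_k -> I -> rat), (forall j, S (q j)) /\
    forall v, S v -> exists c : 'I_k -> rat, forall i, v i = \sum_j c j * q j i.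
Proof.
pose Q k := `[< exists q : 'I_k -> I -> rat, (forall j, S (q j)) /\ indep q >].
have Q0 : exists k, Q k.
  exists 0%N; apply/asboolP; exists (fun _ _ => 0).
  by split=> [[]|c _ []].
have Qb k : Q k -> (k <= #|I|)%N by move=> /asboolP[q [_ /indep_bound]].
case: (ex_maxnP Q0 Qb) => k /asboolP[q [Sq iq]] kmax.
exists k, q; split=> // v Sv; apply: contrapT => h.
suff /kmax : Q k.+1 by rewrite ltnn.
apply/asboolP; exists (fcons v q); split.
  by move=> j; case: (unliftP ord0 j) => [j'|] ->; rewrite ?fconsS ?fcons0.
by apply: indep_cons => // c hc; apply: h; exists c.
Qed.

(** Each condition holds on an initial interval of the positive numbers, and the minimum of finitely
    many thresholds is still positive. *)
Lemma small_eps (T : finType) (Q : T -> rat -> Prop) :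
  (forall t, exists2 e, 0 < e & forall e', 0 < e' -> e' <= e -> Q t e') ->
  exists2 e, 0 < e & forall t, Q t e.
Proof.
move=> h; have /choice[e he] : forall t, exists e, 0 < e /\
    forall e', 0 < e' -> e' <= e -> Q t e' by move=> t; have [e] := h t; exists e.
  exists (\big[Order.min/1]_t e t); first by apply: lt_bigmin => // ? _; apply: (he _).1.
  by move=> t; apply: (he t).2 => //; [apply: lt_bigmin|apply: bigmin_le_cond] => // ? _; apply: (he _).1.
Qed.

(* Every [v] in [C] lies in the relative interior of a face of [K]. If that   *)
(* face contains [w], then [v - e w] is in [K] for a small [e], so that all   *)
(* such [v] are in [C]; otherwise the face spans a subspace without [w], and  *)
(* the dimension drops.                                                       *)
Lemma nice_edef (I : finType) (C : set (I -> rat)) :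
  ccone C ->
  (forall V, subsp V -> exists K w, [/\ basic false K, C w, V w,
     forall v, C v -> V v -> K v &
     forall v e, K v -> V v -> 0 < e -> C (lcomb 1 e v w)]) ->
  edef C.
Proof.
move=> [C0 hC] nice.
(* Induction on a strict upper bound [k] for the dimension of [V]; the bound [#|I|.+1] covers the
   whole space. *)
suff main : forall k V, subsp V -> edef V ->
    ~ (exists w : 'I_k -> I -> rat, indep w /\ forall j, V (w j)) -> edef (C `&` V).
  have VT : subsp [set: I -> rat] by [].
  apply: edef_eq (main #|I|.+1 _ VT (basic_edef (basicT true I)) _).
    by move=> v; split=> [[]|].
  by move=> [w [/indep_bound]]; rewrite ltnn.
elim=> [|k IH] V sV eV hV.
  by exfalso; apply: hV; exists (fun _ _ => 0); split=> [c _ []|[]].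
have [K [w [[Y [F [s [f [lf ls hK]]]]] Cw Vw CK KC]]] := nice V sV.
have {ls}ls k' : s k' = false by apply/negP => /ls.
pose sol v y := forall k, 0 <= f k (pr v y).
have {}hK v : K v <-> exists y, sol v y.
  by rewrite hK; split=> -[y hy]; exists y => k'; have := hy k'; rewrite ls.
pose Phi v k := exists y, sol v y /\ 0 < f k (pr v y).
have solC a b u v y z : 0 <= a -> 0 <= b -> sol u y -> sol v z ->
    sol (lcomb a b u v) (lcomb a b y z) /\
    forall k, f k (pr (lcomb a b u v) (lcomb a b y z)) = a * f k (pr u y) + b * f k (pr v z).
  move=> a0 b0 hy hz.
  have e : pr (lcomb a b u v) (lcomb a b y z) = lcomb a b (pr u y) (pr v z).
    by apply/funext => -[].
  by split=> k'; rewrite e lf // addr_ge0 // mulr_ge0.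
(* Averaging witnesses for single inequalities yields one witness that is strict wherever some
   witness is. *)
have solmax v : K v -> exists y, sol v y /\ forall k, Phi v k -> 0 < f k (pr v y).
  move=> /hK[y0 hy0].
  have : forall l : seq F, exists y, sol v y /\ forall k, k \in l -> Phi v k -> 0 < f k (pr v y).
    elim=> [|x l [y [hy hl]]]; first by exists y0.
    case: (pselect (Phi v x)) => [[z [hz zx]]|nx]; last first.
      by exists y; split=> // k'; rewrite inE => /orP[/eqP->//|]; exact: hl.
    exists (lcomb 2^-1 2^-1 y z).
    have [] := @solC 2^-1 2^-1 v v y z; rewrite ?invr_ge0 //.
    have -> : lcomb 2^-1 2^-1 v v = v by apply/funext => i; rewrite /lcomb; field.
    move=> h1 h2; split=> // k'; rewrite inE h2.
    have := hy k'; have := hz k' => a1 a2 /orP[/eqP ek|kl] ph.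
      by move: a1 a2; rewrite {}ek; lra.
    by have := hl _ kl ph; lra.
  by move=> /(_ (enum F))[y [hy h]]; exists y; split=> // k'; apply: h; rewrite mem_enum.
(* The inequalities that can be strict at [v] name the face of [K] with [v] in its relative
   interior. [KP Psi] is the face named by [Psi], [V' Psi] its span within [V], and [good Psi] says
   that the face occurs and omits [w]. *)
pose PhS v := [set x | `[< Phi v x >]]%SET.
have memPh v x : reflect (Phi v x) (x \in PhS v).
  by rewrite finset.in_set; exact: asboolP.
pose KP (Psi : {set F}) := [set v | exists y, sol v y /\ forall k, k \notin Psi -> f k (pr v y) = 0].
pose V' (Psi : {set F}) := V `&` [set u | exists f1 f2, [/\ KP Psi f1, KP Psi f2 & u = lcomb 1 (-1) f1 f2]].
pose good Psi := exists v, [/\ K v, PhS v = Psi & ~~ (PhS w \subset Psi)].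
pose D Psi := if `[< good Psi >] then C `&` V' Psi else set0.
pose M := [set v | K v /\ exists y, sol v y /\ forall k, Phi w k -> 0 < f k (pr v y)].
have [yw [hyw yw0]] := solmax _ (CK _ Cw Vw).
have eKP Psi : edef (KP Psi).
  apply: (edef_eq _ (@edef_ex I Y [set z | (forall k, 0 <= f k z) /\
      forall k, k \notin Psi -> f k z = 0] _)) => //.
  apply: edefI.
    by apply: edef_bigI => k'; apply: (@basic_edef true); apply: basic_ge.
  apply: edef_bigI => k'; case: (k' \notin Psi); last first.
    by apply: edef_eq (basic_edef (basicT true _)).
  apply: edef_eq (basic_edef (@basic_zero true _ _ (lf k'))) => z /=.
  by split=> // /(_ isT).
have sKP Psi a b u v : 0 <= a -> 0 <= b -> KP Psi u -> KP Psi v -> KP Psi (lcomb a b u v).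
  move=> a0 b0 [y [hy y0]] [z [hz z0]]; exists (lcomb a b y z).
  have [h1 h2] := solC _ _ _ _ _ _ a0 b0 hy hz; split=> // k' kn.
  by rewrite h2 y0 // z0 // !mulr0 addr0.
have KP0 Psi : KP Psi (fun=> 0).
  exists (fun=> 0); have e : pr (fun=> 0) (fun=> 0) = (fun=> 0) :> (I + Y -> rat).
    by apply/funext => -[].
  by split=> k'; rewrite e islin0.
have sV' Psi : subsp (V' Psi).
  split.
    split; first exact: sV.1.
    by exists (fun=> 0), (fun=> 0).
  move=> a b u v [Vu [u1 [u2 [hu1 hu2 eu]]]] [Vv [v1 [v2 [hv1 hv2 ev]]]].
  split; first exact: sV.2.
  have sc c x : KP Psi x -> 0 <= c -> KP Psi (lcomb c 0 x x) by move=> *; apply: sKP.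
  have split1 c x1 x2 : KP Psi x1 -> KP Psi x2 -> exists y1 y2,
      [/\ KP Psi y1, KP Psi y2 & forall i, c * (x1 i - x2 i) = y1 i - y2 i].
    move=> h1 h2; case: (lerP 0 c) => c0.
      exists (lcomb c 0 x1 x1), (lcomb c 0 x2 x2); split; try exact: sc.
      by move=> i; rewrite /lcomb; ring.
    have nc : 0 <= - c by lra.
    exists (lcomb (- c) 0 x2 x2), (lcomb (- c) 0 x1 x1); split; try exact: sc.
    by move=> i; rewrite /lcomb; ring.
  have [y1 [y2 [hy1 hy2 ey]]] := split1 a _ _ hu1 hu2.
  have [z1 [z2 [hz1 hz2 ez]]] := split1 b _ _ hv1 hv2.
  exists (lcomb 1 1 y1 z1), (lcomb 1 1 y2 z2); split; try exact: sKP.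
  apply/funext => i; have := ey i; have := ez i; rewrite eu ev /lcomb; lra.
have eV' Psi : edef (V' Psi).
  apply: edefI => //.
  pose R := [set z : I + (I + I) -> rat | [/\ KP Psi (z \o (inr \o inl)),
    KP Psi (z \o (inr \o inr)) & forall i, z (inl i) - z (inr (inl i)) + z (inr (inr i)) = 0]].
  apply: edef_eq (@edef_ex _ _ R _); last first.
    have h1 : edef [set z : I + (I + I) -> rat | KP Psi (z \o (inr \o inl))].
      by apply: edef_pre (eKP Psi); exact: islinm_reindex.
    have h2 : edef [set z : I + (I + I) -> rat | KP Psi (z \o (inr \o inr))].
      by apply: edef_pre (eKP Psi); exact: islinm_reindex.
    have h3 : edef [set z : I + (I + I) -> rat |
        forall i, z (inl i) - z (inr (inl i)) + z (inr (inr i)) = 0].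
      apply: edef_bigI => i; apply: (@basic_edef true).
      apply: (@basic_zero _ _ (fun z : I + (I + I) -> rat =>
        z (inl i) - z (inr (inl i)) + z (inr (inr i)))).
      by move=> a b u v; rewrite /lcomb; ring.
    by apply: edef_eq (edefI (edefI h1 h2) h3) => z; split=> [[[]]|[]].
  move=> v; split=> /=.
    move=> [u [/= h1 h2 h3]]; exists (u \o inl), (u \o inr); split=> //.
    by apply/funext => i; have := h3 i; rewrite /lcomb /=; lra.
  move=> [u1 [u2 [h1 h2 e]]]; exists (pr u1 u2); split=> // i.
  by rewrite /= e /lcomb; ring.
(* If [w = f1 - f2] with [f1], [f2] in the face, then [f1 = w + f2] lies in the face and
   [v - eps f1] stays in [K]. Hence [v] can be strict wherever [w] can, against the choice of
   [Psi]. *)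
have goodV' Psi : good Psi -> ~ V' Psi w.
  move=> [v [Kv <- nsub]] [_ [f1 [f2 [h1 [y2 [hy2 y20]] e]]]].
  move/negP: nsub; apply; apply/fintype.subsetP => x /memPh px; apply/memPh.
  have [yv [hyv yv0]] := solmax _ Kv.
  have [y1 [hy1 y10]] := h1.
  have e1 : f1 = lcomb 1 1 w f2 by apply/funext => i; rewrite e /lcomb; ring.
  have [hs hs'] := solC 1 1 w f2 yw y2 ler01 ler01 hyw hy2; rewrite -e1 in hs hs'.
  have [eps eps0 heps] : exists2 eps, 0 < eps &
      forall k, 0 <= f k (pr v yv) - eps * f k (pr f1 y1).
    apply: small_eps => k'; case: (pselect (Phi v k')) => [pk|npk]; last first.
      exists 1 => // e' _ _; rewrite y10 ?mulr0 ?subr0 //.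
      by apply/memPh.
    have := yv0 _ pk; have := hy1 k'; set a := f k' _; set b := f k' _ => a0 b0.
    exists (b / (a + 1)); first by apply: divr_gt0 => //; lra.
    move=> e' e'0; rewrite ler_pdivlMr; last by lra.
    move=> h; have : e' * a + e' <= b by lra.
    lra.
  pose u := lcomb 1 (- eps) v f1.
  pose yu := lcomb 1 (- eps) yv y1.
  have su : sol u yu.
    move=> k'; have -> : pr u yu = lcomb 1 (- eps) (pr v yv) (pr f1 y1) by apply/funext => -[].
    by rewrite lf; have := heps k'; lra.
  have [h1' h2'] := solC 1 eps u f1 yu (lcomb 1 1 yw y2) ler01 (ltW eps0) su hs.
  have ev : lcomb 1 eps u f1 = v by apply/funext => i; rewrite /u /lcomb; ring.
  rewrite ev in h1' h2'; exists (lcomb 1 eps yu (lcomb 1 1 yw y2)); split=> //.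
  rewrite h2' hs'; have := su x; have := yw0 _ px; have := hy2 x => a1 a2 a3.
  have : 0 < eps * (1 * f x (pr w yw) + 1 * f x (pr f2 y2)) by apply: mulr_gt0 => //; lra.
  lra.
apply: edef_eq (edefU (_ : edef (V `&` M)) (_ : edef [set v | exists Psi : {set F}, D Psi v])).
- move=> v; split.
  + case=> [[Vv [Kv [y [hy hy0]]]]|[Psi]]; last first.
      by rewrite /D; case: asboolP => // _ [Cv [Vv _]].
    split=> //.
    (* All inequalities that are strict at [w] are strict at [v], so [v - eps w] remains in [K];
       adding [eps w] back lands in [C]. *)
    have [eps eps0 heps] : exists2 eps, 0 < eps &
        forall k, 0 <= f k (pr v y) - eps * f k (pr w yw).
      apply: small_eps => k'; case: (pselect (Phi w k')) => [pk|npk]; last first.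
        exists 1 => // e' e'0 _; have := hy k'; have : f k' (pr w yw) <= 0.
          by rewrite leNgt; apply/negP => h; apply: npk; exists yw.
        by have := hyw k'; nra.
      have := hy0 _ pk; have := hyw k'; set a := f k' _; set b := f k' _ => a0 b0.
      exists (b / (a + 1)); first by apply: divr_gt0 => //; lra.
      move=> e' e'0; rewrite ler_pdivlMr; last by lra.
      move=> h; have : e' * a + e' <= b by lra.
      lra.
    have Ku : K (lcomb 1 (- eps) v w).
      apply/hK; exists (lcomb 1 (- eps) y yw) => k'.
      have -> : pr (lcomb 1 (- eps) v w) (lcomb 1 (- eps) y yw) =
        lcomb 1 (- eps) (pr v y) (pr w yw) by apply/funext => -[].
      by rewrite lf; have := heps k'; lra.
    have := KC _ _ Ku (sV.2 _ _ _ _ Vv Vw) eps0; congr C.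
    by apply/funext => i; rewrite /lcomb; ring.
  + move=> [Cv Vv]; have Kv := CK _ Cv Vv.
    have [y [hy hy0]] := solmax _ Kv.
    case: (boolP (PhS w \subset PhS v)) => [/fintype.subsetP h|h].
      left; split=> //; split=> //; exists y; split=> // k' pk; apply: hy0.
      by apply/memPh/h/memPh.
    right; exists (PhS v); rewrite /D asboolT; last by exists v.
    split=> //; split=> //; exists v, (fun=> 0); split=> //.
      exists y; split=> // k' /memPh nk; apply/eqP.
      by rewrite eq_le hy andbT leNgt; apply/negP => h'; apply: nk; exists y.
    by apply/funext => i; rewrite /lcomb; ring.
- apply: edefI => //.
  apply: edefI.
    by apply: (@basic_edef true); apply: basic_weak; exists Y, F, s, f; split=> // [k'|v];
      rewrite ?ls // hK; split=> -[y hy]; exists y => k'; have := hy k'; rewrite ls.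
  apply: (edef_eq _ (@edef_ex I Y [set z | (forall k, 0 <= f k z) /\
      forall k, Phi w k -> 0 < f k z] _)) => //.
  apply: edefI.
    by apply: edef_bigI => k'; apply: (@basic_edef true); apply: basic_ge.
  apply: edef_bigI => k'; case: (pselect (Phi w k')) => pk; last first.
    by apply: edef_eq (basic_edef (basicT true _)) => z; split.
  apply: edef_eq (basic_edef (@basic_gt _ _ (lf k'))) => z /=.
  by split=> // /(_ pk).
- apply: edef_bigU => Psi; rewrite /D; case: asboolP => [gP|_]; last exact: edef0.
  (* [w] lies in [V] but not in [V' Psi], so it extends every independent family of [V' Psi]: the
     dimension drops. *)
  apply: IH => // -[u [iu uV]]; apply: hV; exists (fcons w u); split.
    apply: (indep_cons _ iu) => // c hc; apply: (goodV' _ gP).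
    suff -> : w = (fun i => \sum_j c j * u j i) by apply: subsp_sum.
    by apply/funext.
  by move=> j; case: (unliftP ord0 j) => [j'|] ->; rewrite ?fconsS ?fcons0 //; case: (uV j').
Qed.

(** [K] relaxes the strict inequalities; a positive multiple of [w], which satisfies them strictly,
    restores strictness. *)
Lemma basic_closure (I : finType) (B : set (I -> rat)) w :
  basic true B -> B w ->
  exists K, [/\ basic false K, K (fun=> 0), forall v, B v -> K v &
    forall v e, K v -> 0 < e -> B (lcomb 1 e v w)].
Proof.
move=> [Y [F [s [f [lf _ hB]]]]] /hB[yw hw].
exists [set v | exists y, forall k, sgnok false (f k (pr v y))]; split.
- by exists Y, F, (fun=> false), f.
- exists (fun=> 0) => k; have -> : pr (fun=> 0) (fun=> 0) = (fun=> 0) :> (I + Y -> rat).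
    by apply/funext => -[].
  by rewrite islin0.
- by move=> v /hB[y hy]; exists y => k; have := hy k; rewrite /sgnok; case: (s k) => // /ltW.
- move=> v e [y hy] e0; apply/hB; exists (lcomb 1 e y yw) => k.
  have -> : pr (lcomb 1 e v w) (lcomb 1 e y yw) = lcomb 1 e (pr v y) (pr w yw).
    by apply/funext => -[].
  rewrite lf mul1r; have := hy k; have := hw k; rewrite /sgnok; case: (s k) => h1 h2.
    by rewrite ltr_wpDl // mulr_gt0.
  by rewrite addr_ge0 // mulr_ge0 // ltW.
Qed.

(** Trades a cone with an arbitrary boundary for a non-strict system, at the price of a small
    multiple of the sum of the [q j]. Applied to the period cone of each edge, it lets flows be
    described by non-strict inequalities only. *)
Lemma edef_hull (I : finType) (C : set (I -> rat)) k (q : 'I_k -> I -> rat) :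
  ccone C -> edef C -> (forall j, C (q j)) ->
  exists K, [/\ basic false K,
    forall v, C v -> (exists c : 'I_k -> rat, forall i, v i = \sum_j c j * q j i) -> K v &
    forall v e, K v -> 0 < e -> C (lcomb 1 e v (fun i => \sum_j q j i))].
Proof.
move=> cC eC hq; have [C0 hC] := cC.
pose W := [set v : I -> rat | exists c : 'I_k -> rat, forall i, v i = \sum_j c j * q j i].
have W0 : W (fun=> 0).
  by exists (fun=> 0) => i; rewrite big1 // => j _; rewrite mul0r.
have eW : edef W.
  apply: (edef_eq _ (@edef_ex I 'I_k [set z | forall i, z (inl i) - \sum_j z (inr j) * q j i = 0] _)).
    move=> v; split=> -[c hc].
      by exists c => i; have := hc i => /=; lra.
    by exists c => i /=; rewrite hc subrr.
  apply: edef_bigI => i; apply: (@basic_edef true).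
  apply: (@basic_zero _ _ (fun z : I + 'I_k -> rat => z (inl i) - \sum_j z (inr j) * q j i)).
  apply: islin_add; first exact: islin_coord.
  apply/islin_opp/islin_sum => j a b u v; rewrite /lcomb; ring.
have [T [B [hB hT]]] := edefI eC eW.
have /choice[K hK] : forall t, exists K, [/\ basic false K, K (fun=> 0), forall v, B t v -> K v &
    exists w, [/\ C w, W w & forall v e, K v -> 0 < e -> C (lcomb 1 e v w)]].
  move=> t; case: (pselect (exists w, B t w)) => [[w Bw]|nB].
    have [K [h1 h2 h3 h4]] := basic_closure (hB t) Bw.
    have BC v : B t v -> C v /\ W v by move=> Bv; apply/hT; exists t.
    exists K; split=> //; exists w; have [Cw Ww] := BC _ Bw; split=> // v e Kv e0.
    by have [] := BC _ (h4 v e Kv e0).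
  (* An empty piece contributes only the zero vector. *)
  exists [set v | forall i, v i = 0]; split=> //.
  - by apply: basic_bigI => i; apply: basic_zero.
  - by move=> v Bv; exfalso; apply: nB; exists v.
  - exists (fun=> 0); split=> // v e /= v0 _; move: C0; congr C.
    by apply/funext => i; rewrite /lcomb v0; ring.
have /choice[w hw] : forall t, exists w, [/\ C w, W w & forall v e, K t v -> 0 < e -> C (lcomb 1 e v w)].
  by move=> t; have [] := hK t.
have /choice[c hc] : forall t, exists c : 'I_k -> rat, forall i, w t i = \sum_j c j * q j i.
  by move=> t; have [] := hw t.
(* A single projected system is required, so the relaxed pieces are added up rather than united;
   each contains 0, so the sum contains them all. *)
exists [set v | exists u : T * I -> rat, (forall i, v i - \sum_t u (t, i) = 0) /\
   forall t, K t (fun i => u (t, i))]; split.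
- apply: (basic_eq _ (@basic_ex false I (T * I)%type [set z | (forall i, z (inl i) - \sum_t z (inr (t, i)) = 0) /\
   forall t, K t (fun i => z (inr (t, i)))] _)) => //.
  apply: basicI.
    apply: basic_bigI => i.
    apply: (@basic_zero _ _ (fun z : I + T * I -> rat => z (inl i) - \sum_t z (inr (t, i)))).
    apply: islin_add; first exact: islin_coord.
    by apply/islin_opp/islin_sum => t; exact: islin_coord.
  apply: basic_bigI => t.
  by apply: (basic_pre (g := fun (z : I + T * I -> rat) i => z (inr (t, i)))); case: (hK t).
- move=> v Cv Wv; have /hT[t Bt] : (C `&` W) v by [].
  exists (fun x => if x.1 == t then v x.2 else 0); split=> [i|t'] /=.
    by rewrite -big_mkcond big_pred1_eq subrr.
  by case: eqP => [->|_]; have [h1 h2 h3 _] := hK t; [apply: h3|have [] := hK t'].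
- move=> v e [u [eu hu]] e0.
  (* The vectors [w t] are combinations of the [q j] with coefficients of any sign. For small [d],
     the remainder of [e] times the sum of the [q j] after subtracting [d] times the sum of the
     [w t] has nonnegative coefficients. *)
  have [d d0 hd] : exists2 d, 0 < d & forall j, 0 <= e - d * \sum_t c t j.
    apply: small_eps => j; have h := ler_norm (\sum_t c t j).
    exists (e / (`|\sum_t c t j| + 1)).
      by apply: divr_gt0 => //; have := normr_ge0 (\sum_t c t j); lra.
    move=> d d0; rewrite ler_pdivlMr; last by have := normr_ge0 (\sum_t c t j); lra.
    by move=> h1; have : d * \sum_t c t j <= d * `|\sum_t c t j|; [rewrite ler_pM2l|lra].
  have h1 : C (fun i => \sum_t 1 * lcomb 1 d (fun i => u (t, i)) (w t) i).
    apply: ccone_sum => // t; have [_ _] := hw t; exact.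
  have h2 : C (fun i => \sum_j (e - d * \sum_t c t j) * q j i) by apply: ccone_sum.
  have := hC 1 1 _ _ ler01 ler01 h1 h2; congr C; apply/funext => i.
  rewrite /lcomb; under eq_bigr do rewrite !mul1r.
  rewrite big_split /= -mulr_sumr.
  under [X in d * X]eq_bigr do rewrite hc.
  rewrite exchange_big /=.
  have -> : v i = \sum_t u (t, i) by have := eu i; lra.
  have -> : \sum_j (e - d * \sum_t c t j) * q j i =
     e * (\sum_j q j i) - d * \sum_j \sum_t c t j * q j i.
    rewrite !mulr_sumr -sumrB; apply: eq_bigr => j _.
    by rewrite mulrBl -mulrA mulr_suml.
  ring.
Qed.

(** * Almost-full relations *)

(* Transitivity is not assumed; in particular the arguments below go through  *)
(* Ramsey's theorem instead of using a quasi-order.                           *)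
Definition af (A : Type) (D : A -> Prop) (R : A -> A -> Prop) : Prop :=
  forall f : nat -> A, (forall n, D (f n)) ->
    exists i j, (i < j)%N /\ R (f i) (f j).

Definition incr (h : nat -> nat) := forall i j, (i < j)%N -> (h i < h j)%N.

Lemma incrP (h : nat -> nat) : (forall i, (h i < h i.+1)%N) -> incr h.
Proof.
move=> hh i j; elim: j => // j IH; rewrite ltnS leq_eqVlt => /orP[/eqP->//|/IH].
by move=> h1; exact: ltn_trans (hh j).
Qed.

Lemma incr_le (h : nat -> nat) : incr h -> forall i j, (i <= j)%N -> (h i <= h j)%N.
Proof.
by move=> hh i j; rewrite leq_eqVlt => /orP[/eqP->//|/hh/ltnW].
Qed.

Lemma infinite_incr (Q : nat -> Prop) :
  (forall N, exists m, (N <= m)%N /\ Q m) -> exists s, incr s /\ forall m, Q (s m).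
Proof.
move=> /choice[g hg]; pose s := fix s m := if m is m'.+1 then g (s m').+1 else g 0%N.
exists s; split; last by case=> [|m]; apply: (hg _).2.
by apply: incrP => i; exact: (hg _).1.
Qed.

(** Otherwise each index is related to only finitely many later ones, and a subsequence jumping
    beyond these bounds has no related pair. *)
Lemma af_infinite (A : Type) (D : A -> Prop) (R : A -> A -> Prop) (f : nat -> A) :
  af D R -> (forall n, D (f n)) ->
  exists n, forall N, exists m, (N <= m)%N /\ R (f n) (f m).
Proof.
move=> haf hD; apply: contrapT => h.
have /choice[N hN] : forall n, exists N, forall m, (N <= m)%N -> ~ R (f n) (f m).
  move=> n; apply: contrapT => h1; apply: h; exists n => N; apply: contrapT => h2.
  by apply: h1; exists N => m Nm Rm; apply: h2; exists m.
pose M n := (\max_(i < n.+1) N i)%N.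
pose s := fix s m := if m is m'.+1 then maxn (s m').+1 (M (s m')) else 0%N.
have si : incr s by apply: incrP => i /=; rewrite leq_maxl.
have [i [j [ij]]] := haf (f \o s) (fun n => hD _); apply: (hN (s i)).
apply: leq_trans (incr_le si ij); rewrite /= leq_max; apply/orP; right.
exact: (@leq_bigmax _ (fun k : 'I_(s i).+1 => N k) ord_max).
Qed.

(** Ramsey's argument: choose a term related to infinitely many later ones, continue inside the
    subsequence of those, and collect the chosen terms. *)
Lemma af_perfect (A : Type) (D : A -> Prop) (R : A -> A -> Prop) (f : nat -> A) :
  af D R -> (forall n, D (f n)) ->
  exists h, incr h /\ forall i j, (i < j)%N -> R (f (h i)) (f (h j)).
Proof.
move=> haf hD.
have step : forall s : {s | incr s}, exists ns : nat * {s | incr s},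
    [/\ exists a, ns.1 = sval s a, forall m, exists b, sval ns.2 m = sval s b,
        forall m, (ns.1 < sval ns.2 m)%N & forall m, R (f ns.1) (f (sval ns.2 m))].
  move=> [s si] /=; have [n hn] := af_infinite (f := f \o s) haf (fun n => hD _).
  have [t [ti ht]] : exists t, incr t /\ forall m, (n < t m)%N /\ R (f (s n)) (f (s (t m))).
    apply: (@infinite_incr (fun m => (n < m)%N /\ R (f (s n)) (f (s m)))) => N; have [m [hm hR]] := hn (maxn N n.+1).
    by exists m; move: hm; rewrite geq_max => /andP[-> ->].
  have sti : incr (s \o t) by move=> i j ij /=; apply/si/ti.
  exists (s n, exist _ _ sti); split=> /=.
  - by exists n.
  - by move=> m; exists (t m).
  - by move=> m; apply: si; have [] := ht m.
  - by move=> m; have [] := ht m.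
have {step}[S hS] := choice step.
have idi : incr id by [].
pose st k := iter k (fun s => (S s).2) (exist _ _ idi).
have sub k l : (k <= l)%N -> forall m, exists b, sval (st l) m = sval (st k) b.
  elim: l => [|l IH]; first by rewrite leqn0 => /eqP-> m; exists m.
  rewrite leq_eqVlt => /orP[/eqP-> m|kl m]; first by exists m.
  have [_ /(_ m)[b eb] _ _] := hS (st l).
  by have [b' eb'] := IH kl b; exists b'; rewrite -eb' -eb.
have main i j : (i < j)%N -> ((S (st i)).1 < (S (st j)).1)%N /\
    R (f (S (st i)).1) (f (S (st j)).1).
  move=> ij; have [[a ->] _ _ _] := hS (st j).
  have [b ->] := sub _ _ ij a.
  by have [_ _ h1 h2] := hS (st i).
exists (fun k => (S (st k)).1); split=> i j ij; exact: (main i j ij).1 || exact: (main i j ij).2.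
Qed.

Lemma af_and (A : Type) (D : A -> Prop) (R R' : A -> A -> Prop) :
  af D R -> af D R' -> af D (fun x y => R x y /\ R' x y).
Proof.
move=> h h' f hD; have [s [si hs]] := af_perfect h hD.
have [i [j [ij hij]]] := h' (f \o s) (fun n => hD _).
by exists (s i), (s j); split; [exact: si|split=> //; exact: hs].
Qed.

Lemma af_pre (A B : Type) (D : A -> Prop) (D' : B -> Prop) (g : B -> A)
    (R : A -> A -> Prop) :
  af D R -> (forall x, D' x -> D (g x)) -> af D' (fun x y => R (g x) (g y)).
Proof. by move=> h hg f hD; apply: (h (g \o f)) => n; exact/hg/hD. Qed.

Lemma af_sub (A : Type) (D D' : A -> Prop) (R R' : A -> A -> Prop) :
  af D R -> (forall x, D' x -> D x) ->
  (forall x y, D' x -> D' y -> R x y -> R' x y) -> af D' R'.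
Proof.
move=> h hD hR f hf; have [i [j [ij]]] := h f (fun n => hD _ (hf n)).
by exists i, j; split=> //; apply: hR.
Qed.

Lemma af_leq : af (fun=> True) leq.
Proof.
move=> f _.
have : forall n f, (f 0%N <= n)%N -> exists i j : nat, (i < j)%N /\ (f i <= f j)%N.
  elim=> [|n IH] g g0.
    by exists 0%N, 1%N; split=> //; apply: leq_trans g0 _.
  have [h|h] := leqP (g 0%N) (g 1%N); first by exists 0%N, 1%N.
  have [i [j [ij hij]]] := IH (g \o succn) (ltac:(rewrite /=; lia)).
  by exists i.+1, j.+1.
by move=> /(_ (f 0%N) f (leqnn _)).
Qed.

Lemma dickson (I : finType) :
  af (fun=> True) (fun x y : I -> nat => forall i, (x i <= y i)%N).
Proof.
suff h : forall l : seq I, af (fun=> True) (fun x y : I -> nat => forall i, i \in l -> (x i <= y i)%N).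
  by apply: af_sub (h (enum I)) _ _ => // x y _ _ xy i; apply: xy; rewrite mem_enum.
elim=> [|i l IH]; first by move=> f _; exists 0%N, 1%N.
have hi : af (fun=> True) (fun x y : I -> nat => (x i <= y i)%N).
  by apply: (af_pre (g := fun x : I -> nat => x i) af_leq).
apply: af_sub (af_and hi IH) _ _ => // x y _ _ [h1 h2] j.
by rewrite inE => /orP[/eqP->//|/h2].
Qed.

(** * Higman's lemma and finite bases *)

Inductive emb (A : Type) (R : A -> A -> Prop) : seq A -> seq A -> Prop :=
  | emb_nil w : emb R [::] w
  | emb_skip u b w : emb R u w -> emb R u (b :: w)
  | emb_cons a u b w : R a b -> emb R u w -> emb R (a :: u) (b :: w).

Fixpoint allp (A : Type) (D : A -> Prop) (w : seq A) : Prop :=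
  if w is a :: w' then D a /\ allp D w' else True.

(** Nash-Williams' minimal bad sequence: words are chosen one after the other, each as short as
    possible. Along a subsequence with pairwise related heads, passing to the tails gives a smaller
    bad sequence. The perfect subsequence takes the place of transitivity. *)
Lemma higman (A : Type) (D : A -> Prop) (R : A -> A -> Prop) :
  af D R -> af (allp D) (emb R).
Proof.
move=> haf f0 hf0; apply: contrapT => nf0.
pose bad (f : nat -> seq A) := (forall n, allp D (f n)) /\
  forall i j, (i < j)%N -> ~ emb R (f i) (f j).
pose badext (p : seq (seq A)) := exists f, bad f /\ forall i, (i < size p)%N -> f i = nth [::] p i.
have step (p : {p | badext p}) : exists w, badext (rcons (sval p) w) /\
    forall w', badext (rcons (sval p) w') -> (size w <= size w')%N.
  case: p => p /= [f [bf hf]].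
  pose Q n := `[< exists w, size w = n /\ badext (rcons p w) >].
  have exQ : exists n, Q n.
    exists (size (f (size p))); apply/asboolP; exists (f (size p)); split=> //.
    exists f; split=> // i; rewrite size_rcons ltnS leq_eqVlt nth_rcons => /orP[/eqP->|ip].
      by rewrite ltnn eqxx.
    by rewrite ip hf.
  case: (ex_minnP exQ) => n /asboolP[w [<- bw]] wmin; exists w; split=> // w' bw'.
  by apply: wmin; apply/asboolP; exists w'.
have [W hW] := choice step.
have b0 : badext [::].
  exists f0; split=> //; split=> // i j ij e; apply: nf0; by exists i, j.
pose nx (p : {p | badext p}) : {p | badext p} := exist _ (rcons (sval p) (W p)) (hW p).1.
pose st n := iter n nx (exist _ _ b0).
pose g n := W (st n).
have eP n : sval (st n) = mkseq g n.
  by elim: n => // n IH; have -> : mkseq g n.+1 = rcons (mkseq g n) (g n);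
    [rewrite /mkseq -addn1 iotaD map_cat cats1|rewrite -IH].
have gext n : exists f, bad f /\ forall i, (i < n)%N -> f i = g i.
  have [f [bf hf]] := svalP (st n); exists f; split=> // i ni.
  by rewrite hf eP ?size_mkseq // nth_mkseq.
have gbad : bad g.
  split=> [n|i j ij].
    have [f [[fD _] hf]] := gext n.+1; rewrite -hf //; exact: fD.
  have [f [[_ fb] hf]] := gext j.+1; rewrite -hf; last by lia.
  by rewrite -hf //; exact: fb.
have gmin n f : bad f -> (forall i, (i < n)%N -> f i = g i) -> (size (g n) <= size (f n))%N.
  move=> bf hf; apply: (hW (st n)).2; exists f; split=> // i.
  rewrite size_rcons eP size_mkseq nth_rcons size_mkseq ltnS leq_eqVlt => /orP[/eqP->|ip].
    by rewrite ltnn eqxx.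
  by rewrite ip nth_mkseq // hf.
have /choice[ht hg] : forall n, exists ht : A * seq A, g n = ht.1 :: ht.2.
  move=> n; case e : (g n) => [|a w]; last by exists (a, w).
  by exfalso; apply: (gbad.2 n n.+1) => //; rewrite e; constructor.
have hD n : D (ht n).1 by have := gbad.1 n; rewrite hg => -[].
have [h [hi hR]] := af_perfect haf hD.
pose f' i := if (i < h 0%N)%N then g i else (ht (h (i - h 0%N)%N)).2.
have bf' : bad f'.
  split=> [n|i j ij]; rewrite /f'.
    case: ifP => _; first exact: gbad.1.
    by have := gbad.1 (h (n - h 0)%N); rewrite hg => -[].
  case: ifP => ih; case: ifP => jh; first exact: gbad.2.
  - move=> e; apply: (gbad.2 i (h (j - h 0)%N)).
      by apply: leq_trans ih _; apply: incr_le.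
    by rewrite (hg (h _)); constructor.
  - by lia.
  - move=> e; apply: (gbad.2 (h (i - h 0)%N) (h (j - h 0)%N)); first by apply: hi; lia.
    by rewrite !(hg (h _)); constructor=> //; apply: hR; lia.
have := gmin (h 0%N) f' bf' (fun i ih => ltac:(by rewrite /f' ih)).
by rewrite /f' ltnn subnn hg /= ltnn.
Qed.

(** If no finite list sufficed, elements chosen greedily, each above none of the earlier ones, would
    form a sequence without a related pair. *)
Lemma af_cover (A : Type) (D : A -> Prop) (R : A -> A -> Prop) :
  af D R -> exists k (g : 'I_k -> A), (forall i, D (g i)) /\
    forall y, D y -> exists i, R (g i) y.
Proof.
move=> haf.
suff [l [lD hl]] : exists l : seq A, allp D l /\ forall y, D y ->
    exists i : 'I_(size l), R (tnth (in_tuple l) i) y.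
  exists (size l), (tnth (in_tuple l)); split=> // i.
  have : forall (l : seq A) (i : 'I_(size l)), allp D l -> D (tnth (in_tuple l) i).
    move=> {hl lD i}l; elim: l => [|a l IH] [[|i] hi] //= [Da Dl]; first by rewrite (tnth_nth a).
    have := IH (Ordinal (hi : (i < size l)%N)) Dl.
    by rewrite !(tnth_nth a).
  exact.
apply: contrapT => h.
have /choice[Y hY] : forall l : {l : seq A | allp D l}, exists y, D y /\
    forall i : 'I_(size (sval l)), ~ R (tnth (in_tuple (sval l)) i) y.
  move=> [l Dl]; apply: contrapT => h'; apply: h; exists l; split=> // y Dy.
  apply: contrapT => h2; apply: h'; exists y; split=> // i hi; apply: h2; by exists i.
have cD (l : {l | allp D l}) : allp D (Y l :: sval l) by split; [exact: (hY l).1|exact: svalP].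
pose st n := iter n (fun l => exist (allp D) _ (cD l)) (exist (allp D) [::] I).
have [i [j [ij]]] := haf (fun n => Y (st n)) (fun n => (hY _).1).
suff [k ->] : exists k : 'I_(size (sval (st j))), Y (st i) = tnth (in_tuple (sval (st j))) k.
  exact: (hY (st j)).2.
elim: j ij => // j IH; rewrite ltnS leq_eqVlt => /orP[/eqP->|ij].
  by exists ord0; rewrite (tnth_nth (Y (st i))).
have [k ->] := IH ij; exists (lift ord0 k).
by rewrite !(tnth_nth (Y (st i))).
Qed.

(** * Eulerian circuits *)

Section Euler.
Local Open Scope nat_scope.
Variables (E : finType) (N : eqType) (src tgt : E -> N).

Fixpoint walk (a : N) (w : seq E) (b : N) : Prop :=
  if w is e :: w' then src e = a /\ walk (tgt e) w' b else a = b.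

Lemma walk_cat a w b w' c : walk a w b -> walk b w' c -> walk a (w ++ w') c.
Proof. by elim: w a => [|e w IH] a /= => [->//|[-> /IH h] /h]. Qed.

Lemma walk_catP a w w' c : walk a (w ++ w') c -> exists2 b, walk a w b & walk b w' c.
Proof.
elim: w a => [|e w IH] a /=; first by exists a.
by move=> [<- /IH[b h1 h2]]; exists b.
Qed.

Lemma walk_fun a w b c : walk a w b -> walk a w c -> b = c.
Proof. by elim: w a => [|x u IH] a /= => [<-//|[_ h1] [_ h2]]; exact: IH h1 h2. Qed.

Definition inflow (th : E -> nat) p := \sum_e th e * (tgt e == p).
Definition outflow (th : E -> nat) p := \sum_e th e * (src e == p).

Lemma sum_dec (th : E -> nat) (e : E) (f : E -> nat) :
  0 < th e ->
  \sum_x th x * f x = \sum_x (th x - (x == e)) * f x + f e.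
Proof.
move=> h; rewrite (bigD1 e) //= [in RHS](bigD1 e) //= eqxx.
rewrite [X in _ = _ + X + _](eq_bigr (fun x => th x * f x)); first by nia.
by move=> x /negPf->; rewrite subn0.
Qed.

(** [th] is a flow with one extra unit leaving [a] and entering [b]. While [a] differs from [b] some
    edge leaves [a], and removing it moves the defect to its target. *)
Lemma trail (th : E -> nat) a b :
  (forall p, outflow th p + (b == p) = inflow th p + (a == p)) ->
  exists2 w, walk a w b & forall e, count_mem e w <= th e.
Proof.
move: {2}(\sum_e th e).+1 (ltnSn (\sum_e th e)) => n.
elim: n th a => // n IH th a hn bal.
have [->|ab] := eqVneq a b; first by exists [::].
have [e the ea] : exists2 e, 0 < th e & src e = a.
  have : 0 < outflow th a by have := bal a; rewrite eqxx eq_sym (negPf ab); lia.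
  rewrite lt0n sum_nat_eq0 negb_forall => /existsP[e]; rewrite implyTb muln_eq0 negb_or.
  by rewrite -lt0n eqb0 negbK => /andP[h /eqP]; exists e.
have [||w hw hc] := IH (fun x => th x - (x == e)) (tgt e).
- have := @sum_dec th e (fun=> 1) the; rewrite /=.
  under eq_bigr do rewrite muln1.
  under [X in _ = X + _]eq_bigr do rewrite muln1.
  lia.
- move=> p; have := bal p.
  have := @sum_dec th e (fun x => src x == p) the.
  have := @sum_dec th e (fun x => tgt x == p) the.
  rewrite -/(inflow _ _) -/(outflow _ _) -ea /inflow /outflow; lia.
exists (e :: w) => // x /=; have := hc x; rewrite eq_sym.
by case: eqP => [ex|_] /=; rewrite -?ex; lia.
Qed.

(** A longest closed walk within the capacities exhausts them: otherwise an edge with spare capacity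
    leaves a visited node, the residual flow is balanced, and a circuit through that edge can be
    spliced in. *)
Lemma euler (th : E -> nat) r :
  (forall p, outflow th p = inflow th p) ->
  (forall e, 0 < th e -> exists2 w, walk r w (src e) & forall x, x \in w -> 0 < th x) ->
  exists2 w, walk r w r & forall e, count_mem e w = th e.
Proof.
move=> bal conn.
pose Q n := `[< exists2 w, walk r w r & (forall e, count_mem e w <= th e) /\ size w = n >].
have size_sum w : size w = \sum_e count_mem e w.
  elim: w => [|x w IH] /=; first by rewrite big1.
  by rewrite big_split /= -IH (bigD1 x) //= eqxx big1 // => e; rewrite eq_sym => /negPf->.
have Q0 : exists n, Q n by exists 0; apply/asboolP; exists [::].
have Qb n : Q n -> n <= \sum_e th e.
  by move=> /asboolP[w _ [hc <-]]; rewrite size_sum; apply: leq_sum.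
case: (ex_maxnP Q0 Qb) => n /asboolP[w hw [hc hs]] wmax.
exists w => // e0; apply/eqP; rewrite eqn_leq hc /= leqNgt; apply/negP => h0.
have vis e : e \in w -> exists w1 w2, w = w1 ++ w2 /\ walk r w1 (tgt e).
  move=> ew; case/splitPr: ew hw => p1 p2 /walk_catP[b h1 [h2 h3]].
  exists (rcons p1 e), p2; rewrite cat_rcons -cats1; split=> //.
  by apply: walk_cat h1 _.
have [e the [w1 [w2 [ew hw1]]]] : exists2 e, count_mem e w < th e &
    exists w1 w2, w = w1 ++ w2 /\ walk r w1 (src e).
  have th0 : 0 < th e0 by lia.
  have [p hp pth] := conn _ th0.
  have v0 : exists w1 w2, w = w1 ++ w2 /\ walk r w1 r by exists [::], w.
  (* The first edge of the connecting path that is not exhausted starts at a visited node, because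
     exhausted edges of positive capacity occur on the walk. *)
  suff: forall a, (exists w1 w2, w = w1 ++ w2 /\ walk r w1 a) ->
      forall p, walk a p (src e0) -> (forall x, x \in p -> 0 < th x) ->
      exists2 e, count_mem e w < th e & exists w1 w2, w = w1 ++ w2 /\ walk r w1 (src e).
    by move=> h; apply: (h _ v0 _ hp pth).
  move=> a va {hp pth}p; elim: p a va => [|x p IH] a va /=.
    by move=> ea _; exists e0; rewrite -?ea.
  move=> [ax hp] pth; have [hx|hx] := ltnP (count_mem x w) (th x).
    by exists x; rewrite // ax.
  apply: IH hp _; last by move=> y yp; apply: pth; rewrite inE yp orbT.
  apply: vis; rewrite -has_pred1 has_count; apply: leq_trans hx.
  by apply: pth; rewrite inE eqxx.
pose rm x := th x - count_mem x w.
have balrm p : outflow rm p = inflow rm p.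
  have [f1 f2] : outflow th p = outflow rm p + outflow (fun x => count_mem x w) p /\
      inflow th p = inflow rm p + inflow (fun x => count_mem x w) p.
    rewrite /outflow /inflow -!big_split /=; split; apply: eq_bigr => x _;
    by rewrite -mulnDl subnK.
  have f3 : forall a b v, walk a v b ->
      outflow (fun x => count_mem x v) p + (b == p) = inflow (fun x => count_mem x v) p + (a == p).
    move=> a b v; elim: v a => [|x v IH] a /=.
      by move=> ->; rewrite /outflow /inflow !big1.
    move=> [<- /IH]; rewrite /outflow /inflow.
    have s (f : E -> N) : \sum_e ((x == e) + count_mem e v) * (f e == p) =
        (f x == p) + \sum_e count_mem e v * (f e == p).
      under eq_bigr do rewrite mulnDl; rewrite big_split /= (bigD1 x) //= eqxx mul1n.
      by rewrite [X in _ + X + _]big1 ?addn0 // => y; rewrite eq_sym => /negPf->.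
    by rewrite !s; lia.
  by have := bal p; have := f3 _ _ _ hw; rewrite f1 f2; lia.
have rme : 0 < rm e by rewrite /rm; lia.
(* [e] is removed first, so that a trail from its target back to its source closes a circuit through
   it. *)
have [|v hv hcv] := @trail (fun x => rm x - (x == e)) (tgt e) (src e).
  move=> p; have := balrm p.
  have := @sum_dec rm e (fun x => src x == p) rme.
  have := @sum_dec rm e (fun x => tgt x == p) rme.
  by rewrite /inflow /outflow; lia.
have [b hb1 hb2] : exists2 b, walk r w1 b & walk b w2 r by apply: walk_catP; rewrite -ew.
have hw2 : walk (src e) w2 r.
  suff -> : src e = b by [].
  exact: walk_fun hw1 hb1.
have : Q (size (w1 ++ (e :: v) ++ w2)).
  apply/asboolP; exists (w1 ++ (e :: v) ++ w2); last split=> //.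
    by apply: walk_cat hw1 _; apply: walk_cat hw2 => /=.
  move=> x; have := hcv x; have := hc x.
  have : count_mem x w = count_mem x w1 + count_mem x w2 by rewrite ew count_cat.
  rewrite /rm !count_cat /= eq_sym.
  case: eqP => [<-|_] /=; last by lia.
  move: the; move: (count_mem e w) (count_mem e w1) (count_mem e w2) (count_mem e v) (th e).
  move=> c c1 c2 c3 t; clear=> h1 h2 h3 h4; lia.
move=> /wmax; rewrite -hs ew !size_cat /=; lia.
Qed.
End Euler.

(** * Vectors of naturals and cones of periodic sets *)

Definition addv (I : Type) (x y : I -> nat) : I -> nat := fun i => (x i + y i)%N.
Definition zv (I : Type) : I -> nat := fun=> 0%N.
Definition scv (I : Type) (n : nat) (x : I -> nat) : I -> nat := fun i => (n * x i)%N.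
Definition toq (I : Type) (x : I -> nat) : I -> rat := fun i => (x i)%:R.
Arguments zv {I}.

Lemma addvC (I : Type) (x y : I -> nat) : addv x y = addv y x.
Proof. by apply/funext => i; rewrite /addv addnC. Qed.

Lemma addvA (I : Type) (x y z : I -> nat) : addv x (addv y z) = addv (addv x y) z.
Proof. by apply/funext => i; rewrite /addv addnA. Qed.

Lemma addvAC (I : Type) (x y z : I -> nat) : addv (addv x y) z = addv (addv x z) y.
Proof. by rewrite -!addvA (addvC y). Qed.

Lemma addvACA (I : Type) (x y z t : I -> nat) :
  addv (addv x y) (addv z t) = addv (addv x z) (addv y t).
Proof. by apply/funext => i; rewrite /addv addnACA. Qed.

Lemma add0v (I : Type) (x : I -> nat) : addv zv x = x.
Proof. by []. Qed.

Lemma addv0 (I : Type) (x : I -> nat) : addv x zv = x.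
Proof. by rewrite addvC. Qed.

Lemma addvI (I : Type) (x y z : I -> nat) : addv x y = addv x z -> y = z.
Proof.
by move=> e; apply/funext => i; have /(congr1 (@^~ i)) := e; rewrite /addv => /addnI.
Qed.

Lemma addv_pr (I J : Type) (x y : I -> nat) (z t : J -> nat) :
  addv (pr x z) (pr y t) = pr (addv x y) (addv z t).
Proof. by apply/funext => -[]. Qed.

Lemma scv_pr (I J : Type) n (x : I -> nat) (y : J -> nat) :
  scv n (pr x y) = pr (scv n x) (scv n y).
Proof. by apply/funext => -[]. Qed.

Lemma pr0 (I J : Type) : pr (@zv I) (@zv J) = zv.
Proof. by apply/funext => -[]. Qed.

Lemma le_addv (I : Type) (x y : I -> nat) :
  (forall i, (x i <= y i)%N) -> exists z, y = addv x z.
Proof.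
move=> h; exists (fun i => (y i - x i)%N); apply/funext => i.
by rewrite /addv subnKC.
Qed.

Lemma scvS (I : Type) n (x : I -> nat) : scv n.+1 x = addv x (scv n x).
Proof. by apply/funext => i; rewrite /scv mulSn. Qed.

Definition periodicv (I : Type) (P : set (I -> nat)) : Prop :=
  P zv /\ forall x y, P x -> P y -> P (addv x y).

Lemma periodic_scv (I : Type) (P : set (I -> nat)) n x : periodicv P -> P x -> P (scv n x).
Proof.
move=> [P0 PD] Px; elim: n => [|n IH]; last by rewrite scvS; apply: PD.
by congr P: P0; apply/funext => i; rewrite /scv mul0n.
Qed.

(** For periodic [P] this is the cone generated by [P]. Common multiples of denominators make it
    commute with intersections, and with preimages among nonnegative vectors. *)
Definition coneP (I : Type) (P : set (I -> nat)) : set (I -> rat) :=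
  [set v | exists N p, [/\ (0 < N)%N, P p & forall i, N%:R * v i = (p i)%:R]].

Lemma rat_nat (a : rat) : 0 <= a -> exists N m : nat, (0 < N)%N /\ N%:R * a = m%:R.
Proof.
move=> a0; exists `|denq a|%N, `|numq a|%N; split; first by rewrite absz_denq denq_gt0 || rewrite lt0n absz_eq0 denq_eq0.
have e (z : int) : 0 <= z -> (`|z|%N%:R : rat) = z%:~R.
  by move=> z0; rewrite -[in RHS](gez0_abs z0).
by rewrite !e ?denq_ge0 ?numq_ge0 // mulrC -numqE.
Qed.

Lemma rats_nat (T : finType) (a : T -> rat) : (forall t, 0 <= a t) ->
  exists (N : nat) (m : T -> nat), (0 < N)%N /\ forall t, N%:R * a t = (m t)%:R.
Proof.
move=> a0; have /choice[f hf] : forall t, exists Nm : nat * nat,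
    (0 < Nm.1)%N /\ Nm.1%:R * a t = Nm.2%:R.
  by move=> t; have [N [m h]] := rat_nat (a0 t); exists (N, m).
exists (\prod_t (f t).1)%N, (fun t => ((\prod_(u | u != t) (f u).1) * (f t).2)%N).
split; first by apply: prodn_gt0 => t; exact: (hf t).1.
by move=> t; rewrite (bigD1 t) //= mulnC !natrM -mulrA (hf t).2.
Qed.

Lemma coneP_ccone (I : Type) (P : set (I -> nat)) : periodicv P -> ccone (coneP P).
Proof.
move=> pP; have [P0 PD] := pP; split.
  by exists 1%N, zv; split=> // i; rewrite mulr0.
move=> a b u v a0 b0 [N [p [N0 Pp ep]]] [M [q [M0 Pq eq]]].
have [A [m [A0 em]]] := rat_nat a0; have [B [n [B0 en]]] := rat_nat b0.
exists (A * B * N * M)%N, (addv (scv (m * B * M) p) (scv (n * A * N) q)); split.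
- by rewrite !muln_gt0 A0 B0 N0.
- by apply: PD; apply: periodic_scv.
- move=> i; rewrite /lcomb /addv /scv natrD !natrM -em -en -ep -eq; ring.
Qed.

Lemma coneP_sub (I : Type) (P : set (I -> nat)) p : P p -> coneP P (toq p).
Proof. by move=> Pp; exists 1%N, p; split=> // i; rewrite mul1r. Qed.

Lemma coneP_ge0 (I : Type) (P : set (I -> nat)) v : coneP P v -> forall i, 0 <= v i.
Proof.
move=> [N [p [N0 _ e]]] i; rewrite -(pmulr_rge0 (x := N%:R)) ?ltr0n //.
by rewrite e ler0n.
Qed.

Lemma conePI (I : Type) (P Q : set (I -> nat)) v : periodicv P -> periodicv Q ->
  coneP (P `&` Q) v <-> coneP P v /\ coneP Q v.
Proof.
move=> pP pQ; split.
  by move=> [N [p [N0 [Pp Qp] e]]]; split; exists N, p.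
move=> [[N [p [N0 Pp ep]]] [M [q [M0 Qq eq]]]].
have e : scv M p = scv N q.
  apply/funext => i; apply/eqP; rewrite -(eqr_nat rat) /scv !natrM -ep -eq.
  by apply/eqP; ring.
exists (M * N)%N, (scv M p); split; first by rewrite muln_gt0 M0.
  by split; [|rewrite e]; apply: periodic_scv.
by move=> i; rewrite /scv !natrM -ep; ring.
Qed.

(** The linear extension [aq] is bundled so that cones of images and preimages can be described over
    the rationals. *)
Record amap (I J : Type) := AMap {
  an :> (I -> nat) -> J -> nat;
  aq : (I -> rat) -> J -> rat;
  an_add : forall x y, an (addv x y) = addv (an x) (an y);
  aq_lin : islinm aq;
  aq_nat : forall x, aq (toq x) = toq (an x)
}.

Lemma an0 (I J : Type) (g : amap I J) : g zv = zv.
Proof.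
have := an_add g zv zv; rewrite add0v => e; apply/funext => j.
by have /(congr1 (@^~ j)) := e; rewrite /addv /zv; lia.
Qed.

Lemma an_scv (I J : Type) (g : amap I J) n x : g (scv n x) = scv n (g x).
Proof.
elim: n => [|n IH]; last by rewrite !scvS an_add IH.
by rewrite -[RHS]/(zv) -(an0 g).
Qed.

Lemma aq_scale (I J : Type) (g : amap I J) (N : nat) v x :
  (forall i, N%:R * v i = (x i)%:R) -> forall j, N%:R * aq g v j = (g x j)%:R.
Proof.
move=> e j; have h := aq_lin g N%:R 0 v v.
have : aq g (lcomb N%:R 0 v v) = toq (g x).
  by rewrite -aq_nat; congr (aq g _); apply/funext => i; rewrite /lcomb mul0r addr0 e.
by rewrite h => /(congr1 (@^~ j)); rewrite /lcomb mul0r addr0.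
Qed.

Lemma periodic_pre (I J : Type) (g : amap I J) (P : set (J -> nat)) :
  periodicv P -> periodicv [set x | P (g x)].
Proof.
move=> [P0 PD]; split=> /= [|x y Px Py]; first by rewrite an0.
by rewrite an_add; apply: PD.
Qed.

Lemma periodic_img (I J : Type) (g : amap I J) (P : set (I -> nat)) :
  periodicv P -> periodicv [set g x | x in P].
Proof.
move=> [P0 PD]; split; first by exists zv => //; rewrite an0.
by move=> _ _ [x Px <-] [y Py <-]; exists (addv x y); [exact: PD|rewrite an_add].
Qed.

Lemma periodicI (I : Type) (P Q : set (I -> nat)) :
  periodicv P -> periodicv Q -> periodicv (P `&` Q).
Proof.
move=> [P0 PD] [Q0 QD]; split=> // x y [? ?] [? ?]; split; [exact: PD|exact: QD].
Qed.

Lemma coneP_pre (I : finType) (J : Type) (g : amap I J) (P : set (J -> nat)) v :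
  periodicv P ->
  coneP [set x | P (g x)] v <-> (forall i, 0 <= v i) /\ coneP P (aq g v).
Proof.
move=> pP; split.
  move=> h; split; first exact: coneP_ge0 h.
  by have [N [p [N0 Pp e]]] := h; exists N, (g p); split=> //; apply: aq_scale.
move=> [v0 [M [q [M0 Pq eq]]]]; have [N [m [N0 em]]] := rats_nat v0.
exists (M * N)%N, (scv M m); split; first by rewrite muln_gt0 M0.
  rewrite /= an_scv; have -> : scv M (g m) = scv N q; last exact: periodic_scv.
  apply/funext => j; apply/eqP; rewrite -(eqr_nat rat) /scv !natrM -eq -(aq_scale g em).
  by apply/eqP; ring.
by move=> i; rewrite /scv !natrM -em; ring.
Qed.

Lemma coneP_img (I J : Type) (g : amap I J) (P : set (I -> nat)) v :
  coneP [set g x | x in P] v <-> exists2 u, coneP P u & aq g u = v.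
Proof.
split.
  move=> [N [_ [N0 [p Pp <-] e]]]; exists (fun i => N%:R^-1 * (p i)%:R).
    exists N, p; split=> // i; rewrite mulrA divff ?mul1r //.
    by rewrite pnatr_eq0 -lt0n.
  have nz : (N%:R : rat) != 0 by rewrite pnatr_eq0 -lt0n.
  have e' i : N%:R * (N%:R^-1 * (p i)%:R) = (p i)%:R :> rat.
    by rewrite mulrA divff ?mul1r.
  by apply/funext => j; apply: (mulfI nz); rewrite e; exact: aq_scale.
move=> [u [N [p [N0 Pp e]]] <-]; exists N, (g p); split=> //; last exact: aq_scale.
by exists p.
Qed.

Lemma edef_ge0 (I : finType) : edef [set v : I -> rat | forall i, 0 <= v i].
Proof.
apply: edef_bigI => i; apply: (@basic_edef true); apply: basic_ge; exact: islin_coord.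
Qed.

Lemma edef_coneP_pre (I J : finType) (g : amap I J) (P : set (J -> nat)) :
  periodicv P -> edef (coneP P) -> edef (coneP [set x | P (g x)]).
Proof.
move=> pP eP; apply: edef_eq (edefI (edef_ge0 I) (edef_pre (aq_lin g) eP)) => v.
by rewrite coneP_pre.
Qed.

Lemma edef_coneP_img (I J : finType) (g : amap I J) (P : set (I -> nat)) :
  edef (coneP P) -> edef (coneP [set g x | x in P]).
Proof.
move=> eP; apply: edef_eq (edef_img (aq_lin g) eP) => v.
by rewrite coneP_img.
Qed.

Lemma edef_conePI (I : finType) (P Q : set (I -> nat)) : periodicv P -> periodicv Q ->
  edef (coneP P) -> edef (coneP Q) -> edef (coneP (P `&` Q)).
Proof.
move=> pP pQ eP eQ; apply: edef_eq (edefI eP eQ) => v.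
by rewrite conePI.
Qed.

Lemma edef_conePT (I : finType) : edef (coneP [set: I -> nat]).
Proof.
apply: edef_eq (edef_ge0 I) => v; split; last exact: coneP_ge0.
by move=> /rats_nat[N [m [N0 e]]]; exists N, m.
Qed.

(** * Good families *)

(* A family is a set of pieces (b, P), meant to satisfy b + P `<=` supp.      *)
Definition fam (I : Type) := (I -> nat) -> set (I -> nat) -> Prop.

(** The bases suffice: in a good family they absorb their periods, so this is also the union of all
    [b + P]. *)
Definition supp (I : Type) (F : fam I) : set (I -> nat) := [set b | exists P, F b P].

Definition dbl (I : Type) (F : fam I) : set (I + I -> nat) :=
  [set w : I + I -> nat | exists2 P, F (w \o inl) P & P (w \o inr)].

(** Not transitive in general: a period of the larger piece need not be one of the smaller piece. *)
Definition fle (I : Type) (x y : (I -> nat) * set (I -> nat)) : Prop :=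
  exists2 p, x.2 p & y.1 = addv x.1 p.

Definition good (I : finType) (F : fam I) : Prop :=
  [/\ forall b P, F b P -> periodicv P,
      forall b P p, F b P -> P p -> supp F (addv b p),
      af (fun x => F x.1 x.2) (@fle I) &
      forall b P, F b P -> edef (coneP P)].

(** One doubling is enough: the directions of [supp F] are read off from the cones of the pieces of
    [G]. *)
Definition good2 (I : finType) (F : fam I) : Prop :=
  good F /\ exists2 G, good G & supp G = dbl F.

(* The periods of the pieces are themselves presented by families; [Fl] is    *)
(* what is known about the doubled relations of the latter.                   *)
Definition good3 (I : finType) (Fl : (I -> nat) -> set (I + I -> nat) -> Prop)
    (F : fam I) : Prop :=
  good2 F /\ forall b P, F b P ->
    exists H, [/\ good2 H, supp H = P, H zv P & Fl b (dbl H)].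

(** The transfer goes along a relation, since the data behind a piece, such as its word or the set
    it is a preimage of, are only known to exist. *)
Lemma af_link (A B : Type) (D : A -> Prop) (R : A -> A -> Prop) (D' : B -> Prop)
    (R' : B -> B -> Prop) (link : A -> B -> Prop) :
  af D R -> (forall b, D' b -> exists2 a, D a & link a b) ->
  (forall a b a' b', link a b -> link a' b' -> R a a' -> R' b b') -> af D' R'.
Proof.
move=> haf hl hR f hf.
have /choice[g hg] : forall n, exists a, D a /\ link a (f n).
  by move=> n; have [a] := hl _ (hf n); exists a.
have [i [j [ij h]]] := haf g (fun n => (hg n).1).
by exists i, j; split=> //; apply: hR h; exact: (hg _).2.
Qed.

Definition asum (I J K L : Type) (g : amap I J) (h : amap K L) : amap (I + K) (J + L).
Proof.
refine (@AMap (I + K) (J + L) (fun w => pr (g (w \o inl)) (h (w \o inr)))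
  (fun w => pr (aq g (w \o inl)) (aq h (w \o inr))) _ _ _).
- by move=> x y; rewrite addv_pr -!an_add.
- move=> a b u v; apply/funext => -[j|l] /=.
    by rewrite -[RHS]/(lcomb a b (aq g (u \o inl)) (aq g (v \o inl)) j) -aq_lin.
  by rewrite -[RHS]/(lcomb a b (aq h (u \o inr)) (aq h (v \o inr)) l) -aq_lin.
- move=> x; have e1 : aq g (toq x \o inl) = toq (g (x \o inl)) by rewrite -aq_nat.
  have e2 : aq h (toq x \o inr) = toq (h (x \o inr)) by rewrite -aq_nat.
  by rewrite e1 e2; apply/funext => -[].
Defined.

(** Pairs of vectors are functions on a sum type, so every rearrangement of blocks is a
    precomposition. *)
Definition areindex (I J : Type) (s : J -> I) : amap I J.
Proof. by refine (@AMap I J (fun w => w \o s) (fun w => w \o s) _ _ _). Defined.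

Arguments asum : simpl never.
Arguments areindex : simpl never.

Section Ops.
Variables (I J : finType).

Definition fpre (g : amap I J) (c : J -> nat) (F : fam J) : fam I :=
  fun a Q => exists2 P, F (addv c (g a)) P & Q = [set x | P (g x)].

Definition fimg (g : amap I J) (c : J -> nat) (F : fam I) : fam J :=
  fun a Q => exists b P, [/\ F b P, a = addv c (g b) & Q = [set g x | x in P]].

Definition finter (F G : fam I) : fam I :=
  fun a Q => exists P P', [/\ F a P, G a P' & Q = P `&` P'].

Definition funion (F G : fam I) : fam I := fun a Q => F a Q \/ G a Q.

Definition ffull : fam I := fun _ Q => Q = setT.

Definition fempty : fam I := fun _ _ => False.

Lemma supp_pre g c F : supp (fpre g c F) = [set a | supp F (addv c (g a))].
Proof.
apply/funext => a; apply/propext; split=> [[_ [P hP _]]|[P hP]]; first by exists P.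
by exists [set x | P (g x)], P.
Qed.

Lemma supp_img g c F : supp (fimg g c F) = [set addv c (g b) | b in supp F].
Proof.
apply/funext => a; apply/propext; split.
  by move=> [_ [b [P [hP -> _]]]]; exists b => //; exists P.
by move=> [b [P hP] <-]; exists [set g x | x in P], b, P.
Qed.

Lemma supp_inter F G : supp (finter F G) = supp F `&` supp G.
Proof.
apply/funext => a; apply/propext; split.
  by move=> [_ [P [P' [? ? _]]]]; split; [exists P|exists P'].
by move=> [[P ?] [P' ?]]; exists (P `&` P'), P, P'.
Qed.

Lemma supp_union F G : supp (funion F G) = supp F `|` supp G.
Proof.
apply/funext => a; apply/propext; split.
  by move=> [P [?|?]]; [left|right]; exists P.
by move=> [[P ?]|[P ?]]; exists P; [left|right].
Qed.

Lemma supp_full : supp ffull = setT.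
Proof. by apply/funext => a; apply/propext; split=> // _; exists setT. Qed.

(** The translation moves bases but not periods, hence [pr c zv]. *)
Lemma dbl_pre g c F : dbl (fpre g c F) =
  [set w | dbl F (addv (pr c zv) (asum g g w))].
Proof.
apply/funext => w; apply/propext; split.
  by move=> [_ [P hP ->] hw]; exists P.
by move=> [P hP hw]; exists [set x | P (g x)] => //; exists P.
Qed.

Lemma dbl_img g c F : dbl (fimg g c F) =
  [set addv (pr c zv) (asum g g w) | w in dbl F].
Proof.
apply/funext => w; apply/propext; split.
  move=> [_ [b [P [hP eb ->]] [x Px ex]]]; exists (pr b x); first by exists P.
  by rewrite -(pr_eta w) eb -ex; apply/funext => -[].
by move=> [z [P hP hz] <-]; exists [set g x | x in P]; [exists (z \o inl), P|exists (z \o inr)].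
Qed.

Lemma dbl_inter F G : dbl (finter F G) = dbl F `&` dbl G.
Proof.
apply/funext => a; apply/propext; split.
  by move=> [_ [P [P' [? ? ->]]] [? ?]]; split; [exists P|exists P'].
by move=> [[P ? ?] [P' ? ?]]; exists (P `&` P') => //; exists P, P'.
Qed.

Lemma dbl_union F G : dbl (funion F G) = dbl F `|` dbl G.
Proof.
apply/funext => a; apply/propext; split.
  by move=> [P [?|?] ?]; [left|right]; exists P.
by move=> [[P ? ?]|[P ? ?]]; exists P => //; [left|right].
Qed.

Lemma dbl_full : dbl ffull = setT.
Proof. by apply/funext => a; apply/propext; split=> // _; exists setT. Qed.

(** That [c + g a'] is [c + g a] plus a period does not make [a'] larger than [a]. Dickson's lemma
    on the bases supplies the difference [d], and cancellation identifies [g d] with the period. *)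
Lemma good_pre g c (F : fam J) : good F -> good (fpre g c F).
Proof.
move=> [G1 G2 G3 G4]; split.
- by move=> b _ [P hP ->]; apply: periodic_pre; exact: G1 hP.
- move=> b _ p [P hP ->] /= Pp; rewrite supp_pre /= an_add addvA; exact: G2 hP Pp.
- apply: (af_link (D := fun x : (I -> nat) * set (J -> nat) => F (addv c (g x.1)) x.2)
    (R := fun x y => fle (addv c (g x.1), x.2) (addv c (g y.1), y.2) /\
                     forall i, (x.1 i <= y.1 i)%N)
    (link := fun x y => x.1 = y.1 /\ y.2 = [set z | x.2 (g z)])).
  + apply: af_and.
      by apply: (af_pre (g := fun x : (I -> nat) * set (J -> nat) => (addv c (g x.1), x.2)) G3).
    by apply: (af_pre (g := fst) (@dickson I)).
  + by move=> [a Q] /= [P hP ->]; exists (a, P).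
  + move=> [a P] [b Q] [a' P'] [b' Q'] /= [-> ->] [-> ->] [[p Pp e] /le_addv[d ed]].
    exists d => //=; move: Pp e; rewrite /= ed an_add addvA => Pp /addvI e.
    by rewrite e.
- by move=> b _ [P hP ->]; apply: edef_coneP_pre; [exact: G1 hP|exact: G4 hP].
Qed.

Lemma good_img g c (F : fam I) : good F -> good (fimg g c F).
Proof.
move=> [G1 G2 G3 G4]; split.
- by move=> b _ [b' [P [hP _ ->]]]; apply: periodic_img; exact: G1 hP.
- move=> b _ p [b' [P [hP -> ->]]] [x Px <-]; rewrite supp_img -addvA -an_add.
  by exists (addv b' x) => //; exact: G2 hP Px.
- apply: (af_link (link := fun x y => y.1 = addv c (g x.1) /\ y.2 = [set g z | z in x.2]) G3).
    by move=> [a Q] /= [b [P [hP -> ->]]]; exists (b, P).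
  move=> [a P] [b Q] [a' P'] [b' Q'] /= [-> ->] [-> ->] [p Pp /= ->].
  by exists (g p); [exists p|rewrite an_add addvA].
- by move=> b _ [b' [P [hP _ ->]]]; apply: edef_coneP_img; exact: G4 hP.
Qed.

Lemma good_inter (F G : fam I) : good F -> good G -> good (finter F G).
Proof.
move=> [F1 F2 F3 F4] [G1 G2 G3 G4]; split.
- by move=> b _ [P [P' [h h' ->]]]; apply: periodicI; [exact: F1 h|exact: G1 h'].
- move=> b _ p [P [P' [h h' ->]]] [Pp Pp']; rewrite supp_inter.
  by split; [exact: F2 h Pp|exact: G2 h' Pp'].
- apply: (af_link (D := fun x : (I -> nat) * (set (I -> nat) * set (I -> nat)) =>
      F x.1 x.2.1 /\ G x.1 x.2.2)
    (R := fun x y => fle (x.1, x.2.1) (y.1, y.2.1) /\ fle (x.1, x.2.2) (y.1, y.2.2))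
    (link := fun x y => x.1 = y.1 /\ y.2 = x.2.1 `&` x.2.2)).
  + apply: af_and.
      by apply: (af_pre (g := fun x : (I -> nat) * (set (I -> nat) * set (I -> nat)) =>
        (x.1, x.2.1)) F3) => x [].
    by apply: (af_pre (g := fun x : (I -> nat) * (set (I -> nat) * set (I -> nat)) =>
        (x.1, x.2.2)) G3) => x [].
  + by move=> [a Q] /= [P [P' [h h' ->]]]; exists (a, (P, P')).
  + move=> [a P] [b Q] [a' P'] [b' Q'] /= [-> ->] [-> ->] [[p Pp /= e] [p' Pp' /= e']].
    by exists p => //=; split=> //; rewrite (addvI (etrans (esym e) e')).
- move=> b _ [P [P' [h h' ->]]].
  by apply: edef_conePI; [exact: F1 h|exact: G1 h'|exact: F4 h|exact: G4 h'].
Qed.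

Lemma good_union (F G : fam I) : good F -> good G -> good (funion F G).
Proof.
move=> [F1 F2 F3 F4] [G1 G2 G3 G4]; split.
- by move=> b P [h|h]; [exact: F1 h|exact: G1 h].
- move=> b P p [h|h] Pp; rewrite supp_union; first by left; exact: F2 h Pp.
  by right; exact: G2 h Pp.
- move=> f hf.
  have := infinite_incr (Q := fun n => F (f n).1 (f n).2) => hi.
  case: (pselect (forall N, exists m, (N <= m)%N /\ F (f m).1 (f m).2)).
    move=> /hi[s [si hs]]; have [i [j [ij h]]] := F3 (f \o s) hs.
    by exists (s i), (s j); split=> //; exact: si.
  move=> nF.
  have [N hN] : exists N, forall m, (N <= m)%N -> G (f m).1 (f m).2.
    apply: contrapT => h; apply: nF => N; apply: contrapT => h2; apply: h; exists N => m Nm.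
    by case: (hf m) => // Fm; exfalso; apply: h2; exists m.
  have [i [j [ij h]]] := G3 (fun n => f (N + n)%N) (fun n => hN _ (leq_addr _ _)).
  by exists (N + i)%N, (N + j)%N; split=> //; rewrite ltn_add2l.
- by move=> b P [h|h]; [exact: F4 h|exact: G4 h].
Qed.

Lemma good_full : good ffull.
Proof.
split.
- by move=> b _ ->.
- by move=> b P p _ _; exists setT.
- apply: (af_sub (af_pre (g := fst) (D' := fun x => ffull x.1 x.2) (@dickson I) _)) => //.
  by move=> x y hx _ /le_addv[z ez]; exists z; rewrite ?hx.
- by move=> b _ ->; exact: edef_conePT.
Qed.

Lemma good_empty : good fempty.
Proof. by split=> // f /(_ 0%N). Qed.
End Ops.

Section Ops2.
Variables (I J : finType).

Lemma good2_pre (g : amap I J) c F : good2 F -> good2 (fpre g c F).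
Proof.
move=> [gF [G gG eG]]; split; first exact: good_pre.
exists (fpre (asum g g) (pr c zv) G); first exact: good_pre.
by rewrite supp_pre dbl_pre eG.
Qed.

Lemma good2_img (g : amap I J) c F : good2 F -> good2 (fimg g c F).
Proof.
move=> [gF [G gG eG]]; split; first exact: good_img.
exists (fimg (asum g g) (pr c zv) G); first exact: good_img.
by rewrite supp_img dbl_img eG.
Qed.

Lemma good2_inter (F F' : fam I) : good2 F -> good2 F' -> good2 (finter F F').
Proof.
move=> [gF [G gG eG]] [gF' [G' gG' eG']]; split; first exact: good_inter.
exists (finter G G'); first exact: good_inter.
by rewrite supp_inter dbl_inter eG eG'.
Qed.

Lemma good2_union (F F' : fam I) : good2 F -> good2 F' -> good2 (funion F F').
Proof.
move=> [gF [G gG eG]] [gF' [G' gG' eG']]; split; first exact: good_union.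
exists (funion G G'); first exact: good_union.
by rewrite supp_union dbl_union eG eG'.
Qed.

Lemma good2_full : good2 (@ffull I).
Proof.
split; first exact: good_full.
by exists (@ffull (I + I)%type); [exact: good_full|rewrite supp_full dbl_full].
Qed.

Lemma good2_empty : good2 (@fempty I).
Proof.
split; first exact: good_empty.
exists (@fempty (I + I)%type); first exact: good_empty.
by apply/funext => w; apply/propext; split=> [[]|[]].
Qed.

Lemma good3_weak (Fl Fl' : (I -> nat) -> set (I + I -> nat) -> Prop) (F : fam I) :
  (forall b D, Fl b D -> Fl' b D) -> good3 Fl F -> good3 Fl' F.
Proof.
move=> h [gF hF]; split=> // b P /hF[H [h1 h2 h3 h4]].
by exists H; split=> //; exact: h.
Qed.

Lemma good3_pre (g : amap I J) c F Fl : good3 Fl F ->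
  good3 (fun a D' => exists2 D, Fl (addv c (g a)) D & D' = [set w | D (asum g g w)])
    (fpre g c F).
Proof.
move=> [gF hF]; split; first exact: good2_pre.
move=> b _ [P /hF[H [h1 h2 h3 h4]] ->]; exists (fpre g zv H); split.
- exact: good2_pre.
- by rewrite supp_pre h2.
- by exists P => //; rewrite an0.
- by exists (dbl H) => //; rewrite dbl_pre pr0.
Qed.

Lemma good3_img (g : amap I J) c F Fl : good3 Fl F ->
  good3 (fun a D' => exists b D, [/\ a = addv c (g b), Fl b D &
      D' = [set asum g g w | w in D]])
    (fimg g c F).
Proof.
move=> [gF hF]; split; first exact: good2_img.
move=> _ _ [b [P [/hF[H [h1 h2 h3 h4]] -> ->]]]; exists (fimg g zv H); split.
- exact: good2_img.
- by rewrite supp_img h2.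
- by exists zv, P; rewrite an0.
- by exists b, (dbl H); split=> //; rewrite dbl_img pr0.
Qed.

Lemma good3_inter (F F' : fam I) Fl Fl' : good3 Fl F -> good3 Fl' F' ->
  good3 (fun a D => exists D1 D2, [/\ Fl a D1, Fl' a D2 & D = D1 `&` D2])
    (finter F F').
Proof.
move=> [gF hF] [gF' hF']; split; first exact: good2_inter.
move=> b _ [P [P' [/hF[H [h1 h2 h3 h4]] /hF'[H' [h1' h2' h3' h4']] ->]]].
exists (finter H H'); split.
- exact: good2_inter.
- by rewrite supp_inter h2 h2'.
- by exists P, P'.
- by exists (dbl H), (dbl H'); split=> //; rewrite dbl_inter.
Qed.

Lemma good3_union (F F' : fam I) Fl : good3 Fl F -> good3 Fl F' ->
  good3 Fl (funion F F').
Proof.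
move=> [gF hF] [gF' hF']; split; first exact: good2_union.
by move=> b P [/hF|/hF'].
Qed.

Lemma good3_full (Fl : (I -> nat) -> set (I + I -> nat) -> Prop) :
  (forall a, Fl a setT) -> good3 Fl (@ffull I).
Proof.
move=> h; split; first exact: good2_full.
move=> b _ ->; exists (@ffull I); split=> //; first exact: good2_full.
  by rewrite supp_full.
by rewrite dbl_full.
Qed.

Lemma good3_empty (Fl : (I -> nat) -> set (I + I -> nat) -> Prop) : good3 Fl (@fempty I).
Proof. by split; [exact: good2_empty|]. Qed.
End Ops2.

(** * The cone of a production relation *)

Section Reach.
Variables (I : finType) (X : set (I + I -> nat)).

Inductive reachX : (I -> nat) -> (I -> nat) -> Prop :=
  | reach0 s : reachX s s
  | reachS s t u : X (pr s t) -> reachX t u -> reachX s u.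

Lemma reach1 s t : X (pr s t) -> reachX s t.
Proof. by move=> h; apply: reachS h _; constructor. Qed.

Lemma reach_trans s t u : reachX s t -> reachX t u -> reachX s u.
Proof. by elim=> // a b c ab bc IH /IH; exact: reachS. Qed.

Definition mono := forall s t a, X (pr s t) -> X (pr (addv s a) (addv t a)).

Definition Prod (c : I -> nat) : set (I + I -> nat) :=
  [set w : I + I -> nat | reachX (addv c (w \o inl)) (addv c (w \o inr))].

Hypothesis monoX : mono.

Lemma reach_shift s t a : reachX s t -> reachX (addv s a) (addv t a).
Proof.
elim=> [u|u v w uv vw IH]; first by constructor.
by apply: reachS IH; exact: monoX.
Qed.

(** The first production runs with the input of the second as context, then the second with the
    output of the first. *)
Lemma periodic_Prod c : periodicv (Prod c).
Proof.
split=> [|x y hx hy]; first exact: reach0.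
rewrite /Prod /= -[_ \o inl]/(addv (x \o inl) (y \o inl)) -[_ \o inr]/(addv (x \o inr) (y \o inr)).
rewrite !addvA; apply: (reach_trans (reach_shift _ hx)).
by rewrite addvAC (addvAC c (x \o inr)); apply: reach_shift.
Qed.

Lemma Prod_pr c x y : Prod c (pr x y) <-> reachX (addv c x) (addv c y).
Proof. by []. Qed.

Lemma reach_scv c x y n : reachX (addv c x) (addv c y) ->
  reachX (addv c (scv n x)) (addv c (scv n y)).
Proof. by move=> h; apply: (periodic_scv n (periodic_Prod c) (x := pr x y)). Qed.
End Reach.

Section ConeStar.
Variables (I : finType) (F : fam (I + I)).
Hypothesis gF : good F.
Let X := supp F.
Hypothesis monoX : mono X.
Variable c : I -> nat.
Variable V : set (I + I -> rat).
Hypothesis sV : subsp V.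

Local Notation reach := (reachX X).

(** The restriction to [V] serves [nice_edef], which asks for an approximation of the cone inside
    each subspace. *)
Definition PV : set (I + I -> nat) := [set w | Prod X c w /\ V (toq w)].

Lemma PV_periodic : periodicv PV.
Proof.
have [p0 pD] := periodic_Prod monoX c; have [V0 VD] := sV.
split=> [|x y [px vx] [py vy]].
  by split=> //; move: V0; congr V.
split; first exact: pD.
have := VD 1 1 _ _ vx vy; congr V; apply/funext => i.
by rewrite /lcomb /toq /addv natrD; ring.
Qed.

Definition Qc (s : I -> nat) : Prop :=
  exists x y, [/\ PV (pr x y), reach (addv c x) s & reach s (addv c y)].

(* [Ib] collects the coordinates that are bounded along the runs of           *)
(* productions.                                                               *)
Definition Ib (i : I) : bool := `[< exists B, forall s, Qc s -> (s i <= B)%N >].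

Definition intra (h : I -> nat) : Prop :=
  exists x y, [/\ PV (pr x y), reach (addv c x) (addv c h) & reach (addv c h) (addv c y)].

Lemma intra0 : intra zv.
Proof.
exists zv, zv; split; [|exact: reach0|exact: reach0].
by rewrite pr0; exact: PV_periodic.1.
Qed.

Lemma reach_add2 a b x y : reach (addv c a) (addv c x) -> reach (addv c b) (addv c y) ->
  reach (addv c (addv a b)) (addv c (addv x y)).
Proof.
have [_ pD] := periodic_Prod monoX c => h1 h2.
have := pD (pr a x) (pr b y) h1 h2; rewrite addv_pr; exact.
Qed.

Lemma intraD h k : intra h -> intra k -> intra (addv h k).
Proof.
move=> [x [y [p1 h1 h2]]] [x' [y' [p2 h1' h2']]].
exists (addv x x'), (addv y y'); split; try exact: reach_add2.
by rewrite -addv_pr; apply: PV_periodic.2.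
Qed.

(** Among visited configurations that grow at [i], Dickson's lemma finds [s] and [s + d] with
    [d i > 0]. Entering [s + d] by the second run and leaving [s] by the first carries [d] along and
    arrives at [c + d + x + y]; crossing the runs the other way leads on to an output. *)
Lemma intra_unbounded i : ~~ Ib i -> exists2 h, intra h & (0 < h i)%N.
Proof.
move=> /asboolPn nb.
have /choice[g hg] : forall B, exists s, Qc s /\ (B < s i)%N.
  move=> B; apply: contrapT => h; apply: nb; exists B => s Qs; rewrite leqNgt.
  by apply/negP => hs; apply: h; exists s.
pose f := fix f n := if n is n'.+1 then g (f n' i) else g 0%N.
have fQ n : Qc (f n) by case: n => [|n]; exact: (hg _).1.
have fi : incr (fun n => f n i) by apply: incrP => n; exact: (hg _).2.
have [n [m [nm /le_addv[d ed]]]] := @dickson I f (fun _ => Logic.I).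
have di : (0 < d i)%N by have := fi _ _ nm; rewrite ed /addv; lia.
have [x [y [p1 h1 h2]]] := fQ n; have [x' [y' [p2]]] := fQ m.
rewrite ed => h1' h2'.
exists (addv d (addv x y)); last by rewrite /addv; lia.
exists (addv x' x), (addv y' y); split.
- by rewrite -addv_pr; apply: PV_periodic.2.
- rewrite addvA; apply: (reach_trans (reach_shift monoX x h1')).
  rewrite addvAC; apply: (reach_trans (reach_shift monoX d (reach_shift monoX x h2))).
  have -> : addv c (addv d (addv x y)) = addv (addv (addv c y) x) d.
    by apply/funext => j; rewrite /addv; lia.
  exact: reach0.
- have := reach_shift monoX y (reach_trans (reach_shift monoX d h1) h2').
  by congr reachX; apply/funext => j; rewrite /addv; lia.
Qed.

Lemma intra_total : exists2 h, intra h & forall i, ~~ Ib i -> (0 < h i)%N.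
Proof.
suff : forall l : seq I, exists2 h, intra h & forall i, i \in l -> ~~ Ib i -> (0 < h i)%N.
  by move=> /(_ (enum I))[h ih hh]; exists h => // i; apply: hh; rewrite mem_enum.
elim=> [|i l [h ih hh]]; first by exists zv; [exact: intra0|].
have [bi|bi] := boolP (Ib i).
  by exists h => // j; rewrite inE => /orP[/eqP->|//]; [rewrite bi|exact: hh].
have [k ik hk] := intra_unbounded bi; exists (addv k h); first exact: intraD.
move=> j; rewrite inE /addv => /orP[/eqP->|jl] bj; first by rewrite addn_gt0 hk.
by rewrite addn_gt0 (hh j) ?orbT.
Qed.

Lemma Qc_bound : exists B, forall s i, Qc s -> Ib i -> (s i <= B)%N.
Proof.
have /choice[B hB] : forall i, exists B, Ib i -> forall s, Qc s -> (s i <= B)%N.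
  by move=> i; case: (pselect (Ib i)) => [bi|]; [have [B] := asboolP _ bi; exists B|exists 0%N].
exists (\max_i B i)%N => s i Qs bi.
by apply: leq_trans (hB i bi s Qs) _; exact: leq_bigmax.
Qed.

Lemma scv_bounded (x B : nat) : (forall n, n * x <= B)%N -> x = 0%N.
Proof. by move=> /(_ B.+1); case: x => // x; nia. Qed.

(** All [c + n h] are visited as well, which is compatible with a bound at [i] only if [h] vanishes
    there. *)
Lemma intra_Ib h i : intra h -> Ib i -> h i = 0%N.
Proof.
move=> [x [y [p1 h1 h2]]] bi; have [B hB] := Qc_bound.
apply: (@scv_bounded _ B) => n.
have Qn : Qc (addv c (scv n h)).
  exists (scv n x), (scv n y); split; try exact: reach_scv.
  by rewrite -scv_pr; exact: (periodic_scv n PV_periodic p1).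
by have := hB _ _ Qn bi; rewrite /addv /scv; lia.
Qed.

Lemma PV_intra x y : PV (pr x y) -> intra x /\ intra y.
Proof.
move=> p; have r : reach (addv c x) (addv c y) := p.1.
by split; exists x, y; split=> //; exact: reach0.
Qed.

Definition ZI : set (I + I -> nat) :=
  [set w | forall i, Ib i -> w (inl i) = 0%N /\ w (inr i) = 0%N].

Lemma ZI_periodic : periodicv ZI.
Proof.
split=> // x y hx hy i bi; have [x1 x2] := hx i bi; have [y1 y2] := hy i bi.
by rewrite /addv x1 x2 y1 y2.
Qed.

Lemma PV_ZI w : PV w -> ZI w.
Proof.
rewrite -(pr_eta w) => /PV_intra[h1 h2] i bi.
by split; [exact: (intra_Ib h1 bi)|exact: (intra_Ib h2 bi)].
Qed.

Definition used (w : I + I -> nat) : Prop :=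
  X w /\ exists x y, [/\ PV (pr x y), reach (addv c x) (w \o inl) & reach (w \o inr) (addv c y)].

Lemma usedQ w : used w -> Qc (w \o inl) /\ Qc (w \o inr).
Proof.
move=> [Xw [x [y [p h1 h2]]]]; rewrite -(pr_eta w) in Xw.
split; exists x, y; split=> //; first exact: reachS Xw h2.
by apply: reach_trans h1 (reach1 Xw).
Qed.

(** Nodes of the graph: bounded parts, set to 0 on the other coordinates so that two configurations
    share a node exactly when they agree on [Ib]. *)
Definition nd (s : I -> nat) : {ffun I -> nat} := [ffun i => if Ib i then s i else 0%N].

Lemma ndP s t : nd s = nd t <-> forall i, Ib i -> s i = t i.
Proof.
split=> [/ffunP e i bi|e]; first by have := e i; rewrite !ffunE bi.
by apply/ffunP => i; rewrite !ffunE; case: ifP => // /e.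
Qed.

Lemma nd_add s a : (forall i, Ib i -> a i = 0%N) -> nd (addv s a) = nd s.
Proof. by move=> h; apply/ndP => i bi; rewrite /addv h // addn0. Qed.

Lemma used_cover : exists k (b : 'I_k -> I + I -> nat) (P : 'I_k -> set (I + I -> nat)),
  [/\ forall e, used (b e),
      forall e, [/\ periodicv (P e), P e `<=` ZI, edef (coneP (P e)) &
        forall p, P e p -> X (addv (b e) p)] &
      forall w, used w -> exists e p, P e p /\ w = addv (b e) p].
Proof.
have [G1 G2 G3 G4] := gF; have [B hB] := Qc_bound.
pose D (x : (I + I -> nat) * set (I + I -> nat)) := F x.1 x.2 /\ used x.1.
(* Comparing [B - x] as well prevents the bounded coordinates from growing, while [fle] prevents
   them from shrinking. The periods therefore vanish there, and all uses of an edge have the same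
   end nodes. *)
pose g (x : (I + I -> nat) * set (I + I -> nat)) (k : I + I) :=
  if Ib (match k with inl i => i | inr i => i end) then (B - x.1 k)%N else 0%N.
have afD : af D (fun x y => fle x y /\ forall k, (g x k <= g y k)%N).
  apply: af_and; first by apply: af_sub G3 _ _ => // x [].
  by apply: (af_pre (g := g) (@dickson _)).
have [k [f [fD fc]]] := af_cover afD.
exists k, (fun e => (f e).1), (fun e => (f e).2 `&` ZI); split.
- by move=> e; have [] := fD e.
- move=> e; have [Fe Ue] := fD e; have pe := G1 _ _ Fe; split.
  + by apply: periodicI => //; exact: ZI_periodic.
  + by move=> w [].
  + apply: edef_conePI => //; [exact: ZI_periodic|exact: G4 Fe|].
    have h : edef [set v : I + I -> rat | forall i, Ib i -> v (inl i) = 0 /\ v (inr i) = 0].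
      apply: edef_bigI => i; case: (Ib i); last first.
        by apply: edef_eq (basic_edef (basicT true _)).
      apply: (edef_eq _ (edefI (basic_edef (basic_zero true (islin_coord (inl i))))
        (basic_edef (basic_zero true (islin_coord (inr i)))))) => v.
      by split=> [[? ?] _|/(_ isT)].
    apply: edef_eq (edefI (edef_ge0 _) h) => v; split.
      move=> [/= /rats_nat[N [m [N0 em]]] vz]; exists N, m; split=> // i bi.
      have [v1 v2] := vz i bi; have := em (inl i); have := em (inr i).
      rewrite v1 v2 !mulr0 => /eqP; rewrite eq_sym pnatr_eq0 => /eqP m1 /eqP.
      by rewrite eq_sym pnatr_eq0 => /eqP m2.
    move=> h'; split; first exact: coneP_ge0 h'.
    have [N [p [N0 pz e']]] := h'; move=> i bi.
    have [p1 p2] := pz i bi; have nz : (N%:R : rat) != 0 by rewrite pnatr_eq0 -lt0n.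
    by split; apply: (mulfI nz); rewrite e' ?p1 ?p2 mulr0.
  + by move=> p [Pp _]; exact: G2 Fe Pp.
- move=> w uw; have [P FP] := uw.1.
  have [//|e [[p Pp /= ep] hg]] := fc (w, P).
  exists e, p; split=> //; split=> // i bi.
  have [/usedQ[q1 q2] /usedQ[q1' q2']] := (uw, (fD e).2).
  have := hg (inl i); have := hg (inr i); rewrite /g bi ep /addv /=.
  have := hB _ _ q1 bi; have := hB _ _ q2 bi; rewrite ep /addv /=.
  by have := hB _ _ q1' bi; have := hB _ _ q2' bi => /=; lia.
Qed.

Section Edges.
Variables (k : nat) (b : 'I_k -> I + I -> nat) (P : 'I_k -> set (I + I -> nat)).
Hypothesis bU : forall e, used (b e).
Hypothesis perP : forall e, periodicv (P e).
Hypothesis PZ : forall e, P e `<=` ZI.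
Hypothesis bX : forall e p, P e p -> X (addv (b e) p).
Hypothesis bC : forall w, used w -> exists e p, P e p /\ w = addv (b e) p.
Variables (m : 'I_k -> nat) (qq : forall e, 'I_(m e) -> I + I -> nat).

Definition Ue e : set (I + I -> nat) := [set q | P e q /\ used (addv (b e) q)].

(** Spanned by periods that occur in runs of productions inside [V]. Flows are confined to it
    because the margin that [edef_hull] asks for has to come from such periods. *)
Definition spane e : set (I + I -> rat) :=
  [set v | exists cc : 'I_(m e) -> rat, forall i, v i = \sum_j cc j * toq (qq j) i].

Hypothesis qU : forall e (j : 'I_(m e)), Ue e (qq j).
Hypothesis qS : forall e u, Ue e u -> spane e (toq u).

Lemma spane_subsp e : subsp (spane e).
Proof.
split; first by exists (fun=> 0) => i; rewrite big1 // => j _; rewrite mul0r.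
move=> x y u v [cu hu] [cv hv]; exists (fun j => x * cu j + y * cv j) => i.
rewrite /lcomb hu hv !mulr_sumr -big_split; apply: eq_bigr => j _ /=; ring.
Qed.

Lemma spane_add e u v : spane e (toq u) -> spane e (toq v) -> spane e (toq (addv u v)).
Proof.
move=> hu hv; have := (spane_subsp e).2 1 1 _ _ hu hv; congr (spane e).
by apply/funext => i; rewrite /lcomb /toq /addv natrD; ring.
Qed.

Lemma spane0 e : spane e (toq zv).
Proof. exact: (spane_subsp e).1. Qed.

Definition srcN e := nd (b e \o inl).
Definition tgtN e := nd (b e \o inr).

Definition sideb (th : 'I_k -> nat) (Q : 'I_k -> I + I -> nat) (i : I + I) : nat :=
  (\sum_e (th e * b e i + Q e i))%N.

(* [th e] counts the uses of the piece [e], and [Q e] is the sum of the       *)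
(* periods added to its base: marking equation and Kirchhoff's law.           *)
Definition SD (s t : I -> nat) (th : 'I_k -> nat) (Q : 'I_k -> I + I -> nat) : Prop :=
  [/\ forall e, P e (Q e), forall e, spane e (toq (Q e)),
     forall i, (t i + sideb th Q (inl i) = s i + sideb th Q (inr i))%N &
     forall p, (outflow srcN th p + (nd t == p) = inflow tgtN th p + (nd s == p))%N].

Lemma sidebD th Q th' Q' i :
  sideb (addv th th') (fun e => addv (Q e) (Q' e)) i = (sideb th Q i + sideb th' Q' i)%N.
Proof. by rewrite /sideb -big_split; apply: eq_bigr => e _; rewrite /addv mulnDl addnACA. Qed.

Lemma outflowD (E : finType) (N : eqType) (f : E -> N) th th' p :
  outflow f (addv th th') p = (outflow f th p + outflow f th' p)%N.
Proof. by rewrite /outflow -big_split; apply: eq_bigr => e _; rewrite /addv mulnDl. Qed.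

Lemma inflowD (E : finType) (N : eqType) (f : E -> N) th th' p :
  inflow f (addv th th') p = (inflow f th p + inflow f th' p)%N.
Proof. exact: outflowD. Qed.

Lemma SD_nil s : SD s s zv (fun=> zv).
Proof.
split=> [e|e|i|p]; [exact: (perP e).1|exact: spane0|by []|].
by rewrite /outflow /inflow !big1.
Qed.

Lemma SD_cat s t u th Q th' Q' : SD s t th Q -> SD t u th' Q' ->
  SD s u (addv th th') (fun e => addv (Q e) (Q' e)).
Proof.
move=> [h1 h2 h3 h4] [h1' h2' h3' h4']; split=> [e|e|i|p].
- exact: (perP e).2.
- exact: spane_add.
- by rewrite !sidebD; have := h3 i; have := h3' i; lia.
- by rewrite outflowD inflowD; have := h4 p; have := h4' p; lia.
Qed.

Lemma sum_delta (e : 'I_k) (f : 'I_k -> nat) : (\sum_x (x == e) * f x = f e)%N.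
Proof. by rewrite (bigD1 e) //= eqxx mul1n big1 ?addn0 // => x /negPf->. Qed.

Lemma SD_step e q : Ue e q ->
  SD (addv (b e) q \o inl) (addv (b e) q \o inr) (fun x => x == e)
     (fun x => if x == e then q else zv).
Proof.
move=> [Pq uq].
have sd i : sideb (fun x => x == e) (fun x => if x == e then q else zv) i = addv (b e) q i.
  rewrite /sideb big_split /= sum_delta; congr (_ + _)%N.
  by rewrite (bigD1 e) //= eqxx big1 ?addn0 // => x /negPf->.
have qz i : Ib i -> q (inl i) = 0%N /\ q (inr i) = 0%N by apply: (PZ Pq).
split=> [x|x|i|p].
- by case: eqP => [->|_]; [|exact: (perP x).1].
- by case: eqP => [->|_]; [exact: qS|exact: spane0].
- by rewrite !sd /= addnC.
- rewrite /outflow /inflow !sum_delta /srcN /tgtN.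
  rewrite [nd (_ \o inr)](_ : _ = nd (b e \o inr)); last first.
    by apply: (@nd_add _ (q \o inr)) => i /qz[].
  rewrite [nd (addv _ _ \o inl)](_ : _ = nd (b e \o inl)); first by rewrite addnC.
  by apply: (@nd_add _ (q \o inl)) => i /qz[].
Qed.

Lemma SD_run s t : reach s t ->
  (exists x y, [/\ PV (pr x y), reach (addv c x) s & reach t (addv c y)]) ->
  exists th Q, SD s t th Q.
Proof.
elim=> [u _|u v w uv vw IH [x [y [p h1 h2]]]].
  by exists zv, (fun=> zv); exact: SD_nil.
have [|th [Q hQ]] := IH.
  by exists x, y; split=> //; apply: reach_trans h1 (reach1 uv).
have uu : used (pr u v).
  by split=> //; exists x, y; split=> //; exact: reach_trans vw h2.
have [e [q [Pq eq]]] := bC uu.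
have hs := @SD_step e q (conj Pq (eq_ind _ used uu _ eq)).
by do 2 eexists; rewrite -eq in hs; exact: (SD_cat hs hQ).
Qed.

Lemma walk_run s t : reach s t ->
  (exists x y, [/\ PV (pr x y), reach (addv c x) s & reach t (addv c y)]) ->
  exists w, walk srcN tgtN (nd s) w (nd t).
Proof.
elim=> [u _|u v w uv vw IH [x [y [p h1 h2]]]]; first by exists [::].
have [|l hl] := IH.
  by exists x, y; split=> //; apply: reach_trans h1 (reach1 uv).
have uu : used (pr u v).
  by split=> //; exists x, y; split=> //; exact: reach_trans vw h2.
have [e [q [Pq eq]]] := bC uu.
exists (e :: l); split.
  apply/ndP => i bi; have := congr1 (@^~ (inl i)) eq; rewrite /addv /= => ->.
  by rewrite (PZ Pq bi).1 addn0.
suff -> : tgtN e = nd v by [].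
apply/ndP => i bi; have := congr1 (@^~ (inr i)) eq; rewrite /addv /= => ->.
by rewrite (PZ Pq bi).2 addn0.
Qed.

(** [SD] for a production: [c] cancels in the marking equation, and both ends lie over the node of
    [c], so the flow is balanced. *)
Definition FD (x y : I -> nat) (th : 'I_k -> nat) (Q : 'I_k -> I + I -> nat) : Prop :=
  PV (pr x y) /\
  [/\ forall e, P e (Q e), forall e, spane e (toq (Q e)),
     forall i, (y i + sideb th Q (inl i) = x i + sideb th Q (inr i))%N &
     forall p, outflow srcN th p = inflow tgtN th p].

Lemma FD_SD x y th Q : PV (pr x y) -> SD (addv c x) (addv c y) th Q -> FD x y th Q.
Proof.
move=> p [h1 h2 h3 h4]; split=> //; split=> // [i|q].
  by have := h3 i; rewrite /addv; lia.
have z := PV_ZI p; have := h4 q.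
by rewrite !nd_add; [lia|move=> i /z[]|move=> i /z[]].
Qed.

Lemma FD_add x y th Q x' y' th' Q' : FD x y th Q -> FD x' y' th' Q' ->
  FD (addv x x') (addv y y') (addv th th') (fun e => addv (Q e) (Q' e)).
Proof.
move=> [p [h1 h2 h3 h4]] [p' [h1' h2' h3' h4']]; split.
  by rewrite -addv_pr; apply: PV_periodic.2.
split=> [e|e|i|q].
- exact: (perP e).2.
- exact: spane_add.
- by rewrite !sidebD /addv; have := h3 i; have := h3' i; lia.
- by rewrite outflowD inflowD h4 h4'.
Qed.

Lemma FD0 : FD zv zv zv (fun=> zv).
Proof. by apply: FD_SD; [rewrite pr0; exact: PV_periodic.1|exact: SD_nil]. Qed.

Lemma FD_exists x y : PV (pr x y) -> exists th Q, FD x y th Q.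
Proof.
move=> p; have [|th [Q h]] := @SD_run (addv c x) (addv c y) p.1.
  by exists x, y; split=> //; exact: reach0.
by exists th, Q; exact: FD_SD.
Qed.

(** Such a production supplies the period [q] at the edge [e]; their sum in [dom_all] has a margin
    at all edges simultaneously. *)
Definition dom e q := exists x y th Q,
  [/\ FD x y th Q, (0 < th e)%N & exists2 q', P e q' & Q e = addv q q'].

Lemma dom_item e q : Ue e q -> dom e q.
Proof.
move=> hq; have [Pq [Xq [x [y [p h1 h2]]]]] := hq.
have r : reach (addv (b e) q \o inl) (addv (b e) q \o inr).
  by apply: reach1; rewrite pr_eta.
have [|th1 [Q1 s1]] := SD_run h1.
  by exists x, y; split=> //; [exact: reach0|exact: reach_trans r h2].
have [|th3 [Q3 s3]] := SD_run h2.
  by exists x, y; split=> //; [exact: reach_trans h1 r|exact: reach0].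
have s2 := SD_step hq.
have s := SD_cat s1 (SD_cat s2 s3).
exists x, y; do 2 eexists; split; first exact: FD_SD s.
  by rewrite /addv eqxx; lia.
exists (addv (Q1 e) (Q3 e)); last by rewrite eqxx addvA (addvC (Q1 e)) -addvA.
by apply: (perP e).2; [have [] := s1|have [] := s3].
Qed.

Lemma dom_add e q q' : dom e q -> dom e q' -> dom e (addv q q').
Proof.
move=> [x [y [th [Q [h1 h2 [r Pr er]]]]]] [x' [y' [th' [Q' [h1' h2' [r' Pr' er']]]]]].
do 4 eexists; split; first exact: FD_add h1 h1'.
  by rewrite /addv; lia.
by exists (addv r r'); [exact: (perP e).2|rewrite er er' addvACA].
Qed.

Lemma dom_sum e : dom e (fun i => \sum_j qq (e := e) j i)%N.
Proof.
suff h : forall l : seq 'I_(m e), dom e (fun i => \sum_(j <- l) qq j i)%N by exact: h.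
elim=> [|j l IH].
  under eq_fun do rewrite big_nil; apply: dom_item.
  by split; [exact: (perP e).1|rewrite addv0].
have := dom_add (dom_item (qU j)) IH; congr dom; apply/funext => i.
by rewrite big_cons.
Qed.

Lemma dom_all : exists x y th Q, FD x y th Q /\ forall e, (0 < th e)%N /\
  exists2 q', P e q' & Q e = addv (fun i => \sum_j qq (e := e) j i)%N q'.
Proof.
suff : forall l : seq 'I_k, exists x y th Q, FD x y th Q /\
    forall e, e \in l -> (0 < th e)%N /\
    exists2 q', P e q' & Q e = addv (fun i => \sum_j qq (e := e) j i)%N q'.
  move=> /(_ (enum 'I_k))[x [y [th [Q [h1 h2]]]]]; exists x, y, th, Q; split=> // e.
  by apply: h2; rewrite mem_enum.
elim=> [|e l [x [y [th [Q [h1 h2]]]]]].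
  by exists zv, zv, zv, (fun=> zv); split=> //; exact: FD0.
have [x' [y' [th' [Q' [h1' h2' [r' Pr' er']]]]]] := dom_sum e.
have fd := FD_add h1' h1; do 4 eexists; split; first exact: fd.
have PQ f : P f (Q f) by have [_ []] := h1.
have PQ' f : P f (Q' f) by have [_ []] := h1'.
move=> f; rewrite inE => /orP[/eqP->|/h2[t [r Pr er]]].
  split; first by rewrite /addv; lia.
  exists (addv r' (Q e)); first exact: (perP e).2.
  by rewrite er' addvA.
split; first by rewrite /addv; lia.
exists (addv r (Q' f)); first exact: (perP f).2.
by rewrite er addvC addvA.
Qed.

Definition sumL (L : seq ('I_k * (I + I -> nat))) (i : I + I) : nat :=
  (\sum_(x <- L) (b x.1 i + x.2 i))%N.

(** On bounded coordinates the walk guarantees that each transition is enabled with nothing left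
    over. On the others a stock of the total consumption suffices, whatever the intermediate
    gains. *)
Lemma fire L z p : allp (fun x => P x.1 x.2) L ->
  walk srcN tgtN (nd z) (map fst L) p ->
  (forall i, ~~ Ib i -> (sumL L (inl i) <= z i)%N) ->
  exists2 z', reach z z' & forall i, (z' i + sumL L (inl i) = z i + sumL L (inr i))%N.
Proof.
elim: L z => [|[e q] L IH] z /=.
  by move=> _ _ _; exists z; [exact: reach0|move=> i; rewrite /sumL !big_nil].
move=> [Pq PL] [ez hw] hz.
have hs i : sumL ((e, q) :: L) i = (b e i + q i + sumL L i)%N by rewrite /sumL big_cons.
have [a ea] : exists a, z = addv (addv (b e) q \o inl) a.
  apply: le_addv => i; have [bi|bi] := boolP (Ib i); last first.
    by have := hz i bi; rewrite hs /addv /=; lia.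
  move/ndP: ez => /(_ i bi) /= e1; rewrite /addv /= (PZ Pq bi).1 addn0 e1.
  exact: leqnn.
have az i : Ib i -> a i = 0%N.
  move=> bi; move/ndP: ez => /(_ i bi) /=; rewrite ea /addv /= (PZ Pq bi).1; lia.
pose z1 := addv (addv (b e) q \o inr) a.
have st : X (pr z z1).
  by rewrite ea; apply: monoX; rewrite pr_eta; exact: bX.
have n1 : nd z1 = tgtN e.
  apply/ndP => i bi; rewrite /z1 /addv /= az // (PZ Pq bi).2; lia.
have [||z' rz' hz'] := IH z1 PL.
- by rewrite n1.
- by move=> i bi; have := hz i bi; rewrite hs ea /z1 /addv /=; lia.
exists z'; first exact: reachS st rz'.
by move=> i; rewrite !hs; have := hz' i; rewrite ea /z1 /addv /=; lia.
Qed.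

(** The whole of [Q e] is spent at the last occurrence of [e], and 0 at the earlier ones. *)
Lemma assign (g : seq 'I_k) (Q : 'I_k -> I + I -> nat) : (forall e, P e (Q e)) ->
  exists L, [/\ map fst L = g, allp (fun x => P x.1 x.2) L &
    forall i, (\sum_(x <- L) x.2 i = \sum_(e | e \in g) Q e i)%N].
Proof.
move=> PQ; elim: g => [|e g [L [h1 h2 h3]]].
  by exists [::]; split=> // i; rewrite big_nil big_pred0.
have [eg|eg] := boolP (e \in g).
  exists ((e, zv) :: L); split=> /= [|| i]; [by rewrite h1|by split=> //; exact: (perP e).1|].
  rewrite big_cons h3 add0n; apply: eq_bigl => x; rewrite inE.
  by case: eqP => // ->.
exists ((e, Q e) :: L); split=> /= [|| i]; [by rewrite h1|by []|].
rewrite big_cons h3 [RHS](bigD1 e) ?inE ?eqxx //=; congr (_ + _)%N.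
apply: eq_bigl => x; rewrite inE; case: eqP => [->|_] /=; last by rewrite andbT.
by rewrite (negPf eg).
Qed.

Lemma sum_count (g : seq 'I_k) (f : 'I_k -> nat) :
  (\sum_(e <- g) f e = \sum_e count_mem e g * f e)%N.
Proof.
elim: g => [|x g IH]; first by rewrite big_nil big1.
rewrite big_cons IH /=; under [RHS]eq_bigr do rewrite mulnDl.
rewrite big_split /=; congr (_ + _)%N.
by under eq_bigr do rewrite eq_sym; rewrite sum_delta.
Qed.

(** The Euler circuit of an everywhere positive flow becomes a run once [K] copies of [h] are lent.
    Each round returns the loan, so [K] does not depend on [n]. *)
Lemma cycle (th : 'I_k -> nat) (Q : 'I_k -> I + I -> nat) (W : I + I -> nat) h :
  (forall e, 0 < th e)%N -> (forall e, P e (Q e)) -> ZI W ->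
  (forall i, W (inr i) + sideb th Q (inl i) = W (inl i) + sideb th Q (inr i))%N ->
  (forall p, outflow srcN th p = inflow tgtN th p) ->
  intra h -> (forall i, ~~ Ib i -> (0 < h i)%N) ->
  exists K, forall n, reach (addv (addv c (scv K h)) (scv n (W \o inl)))
                            (addv (addv c (scv K h)) (scv n (W \o inr))).
Proof.
move=> th0 PQ WZ eW bal ih hpos.
(* Each base is a transition of some production, so a run starting above [c] leads to its source;
   all edges carry flow, hence those of this path do. *)
have [e _|g hg cg] := euler (r := nd c) bal.
  have [_ [x [y [p h1 h2]]]] := bU e.
  have [|w hw] := walk_run h1.
    exists x, y; split=> //; first exact: reach0.
    by apply: reach_trans h2; apply: reach1; rewrite pr_eta; have [] := bU e.
  exists w => //; move: hw; rewrite nd_add // => i bi.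
  by have [] := PV_ZI p bi.
have [L [mL aL sL]] := assign g PQ.
have eL i : sumL L i = sideb th Q i.
  rewrite /sumL big_split /= sL /sideb big_split /=; congr (_ + _)%N.
    transitivity (\sum_(e <- g) b e i)%N; first by rewrite -mL big_map.
    rewrite [LHS]sum_count; by apply: eq_bigr => e _; rewrite cg.
  apply: eq_bigl => e; rewrite -has_pred1 has_count cg; exact: th0.
(* The consumption of one round over all coordinates; it is covered by [K] copies of [h], which is
   at least 1 on unbounded coordinates. *)
pose K := (\sum_i sumL L (inl i))%N; exists K.
have hz i : Ib i -> scv K h i = 0%N by move=> bi; rewrite /scv (intra_Ib ih bi) muln0.
have one a : (forall i, Ib i -> a i = 0%N) ->
    reach (addv (addv (addv c (scv K h)) a) (W \o inl)) (addv (addv (addv c (scv K h)) a) (W \o inr)).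
  move=> az; set z := addv _ (W \o inl).
  have [| |z' rz' hz'] := @fire L z (nd c) aL.
  - rewrite mL /z !nd_add //; by move=> i /WZ[].
  - move=> i bi; apply: (@leq_trans (scv K h i)); last by rewrite /z /addv; lia.
    rewrite /scv; apply: (@leq_trans K); last by have := hpos i bi; nia.
    by rewrite /K (bigD1 i) //= leq_addr.
  suff -> : addv (addv (addv c (scv K h)) a) (W \o inr) = z' by [].
  apply/funext => i; have := hz' i; have := eW i; rewrite !eL /z /addv /=; lia.
elim=> [|n IH]; first exact: reach0.
rewrite !scvS.
have w1 i : Ib i -> scv n (W \o inl) i = 0%N by move=> /WZ[h1 _]; rewrite /scv /= h1 muln0.
have := reach_trans (one _ w1) (reach_shift monoX (W \o inr) IH).
by rewrite -!addvA (addvC (scv n (W \o inl))) (addvC (scv n (W \o inr))).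
Qed.

Lemma common (v : 'I_k -> I + I -> rat) : (forall e, coneP (P e) (v e)) ->
  exists (M : nat) (p : 'I_k -> I + I -> nat), (0 < M)%N /\
    forall e, P e (p e) /\ forall i, M%:R * v e i = (p e i)%:R.
Proof.
move=> h; have /choice[f hf] : forall e, exists x : nat * (I + I -> nat),
    [/\ (0 < x.1)%N, P e x.2 & forall i, x.1%:R * v e i = (x.2 i)%:R].
  by move=> e; have [N [p h']] := h e; exists (N, p).
exists (\prod_e (f e).1)%N, (fun e => scv (\prod_(x | x != e) (f x).1)%N (f e).2); split.
  by apply: prodn_gt0 => e; have [] := hf e.
move=> e; have [f0 fP fe] := hf e; split; first exact: periodic_scv.
by move=> i; rewrite (bigD1 e) //= mulnC /scv !natrM -mulrA fe.
Qed.

Variable K : 'I_k -> set (I + I -> rat).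
Hypothesis KB : forall e, basic false (K e).
Hypothesis KS : forall e v, coneP (P e) v -> spane e v -> K e v.
Hypothesis KH : forall e v eps, K e v -> 0 < eps ->
  coneP (P e) (lcomb 1 eps v (fun i => \sum_(j < m e) toq (qq j) i)).

Definition side (u : 'I_k + 'I_k * (I + I) -> rat) (i : I + I) : rat :=
  \sum_e (u (inl e) * toq (b e) i + u (inr (e, i))).

Definition qbal (u : 'I_k + 'I_k * (I + I) -> rat) (p : {ffun I -> nat}) : rat :=
  \sum_e u (inl e) * ((srcN e == p)%:R - (tgtN e == p)%:R).

(** The rational relaxation of [FD]. Balance is required only at the end nodes of edges, a finite
    set of conditions; at all other nodes it is trivial. *)
Definition Kset : set (I + I -> rat) := [set v | [/\ forall i, 0 <= v i,
  forall i, Ib i -> v (inl i) = 0 /\ v (inr i) = 0 &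
  exists u : 'I_k + 'I_k * (I + I) -> rat,
    [/\ forall e, 0 <= u (inl e), forall e, K e (fun i => u (inr (e, i))),
        forall i, v (inr i) + side u (inl i) - (v (inl i) + side u (inr i)) = 0 &
        forall f, qbal u (srcN f) = 0 /\ qbal u (tgtN f) = 0]]].

Lemma Kset_basic : basic false Kset.
Proof.
pose C1 := [set v : I + I -> rat | forall i, 0 <= v i].
pose C2 := [set v : I + I -> rat | forall i, Ib i -> v (inl i) = 0 /\ v (inr i) = 0].
pose J := ('I_k + 'I_k * (I + I))%type.
pose D1 := [set z : (I + I) + J -> rat | forall e, 0 <= z (inr (inl e))].
pose D2 := [set z : (I + I) + J -> rat | forall e, K e (fun i => z (inr (inr (e, i))))].
pose D3 := [set z : (I + I) + J -> rat | forall i,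
  z (inl (inr i)) + side (z \o inr) (inl i) - (z (inl (inl i)) + side (z \o inr) (inr i)) = 0].
pose D4 := [set z : (I + I) + J -> rat | forall f,
  qbal (z \o inr) (srcN f) = 0 /\ qbal (z \o inr) (tgtN f) = 0].
have b1 : basic false C1 by apply: basic_bigI => i; apply/basic_ge/islin_coord.
have b2 : basic false C2.
  apply: basic_bigI => i; case: (Ib i); last by apply: basic_eq (basicT _ _).
  apply: (basic_eq _ (basicI (basic_zero _ (islin_coord (inl i)))
     (basic_zero _ (islin_coord (inr i))))) => v.
  by split=> [[? ?] _|/(_ isT)].
have d1 : basic false D1 by apply: basic_bigI => e; apply/basic_ge/islin_coord.
have d2 : basic false D2.
  apply: basic_bigI => e.
  exact: (basic_pre (g := fun (z : (I + I) + J -> rat) i => z (inr (inr (e, i))))).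
have ls i : islin (fun z : (I + I) + J -> rat => side (z \o inr) i).
  by apply: islin_sum => e a c' u v; rewrite /lcomb /=; ring.
have lq p : islin (fun z : (I + I) + J -> rat => qbal (z \o inr) p).
  by apply: islin_sum => e a c' u v; rewrite /lcomb /=; ring.
have d3 : basic false D3.
  apply: basic_bigI => i.
  apply: (@basic_zero _ _ (fun z : (I + I) + J -> rat => z (inl (inr i)) +
    side (z \o inr) (inl i) - (z (inl (inl i)) + side (z \o inr) (inr i)))).
  apply: islin_add; first by apply: islin_add => //; exact: islin_coord.
  by apply: islin_opp; apply: islin_add => //; exact: islin_coord.
have d4 : basic false D4.
  by apply: basic_bigI => f; apply: basicI; exact: basic_zero.
apply: (basic_eq _ (basicI (basicI b1 b2) (basic_ex (basicI (basicI d1 d2) (basicI d3 d4))))) => v.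
split.
  by move=> [[h1 h2] [u [[h3 h4] [h5 h6]]]]; split=> //; exists u; split.
by move=> [h1 h2 [u [h3 h4 h5 h6]]]; split; [split|exists u; split; split].
Qed.

Lemma sideb_side (M : rat) th Q (u : 'I_k + 'I_k * (I + I) -> rat) i :
  (forall e, M * u (inl e) = (th e)%:R) ->
  (forall e i, M * u (inr (e, i)) = (Q e i)%:R) ->
  (sideb th Q i)%:R = M * side u i.
Proof.
move=> h1 h2; rewrite /sideb /side natr_sum mulr_sumr; apply: eq_bigr => e _.
by rewrite natrD natrM -h1 -h2 /toq; ring.
Qed.

Lemma qbal_flow (M : rat) th (u : 'I_k + 'I_k * (I + I) -> rat) p :
  (forall e, M * u (inl e) = (th e)%:R) ->
  (outflow srcN th p)%:R - (inflow tgtN th p)%:R = M * qbal u p.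
Proof.
move=> h; rewrite /outflow /inflow /qbal !natr_sum mulr_sumr -sumrB.
by apply: eq_bigr => e _; rewrite !natrM -h; ring.
Qed.

Lemma cone_sub_Kset v : coneP (Prod X c) v -> V v -> Kset v.
Proof.
move=> [N [p [N0 pp ep]]] Vv.
have nz : (N%:R : rat) != 0 by rewrite pnatr_eq0 -lt0n.
have PVp : PV p.
  split=> //; have := sV.2 N%:R 0 _ _ Vv Vv; congr V; apply/funext => i.
  by rewrite /lcomb mul0r addr0 ep.
have := PVp; rewrite -(pr_eta p) => /FD_exists[th [Q [_ [PQ SQ eQ bQ]]]].
split.
- by move=> i; rewrite -(pmulr_rge0 (x := N%:R)) ?ltr0n // ep ler0n.
- move=> i /(PV_ZI PVp)[p1 p2].
  by split; apply: (mulfI nz); rewrite ep ?p1 ?p2 mulr0.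
pose u (x : 'I_k + 'I_k * (I + I)) : rat :=
  N%:R^-1 * match x with inl e => (th e)%:R | inr y => (Q y.1 y.2)%:R end.
have u1 e : N%:R * u (inl e) = (th e)%:R by rewrite /u mulrA divff // mul1r.
have u2 e i : N%:R * u (inr (e, i)) = (Q e i)%:R by rewrite /u mulrA divff // mul1r.
exists u; split.
- by move=> e; rewrite /u mulr_ge0 // invr_ge0 ler0n.
- move=> e; apply: KS.
    by exists N, (Q e).
  have := (spane_subsp e).2 N%:R^-1 0 _ _ (SQ e) (SQ e); congr (spane e).
  by apply/funext => i; rewrite /lcomb mul0r addr0.
- move=> i; apply: (mulfI nz).
  have := eQ i => /(congr1 (fun n => n%:R : rat)); rewrite !natrD /=.
  rewrite !(sideb_side _ u1 u2) -!ep mulr0 => h.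
  by rewrite mulrBr !mulrDr; apply/eqP; rewrite subr_eq0; apply/eqP.
- by move=> f; split; apply: (mulfI nz); rewrite -(qbal_flow _ u1) bQ subrr mulr0.
Qed.

(** [w] is the sum of a production with a margin at every edge and one that visits [c + h]. One half
    of [eps] turns [v] into a flow that [cycle] can run, the other half pays for the borrowed copies
    of [h]. *)
Lemma Kset_approx : exists w, [/\ coneP (Prod X c) w, V w &
  forall v e, Kset v -> 0 < e -> coneP (Prod X c) (lcomb 1 e v w)].
Proof.
have cC := coneP_ccone (periodic_Prod monoX c).
have [h ih hpos] := intra_total; have [xh [yh [ph h1 h2]]] := ih.
have [thh [Qh fh]] := FD_exists ph.
have [xr [yr [thr [Qr [fr dr]]]]] := dom_all.
have fw := FD_add fr fh.
set x0 := addv xr xh in fw; set y0 := addv yr yh in fw.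
set th0 := addv _ _ in fw; set Q0 := (fun e => _) in fw.
have dw e : (0 < th0 e)%N /\
    exists2 q', P e q' & Q0 e = addv (fun i => \sum_j qq (e := e) j i)%N q'.
  have [hp [q' Pq' eq']] := dr e; split; first by rewrite /th0 /addv; lia.
  exists (addv q' (Qh e)); last by rewrite /Q0 eq' addvA.
  by apply: (perP e).2 => //; have [_ []] := fh.
have [PVw [PQ0 _ eQ0 bQ0]] := fw.
exists (toq (pr x0 y0)); split.
- exact: coneP_sub PVw.1.
- exact: PVw.2.
move=> v eps [v0 vz [u [u0 uK eu bu]]] eps0.
pose e1 := eps / 2%:R; have e10 : 0 < e1 by rewrite /e1 divr_gt0.
pose u' (x : 'I_k + 'I_k * (I + I)) : rat := u x + e1 *
  match x with inl e => (th0 e)%:R | inr y => (Q0 y.1 y.2)%:R end.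
pose v' := lcomb 1 e1 v (toq (pr x0 y0)).
have [M1 [mm [M10 hm]]] : exists (N : nat) (mm : 'I_k + (I + I) -> nat), (0 < N)%N /\
    forall t, N%:R * match t with inl e => u' (inl e) | inr i => v' i end = (mm t)%:R.
  apply: rats_nat => -[e|i].
    by rewrite /u' addr_ge0 // mulr_ge0 ?ler0n // ltW.
  by rewrite /v' /lcomb mul1r addr_ge0 // mulr_ge0 ?ler0n // ltW.
(* The margin in [Q0] moves the relaxed periods into the actual cone of [P e]; [common] clears the
   denominators of all edges at once. *)
have [M2 [qn [M20 hq]]] : exists (M : nat) (p : 'I_k -> I + I -> nat), (0 < M)%N /\
    forall e, P e (p e) /\ forall i, M%:R * u' (inr (e, i)) = (p e i)%:R.
  apply: (@common (fun e i => u' (inr (e, i)))) => e.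
  have [_ [q' Pq' eq']] := dw e.
  have := (coneP_ccone (perP e)).2 1 e1 _ _ ler01 (ltW e10) (KH (uK e) e10) (coneP_sub Pq').
  congr (coneP (P e)); apply/funext => i.
  rewrite /u' /= eq' /lcomb /addv natrD natr_sum /toq; ring.
pose M := (M1 * M2)%N.
have M0 : (0 < M)%N by rewrite muln_gt0 M10.
have nzM : (M%:R : rat) != 0 by rewrite pnatr_eq0 -lt0n.
pose Th e := (M2 * mm (inl e))%N; pose W := scv M2 (mm \o inr).
pose Qn e := scv M1 (qn e).
have hTh e : M%:R * u' (inl e) = (Th e)%:R.
  by rewrite /M /Th !natrM -(hm (inl e)); ring.
have hW i : M%:R * v' i = (W i)%:R.
  by rewrite /M /W /scv !natrM /= -(hm (inr i)); ring.
have hQn e i : M%:R * u' (inr (e, i)) = (Qn e i)%:R.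
  by rewrite /M /Qn /scv !natrM -(hq e).2; ring.
have PQn e : P e (Qn e) by apply: periodic_scv => //; exact: (hq e).1.
have Th0 e : (0 < Th e)%N.
  rewrite -(ltr0n rat) -hTh mulr_gt0 ?ltr0n // /u' ltr_wpDl // mulr_gt0 // ltr0n.
  exact: (dw e).1.
pose u0' (x : 'I_k + 'I_k * (I + I)) : rat :=
  match x with inl e => (th0 e)%:R | inr y => (Q0 y.1 y.2)%:R end.
have side' i : side u' i = side u i + e1 * side u0' i.
  rewrite /side mulr_sumr -big_split; apply: eq_bigr => e _ /=; rewrite /u'; ring.
have side0 i : (sideb th0 Q0 i)%:R = side u0' i.
  by rewrite (@sideb_side 1 _ _ u0') ?mul1r // => *; rewrite mul1r.
have qbal' p : qbal u' p = qbal u p + e1 * qbal u0' p.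
  rewrite /qbal mulr_sumr -big_split; apply: eq_bigr => e _ /=; rewrite /u'; ring.
have qbal0 p : qbal u0' p = 0.
  have := @qbal_flow 1 th0 u0' p; rewrite bQ0 subrr mul1r => -> // e.
  by rewrite mul1r.
have eW i : (W (inr i) + sideb Th Qn (inl i) = W (inl i) + sideb Th Qn (inr i))%N.
  apply/eqP; rewrite -(eqr_nat rat) !natrD !(sideb_side _ hTh hQn) -!hW -!mulrDr.
  apply/eqP; congr (_ * _); rewrite /v' /lcomb !side' !mul1r.
  have hB := eu i; have := congr1 (fun n => n%:R : rat) (eQ0 i).
  rewrite (natrD _ (y0 i)) (natrD _ (x0 i)) !side0 /toq [pr _ _ _]/= [X in _ = _ + _ * X%:R + _]/= => hA.
  have hA' := congr1 (fun z => e1 * z) hA; rewrite /= in hA'; lra.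
have bTh p : outflow srcN Th p = inflow tgtN Th p.
  case: (pselect (exists f, srcN f = p \/ tgtN f = p)) => [[f hf]|nf].
    apply/eqP; rewrite -(eqr_nat rat) -subr_eq0 (qbal_flow _ hTh) qbal' qbal0 mulr0 addr0.
    by have [b1 b2] := bu f; case: hf => <-; rewrite ?b1 ?b2 mulr0.
  rewrite /outflow /inflow !big1 // => e _.
    by case: eqP => [h'|_]; [exfalso; apply: nf; exists e; right|rewrite muln0].
  by case: eqP => [h'|_]; [exfalso; apply: nf; exists e; left|rewrite muln0].
have ZW : ZI W.
  move=> i bi; have [z1 z2] := vz i bi; have [w1 w2] := PV_ZI PVw bi.
  have hh k' : v k' = 0 -> pr x0 y0 k' = 0%N -> W k' = 0%N.
    move=> a1 a2; apply/eqP; rewrite -(eqr_nat rat) -hW /v' /lcomb /toq a1 a2.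
    by apply/eqP; ring.
  by split; apply: hh.
have [Kn hcyc] := cycle Th0 PQn ZW eW bTh ih hpos.
(* The run builds the stock [Kn h] from [Kn xh], iterates the cycle [n] times, releases the stock
   into [Kn yh], and turns [Kn xr] into [Kn yr]. *)
have main n : Prod X c (addv (scv Kn (pr x0 y0)) (scv n W)).
  have -> : addv (scv Kn (pr x0 y0)) (scv n W) =
     pr (addv (scv Kn x0) (scv n (W \o inl))) (addv (scv Kn y0) (scv n (W \o inr))).
    by apply/funext => -[].
  apply/Prod_pr.
  have r1 := reach_shift monoX (addv (scv Kn xr) (scv n (W \o inl))) (reach_scv monoX Kn h1).
  have r2 := reach_shift monoX (scv Kn xr) (hcyc n).
  have r3 := reach_shift monoX (addv (scv Kn xr) (scv n (W \o inr))) (reach_scv monoX Kn h2).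
  have PVr := fr.1; have hr : reach (addv c xr) (addv c yr) := PVr.1.
  have r4 := reach_shift monoX (addv (scv Kn yh) (scv n (W \o inr))) (reach_scv monoX Kn hr).
  have := reach_trans r1 (reach_trans (_ : reach _ _) (reach_trans (_ : reach _ _) (_ : reach _ _))).
  have E1 : addv c (addv (scv Kn x0) (scv n (W \o inl))) =
    addv (addv c (scv Kn xh)) (addv (scv Kn xr) (scv n (W \o inl))).
    by apply/funext => i; rewrite /x0 /addv /scv mulnDr; lia.
  have E2 : addv (addv c (scv Kn h)) (addv (scv Kn xr) (scv n (W \o inl))) =
    addv (addv (addv c (scv Kn h)) (scv n (W \o inl))) (scv Kn xr).
    by apply/funext => i; rewrite /addv /scv; lia.
  have E3 : addv (addv (addv c (scv Kn h)) (scv n (W \o inr))) (scv Kn xr) =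
    addv (addv c (scv Kn h)) (addv (scv Kn xr) (scv n (W \o inr))).
    by apply/funext => i; rewrite /addv /scv; lia.
  have E4 : addv (addv c (scv Kn yh)) (addv (scv Kn xr) (scv n (W \o inr))) =
    addv (addv c (scv Kn xr)) (addv (scv Kn yh) (scv n (W \o inr))).
    by apply/funext => i; rewrite /addv /scv; lia.
  have E5 : addv c (addv (scv Kn y0) (scv n (W \o inr))) =
    addv (addv c (scv Kn yr)) (addv (scv Kn yh) (scv n (W \o inr))).
    by apply/funext => i; rewrite /y0 /addv /scv mulnDr; lia.
  move=> _; rewrite E1 E5; apply: (reach_trans r1); rewrite E2; apply: (reach_trans r2).
  by rewrite E3; apply: (reach_trans r3); rewrite E4.
(* [n] is so large that the [Kn] copies of [w], after division by [n M], cost at most [e1]. *)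
have [n [n0 hn]] : exists n : nat, (0 < n)%N /\ Kn%:R <= n%:R * e1 * M%:R.
  have [N [m' [N0 em]]] := rat_nat (ltW e10).
  have m0 : (0 < m')%N by rewrite -(ltr0n rat) -em mulr_gt0 // ltr0n.
  exists (N * Kn.+1)%N; split; first by rewrite muln_gt0 N0.
  rewrite natrM (mulrAC N%:R) em -!natrM ler_nat.
  apply: (@leq_trans (m' * Kn.+1)); first by nia.
  by rewrite leq_pmulr.
have nM : 0 < (n%:R * M%:R : rat) by rewrite mulr_gt0 // ltr0n.
have := cC.2 ((n%:R * M%:R)^-1) (eps - e1 - Kn%:R / (n%:R * M%:R)) _ _ _ _
  (coneP_sub (main n)) (coneP_sub PVw.1).
have -> : lcomb (n%:R * M%:R)^-1 (eps - e1 - Kn%:R / (n%:R * M%:R))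
    (toq (addv (scv Kn (pr x0 y0)) (scv n W))) (toq (pr x0 y0)) =
    lcomb 1 eps v (toq (pr x0 y0)).
  apply/funext => i; rewrite /lcomb /toq.
  rewrite (_ : addv _ _ i = (Kn * pr x0 y0 i + n * W i)%N) //.
  rewrite natrD (natrM _ Kn) (natrM _ n (W i)) -hW /v' /lcomb /toq.
  have nzn : (n%:R : rat) != 0 by rewrite pnatr_eq0 -lt0n.
  by field; rewrite nzM nzn.
apply; first by rewrite invr_ge0 ltW.
rewrite subr_ge0 ler_pdivrMr //.
have -> : eps - e1 = e1 by rewrite /e1; field.
by rewrite mulrA (mulrC e1).
Qed.
End Edges.

Lemma cone_Prod_nice : exists K w, [/\ basic false K, coneP (Prod X c) w, V w,
  forall v, coneP (Prod X c) v -> V v -> K v &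
  forall v e, K v -> V v -> 0 < e -> coneP (Prod X c) (lcomb 1 e v w)].
Proof.
have [k [b [P [bU hP bC]]]] := used_cover.
have perP e : periodicv (P e) by have [] := hP e.
have /choice[sp hsp] : forall e, exists x : {m : nat & 'I_m -> I + I -> nat},
    (forall j, Ue b P e (projT2 x j)) /\ forall u, Ue b P e u ->
    exists cc : 'I_(projT1 x) -> rat, forall i, toq u i = \sum_j cc j * toq (projT2 x j) i.
  move=> e; have [m [q [qS hq]]] := span_exists [set toq u | u in Ue b P e].
  have /choice[q' hq'] : forall j, exists u, Ue b P e u /\ toq u = q j.
    by move=> j; have [u Uu <-] := qS j; exists u.
  exists (existT _ m q'); split=> [j|u Uu] /=; first exact: (hq' j).1.
  have [|cc hcc] := hq (toq u); first by exists u.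
  by exists cc => i; rewrite hcc; apply: eq_bigr => j _; rewrite (hq' j).2.
pose m e := projT1 (sp e); pose qq e : 'I_(m e) -> I + I -> nat := projT2 (sp e).
have /choice[K hK] : forall e, exists K, [/\ basic false K,
    forall v, coneP (P e) v -> spane qq e v -> K v &
    forall v eps, K v -> 0 < eps -> coneP (P e) (lcomb 1 eps v (fun i => \sum_j toq (qq e j) i))].
  move=> e; have [_ _ eP _] := hP e.
  apply: (edef_hull (q := fun j => toq (qq e j)) (coneP_ccone (perP e)) eP) => j.
  by apply: coneP_sub; have [] := (hsp e).1 j.
have PZ e : P e `<=` ZI by have [] := hP e.
have bX e p : P e p -> X (addv (b e) p) by have [_ _ _ h] := hP e; exact: h.
have KB e : basic false (K e) by have [] := hK e.
have KS e v : coneP (P e) v -> spane qq e v -> K e v by have [_ h _] := hK e; exact: h.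
have KH e v eps : K e v -> 0 < eps ->
  coneP (P e) (lcomb 1 eps v (fun i => \sum_(j < m e) toq (qq e j) i)).
  by have [_ _ h] := hK e; exact: h.
have [w [h1 h2 h3]] := Kset_approx bU perP PZ bX bC (fun e => (hsp e).1)
  (fun e => (hsp e).2) KH.
exists (Kset b K), w; split=> //.
- exact: Kset_basic.
- exact: (cone_sub_Kset perP PZ bC (fun e => (hsp e).2) KS).
- by move=> v e Kv _; exact: h3.
Qed.
End ConeStar.

Lemma edef_coneP_Prod (I : finType) (F : fam (I + I)) c :
  good F -> mono (supp F) -> edef (coneP (Prod (supp F) c)).
Proof.
move=> gF mF; apply: nice_edef; first exact/coneP_ccone/periodic_Prod.
by move=> V sV; exact: cone_Prod_nice.
Qed.

(** * Composition and reflexive transitive closure of families *)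

Definition comp (I : Type) (P Q : set (I + I -> nat)) : set (I + I -> nat) :=
  [set w : I + I -> nat | exists2 z, P (pr (w \o inl) z) & Q (pr z (w \o inr))].

Definition a12 (I : Type) : amap (I + (I + I)) (I + I) :=
  areindex (fun k : I + I => match k with inl i => inl i | inr i => inr (inl i) end).
Definition a23 (I : Type) : amap (I + (I + I)) (I + I) := areindex inr.
Definition a13 (I : Type) : amap (I + (I + I)) (I + I) :=
  areindex (fun k : I + I => match k with inl i => inl i | inr i => inr (inr i) end).
Arguments a12 {I}.
Arguments a23 {I}.
Arguments a13 {I}.

Lemma a12E (I : Type) (x y z : I -> nat) : a12 (pr x (pr y z)) = pr x y.
Proof. by apply/funext => -[]. Qed.
Lemma a13E (I : Type) (x y z : I -> nat) : a13 (pr x (pr y z)) = pr x z.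
Proof. by apply/funext => -[]. Qed.

(** Reduces composition to preimages, an intersection and an image, for which all closure properties
    are available. *)
Lemma compE (I : Type) (P Q : set (I + I -> nat)) :
  comp P Q = [set a13 w | w in [set w | P (a12 w)] `&` [set w | Q (a23 w)]].
Proof.
apply/funext => w; apply/propext; split.
  move=> [z Pz Qz]; exists (pr (w \o inl) (pr z (w \o inr))); last by rewrite a13E pr_eta.
  have h : P (a12 (pr (w \o inl) (pr z (w \o inr)))) by rewrite a12E.
  by split; [exact: h|exact: Qz].
move=> [u [/= P1 Q1] <-]; exists (u \o (inr \o inl)).
  by congr P: P1; apply/funext => -[].
by congr Q: Q1; apply/funext => -[].
Qed.

Lemma comp_pr (I : Type) (P Q : set (I + I -> nat)) x y z :
  P (pr x y) -> Q (pr y z) -> comp P Q (pr x z).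
Proof. by exists y. Qed.

Lemma periodic_comp (I : Type) (P Q : set (I + I -> nat)) :
  periodicv P -> periodicv Q -> periodicv (comp P Q).
Proof.
by move=> pP pQ; rewrite compE; apply/periodic_img/periodicI; apply: periodic_pre.
Qed.

Lemma edef_coneP_comp (I : finType) (P Q : set (I + I -> nat)) :
  periodicv P -> periodicv Q -> edef (coneP P) -> edef (coneP Q) ->
  edef (coneP (comp P Q)).
Proof.
move=> pP pQ eP eQ; rewrite compE; apply: edef_coneP_img.
by apply: edef_conePI; try apply: periodic_pre; try exact: edef_coneP_pre.
Qed.

Definition fcomp (I : finType) (F G : fam (I + I)) : fam (I + I) :=
  fimg (@a13 I) zv (finter (fpre (@a12 I) zv F) (fpre (@a23 I) zv G)).

Definition dcomp (I : Type) (D E : set ((I + I) + (I + I) -> nat)) :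
    set ((I + I) + (I + I) -> nat) :=
  [set w : (I + I) + (I + I) -> nat | exists x y, D (pr (pr (w \o (inl \o inl)) x) (pr (w \o (inr \o inl)) y)) /\
                       E (pr (pr x (w \o (inl \o inr))) (pr y (w \o (inr \o inr))))].

Lemma supp_comp (I : finType) (F G : fam (I + I)) :
  supp (fcomp F G) = comp (supp F) (supp G).
Proof. by rewrite supp_img supp_inter !supp_pre compE. Qed.

Lemma dbl_comp (I : finType) (F G : fam (I + I)) :
  dbl (fcomp F G) = dcomp (dbl F) (dbl G).
Proof.
rewrite dbl_img dbl_inter !dbl_pre; apply/funext => w; apply/propext; split.
  move=> [u [/= h1 h2] <-].
  exists (u \o (inl \o (inr \o inl))), (u \o (inr \o (inr \o inl))); split.
    by congr (dbl F): h1; apply/funext => -[[]|[]].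
  by congr (dbl G): h2; apply/funext => -[[]|[]].
move=> [x [y [h1 h2]]].
exists (pr (pr (w \o (inl \o inl)) (pr x (w \o (inl \o inr))))
           (pr (w \o (inr \o inl)) (pr y (w \o (inr \o inr))))).
  split=> /=.
    by congr (dbl F): h1; apply/funext => -[[]|[]].
  by congr (dbl G): h2; apply/funext => -[[]|[]].
by apply/funext => -[[]|[]].
Qed.

Lemma good2_comp (I : finType) (F G : fam (I + I)) :
  good2 F -> good2 G -> good2 (fcomp F G).
Proof. by move=> gF gG; apply/good2_img/good2_inter; apply: good2_pre. Qed.

Lemma fcomp_zv (I : finType) (F G : fam (I + I)) P Q :
  F zv P -> G zv Q -> fcomp F G zv (comp P Q).
Proof.
move=> hF hG; exists zv, ([set w | P (a12 w)] `&` [set w | Q (a23 w)]); split.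
- by exists [set w | P (a12 w)], [set w | Q (a23 w)]; split=> //; [exists P|exists Q].
- by [].
- by rewrite compE.
Qed.

Section Star.
Variables (I : finType) (F : fam (I + I)).
Let X := supp F.
Local Notation reach := (reachX X).
Local Notation letter := ((I + I -> nat) * set (I + I -> nat))%type.

Fixpoint chain (s : I -> nat) (w : seq letter) (t : I -> nat) : Prop :=
  if w is x :: w' then x.1 \o inl = s /\ chain (x.1 \o inr) w' t else s = t.

Fixpoint piece (s : I -> nat) (w : seq letter) : set (I + I -> nat) :=
  if w is x :: w' then comp (Prod X s) (comp x.2 (piece (x.1 \o inr) w'))
  else Prod X s.

Definition lettersF (w : seq letter) := allp (fun x : letter => F x.1 x.2) w.

Definition fstar : fam (I + I) := fun b P =>
  exists w, [/\ lettersF w, chain (b \o inl) w (b \o inr) & P = piece (b \o inl) w].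

Lemma chain_reach s w t : lettersF w -> chain s w t -> reach s t.
Proof.
elim: w s => [|x w IH] s /=; first by move=> _ ->; exact: reach0.
move=> [Fx Fw] [<- h]; apply: reachS (IH _ Fw h).
by rewrite pr_eta; exists x.2.
Qed.

Lemma reach_chain s t : reach s t -> exists2 w, lettersF w & chain s w t.
Proof.
elim=> [u|u v w [P hP] _ [l hl cl]]; first by exists [::].
by exists ((pr u v, P) :: l).
Qed.

Lemma supp_star : supp fstar = [set w : I + I -> nat | reach (w \o inl) (w \o inr)].
Proof.
apply/funext => b; apply/propext; split.
  by move=> [_ [w [h1 h2 _]]]; exact: chain_reach h1 h2.
by move=> /reach_chain[w h1 h2]; exists (piece (b \o inl) w), w.
Qed.

Lemma piece_reach s w t z z' : lettersF w -> chain s w t -> good F ->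
  piece s w (pr z z') -> reach (addv s z) (addv t z').
Proof.
move=> + + [_ G2 _ _]; elim: w s z => [|x w IH] s z /=; first by move=> _ ->.
move=> [Fx Fw] [<- h] [z1 p1 [z2 p2 p3]].
have := IH _ z2 Fw h p3; apply: reach_trans.
apply: (reach_trans p1); apply: reach1.
have := G2 _ _ _ Fx p2; congr X.
by rewrite -[x.1 in LHS]pr_eta addv_pr.
Qed.

Lemma emb_consP a u v s t : lettersF v -> chain s v t -> emb (@fle (I + I)) (a :: u) v ->
  exists a' v', [/\ reach s (a'.1 \o inl), fle a a', emb (@fle (I + I)) u v', lettersF v' &
     chain (a'.1 \o inr) v' t].
Proof.
move=> + + e; have [au eau] : exists au, au = a :: u by exists (a :: u).
rewrite -eau in e; elim: e s eau => //.
  move=> u0 b w e IH s eq /= [Fb Fw] [<- h].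
  have [a' [v' [h1 h2 h3 h4 h5]]] := IH _ eq Fw h.
  exists a', v'; split=> //; apply: reachS h1; rewrite pr_eta; by exists b.2.
move=> a0 u0 b w r e IH s [<- <-] /= [Fb Fw] [<- h].
by exists b, w; split=> //; exact: reach0.
Qed.

(** The run along [v] splits at the letters matched by [u]: letters skipped before a match form a
    production at the point that [u] visits, and the match itself contributes a period of the
    letter. *)
Lemma emb_piece u v s t z z' : emb (@fle (I + I)) u v -> lettersF v ->
  chain s u t -> chain (addv s z) v (addv t z') -> piece s u (pr z z').
Proof.
elim: u v s z => [|a u IH] v s z /=.
  by move=> _ Fv -> /(chain_reach Fv).
move=> e Fv [es h] hv; have [a' [v' [h1 [p Pp ea] h3 h4 h5]]] := emb_consP Fv hv e.
have e1 : addv s (p \o inl) = a'.1 \o inl by rewrite ea -es.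
exists (p \o inl); first by apply/Prod_pr; rewrite e1.
exists (p \o inr); first by rewrite -[X in a.2 X]/(pr (p \o inl) (p \o inr)) pr_eta.
apply: IH h3 h4 h _; have -> : addv (a.1 \o inr) (p \o inr) = a'.1 \o inr by rewrite ea.
by [].
Qed.

Hypothesis gF : good F.
Hypothesis monoX : mono X.

Lemma periodic_piece s w : lettersF w -> periodicv (piece s w).
Proof.
have [G1 _ _ _] := gF.
elim: w s => [|x w IH] s /=; first by move=> _; exact: periodic_Prod.
move=> [Fx Fw]; apply: periodic_comp; first exact: periodic_Prod.
by apply: periodic_comp; [exact: G1 Fx|exact: IH].
Qed.

Lemma edef_piece s w : lettersF w -> edef (coneP (piece s w)).
Proof.
have [G1 _ _ G4] := gF.
elim: w s => [|x w IH] s /=; first by move=> _; exact: edef_coneP_Prod.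
move=> [Fx Fw]; have pw := periodic_piece (x.1 \o inr) Fw.
apply: edef_coneP_comp; [exact: periodic_Prod| |exact: edef_coneP_Prod|].
  by apply: periodic_comp => //; exact: G1 Fx.
by apply: edef_coneP_comp => //; [exact: G1 Fx|exact: G4 Fx|exact: IH].
Qed.

Lemma good_star : good fstar.
Proof.
have [G1 G2 G3 G4] := gF; split.
- by move=> b _ [w [Fw _ ->]]; exact: periodic_piece.
- move=> b _ p [w [Fw cw ->]] Pp; rewrite supp_star /=.
  by apply: (piece_reach Fw cw gF); rewrite pr_eta.
- apply: (af_link (D := fun x : (I + I -> nat) * seq letter =>
      lettersF x.2 /\ chain (x.1 \o inl) x.2 (x.1 \o inr))
    (R := fun x y => emb (@fle (I + I)) x.2 y.2 /\ forall i, (x.1 i <= y.1 i)%N)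
    (link := fun x y => [/\ x.1 = y.1, lettersF x.2, chain (x.1 \o inl) x.2 (x.1 \o inr) &
       y.2 = piece (x.1 \o inl) x.2])).
  + apply: af_and; last by apply: (af_pre (g := fst) (@dickson (I + I)%type)).
    by apply: (af_pre (g := snd) (higman G3)) => x [].
  + by move=> [b P] /= [w [h1 h2 ->]]; exists (b, w).
  + move=> [b w] [b' P] [b1 w1] [b1' P1] /= [<- Fw cw ->] [<- Fw1 cw1 ->] [e /le_addv[p ep]].
    exists p => //=; rewrite -(pr_eta p); apply: (emb_piece e Fw1 cw).
    by move: cw1; rewrite ep.
- by move=> b _ [w [Fw _ ->]]; exact: edef_piece.
Qed.

Lemma Prod_refl s z : Prod X s (pr z z).
Proof. exact: reach0. Qed.

Lemma piece_pre s w z z1 z' : Prod X s (pr z z1) -> piece s w (pr z1 z') ->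
  piece s w (pr z z').
Proof.
case: w => [|x w] /= h; first exact: reach_trans.
by move=> [z2 p1 p2]; exists z2 => //; exact: (reach_trans h p1).
Qed.
End Star.

(** * The doubled relation of a closure *)

(** Bases and periods are shifted independently, which makes the steps of the doubled system
    compatible with addition. *)
Definition mono2 (I : finType) (D : set ((I + I) + (I + I) -> nat)) :=
  forall s t z z' a a', D (pr (pr s t) (pr z z')) ->
    D (pr (pr (addv s a) (addv t a)) (pr (addv z a') (addv z' a'))).

Lemma supp_dbl (I : finType) (F : fam I) b : good F -> supp F b <-> dbl F (pr b zv).
Proof.
move=> [G1 _ _ _]; split; first by move=> [P hP]; exists P => //; exact: (G1 _ _ hP).1.
by move=> [P hP _]; exists P.
Qed.

Lemma mono2_mono (I : finType) (F : fam (I + I)) : good F ->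
  mono2 (dbl F) -> mono (supp F).
Proof.
move=> gF h s t a /(supp_dbl _ gF); rewrite -pr0 => hd; have := h _ _ _ _ a zv hd.
by rewrite !addv0 pr0 => /(supp_dbl _ gF).
Qed.

(** Exchanging the middle blocks turns a step from [s] to [t] with period [(z, z')] into a step of
    pairs from [(s, z)] to [(t, z')]. *)
Definition tau (I : Type) (k : (I + I) + (I + I)) : (I + I) + (I + I) :=
  match k with
  | inl (inr i) => inr (inl i) | inr (inl i) => inl (inr i) | k' => k'
  end.

Lemma tauE (I : Type) (s z t z' : I -> nat) :
  areindex (@tau I) (pr (pr s z) (pr t z')) = pr (pr s t) (pr z z').
Proof. by apply/funext => -[[]|[]]. Qed.

(** Together with [apsi] it presents the step from [(s, z)] to [(s, z')] that is allowed when
    [(z, z')] is a production at [s]. *)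
Definition asigma (I : Type) : amap (I + (I + I)) (I + I).
Proof.
refine (@AMap (I + (I + I)) (I + I)
  (fun w => pr (addv (w \o inl) (w \o (inr \o inl))) (addv (w \o inl) (w \o (inr \o inr))))
  (fun w => pr (lcomb 1 1 (w \o inl) (w \o (inr \o inl))) (lcomb 1 1 (w \o inl) (w \o (inr \o inr)))) _ _ _).
- by move=> x y; rewrite addv_pr; congr pr; apply/funext => i; rewrite /addv /= addnACA.
- by move=> a b u v; apply/funext => -[i|i]; rewrite /lcomb /=; ring.
- by move=> x; apply/funext => -[i|i]; rewrite /lcomb /toq /addv /= natrD; ring.
Defined.

Definition apsi (I : Type) : amap (I + (I + I)) ((I + I) + (I + I)) :=
  areindex (fun k : (I + I) + (I + I) => match k with
    | inl (inl i) => inl i | inl (inr i) => inr (inl i)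
    | inr (inl i) => inl i | inr (inr i) => inr (inr i) end).

Arguments asigma : simpl never.

Lemma apsiE (I : Type) (s z z' : I -> nat) : apsi I (pr s (pr z z')) = pr (pr s z) (pr s z').
Proof. by apply/funext => -[[]|[]]. Qed.

Lemma pr_inj (T I J : Type) (x x' : I -> T) (y y' : J -> T) :
  pr x y = pr x' y' -> x = x' /\ y = y'.
Proof.
by move=> e; split; apply/funext => i; [have /(congr1 (@^~ (inl i))) := e|have /(congr1 (@^~ (inr i))) := e].
Qed.

Section Star2.
Variables (I : finType) (F : fam (I + I)) (G : fam ((I + I) + (I + I))).
Hypothesis gF : good F.
Hypothesis gG : good G.
Hypothesis eG : supp G = dbl F.
Hypothesis m2 : mono2 (dbl F).
Let X := supp F.
Let monoX : mono X := mono2_mono gF m2.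

(* A step of the doubled system acts either on the base run or on the pump.   *)
Definition fpump : fam ((I + I) + (I + I)) :=
  funion (fpre (areindex (@tau I)) zv G)
         (fimg (apsi I) zv (fpre (asigma I) zv (fstar F))).

Lemma good_pump : good fpump.
Proof.
apply: good_union; first exact: good_pre.
by apply/good_img/good_pre/good_star.
Qed.

Lemma supp_pump s z t z' : supp fpump (pr (pr s z) (pr t z')) <->
  dbl F (pr (pr s t) (pr z z')) \/ (s = t /\ Prod X s (pr z z')).
Proof.
rewrite supp_union supp_img !supp_pre eG supp_star; split.
  move=> [h|[w h e]]; first by left; rewrite -tauE.
  right; move: h e; rewrite -(pr_eta w) -(pr_eta (w \o inr)) apsiE /= => h.
  rewrite add0v => /pr_inj[/pr_inj[e1 e2] /pr_inj[e3 e4]].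
  by split; [rewrite -e1 -e3|move: h; rewrite e1 e2 e4].
move=> [h|[-> h]]; first by left; move: h; rewrite -tauE.
by right; exists (pr t (pr z z')); rewrite ?apsiE.
Qed.

Lemma mono_pump : mono (supp fpump).
Proof.
move=> x y a; rewrite -(pr_eta x) -(pr_eta y) -(pr_eta a) !addv_pr => /supp_pump h.
apply/supp_pump; case: h => [h|[-> h]]; first by left; exact: m2.
right; split=> //; rewrite /Prod /=.
have := reach_shift monoX (addv (a \o inl) (a \o inr)) h.
by congr reachX; apply/funext => i; rewrite /addv /=; lia.
Qed.

Lemma piece_pump s w t z z' : lettersF F w -> chain s w t -> piece F s w (pr z z') ->
  reachX (supp fpump) (pr s z) (pr t z').
Proof.
elim: w s z => [|x w IH] s z /=.
  by move=> _ -> h; apply: reach1; apply/supp_pump; right.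
move=> [Fx Fw] [es h] [z1 p1 [z2 p2 p3]].
apply: (reachS (t := pr s z1)); first by apply/supp_pump; right.
apply: reachS (IH _ z2 Fw h p3); apply/supp_pump; left.
by rewrite -es pr_eta; exists x.2.
Qed.

(** A letter is preceded by the trivial production, and further productions at the same point are
    merged into it by [piece_pre]. *)
Lemma pump_piece x y : reachX (supp fpump) x y ->
  exists w, [/\ lettersF F w, chain (x \o inl) w (y \o inl) &
     piece F (x \o inl) w (pr (x \o inr) (y \o inr))].
Proof.
elim=> [u|u v t uv vt [w [h1 h2 h3]]].
  by exists [::]; split=> //; exact: reach0.
move: uv; rewrite -{1}(pr_eta u) -{1}(pr_eta v) => /supp_pump[[P FP PP]|[e h]].
  exists ((pr (u \o inl) (v \o inl), P) :: w); split=> //=.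
  exists (u \o inr); first exact: Prod_refl.
  by exists (v \o inr).
exists w; rewrite e; split=> //; apply: piece_pre h3.
by rewrite -e.
Qed.

Lemma dbl_starP s t z z' : dbl (fstar F) (pr (pr s t) (pr z z')) <->
  reachX (supp fpump) (pr s z) (pr t z').
Proof.
split; first by move=> [_ [w [h1 h2 ->]]]; exact: piece_pump.
by move=> /pump_piece[w [h1 h2 h3]]; exists (piece F s w) => //; exists w.
Qed.

(** A piece of the closure alternates productions and periods of letters, which are the two kinds of
    steps of the doubled system; hence its doubled relation is itself a closure, up to exchanging
    blocks. *)
Lemma dbl_star : dbl (fstar F) = supp (fpre (areindex (@tau I)) zv (fstar fpump)).
Proof.
rewrite supp_pre supp_star; apply/funext => b; apply/propext.
have e : b = pr (pr (b \o (inl \o inl)) (b \o (inl \o inr))) (pr (b \o (inr \o inl)) (b \o (inr \o inr))).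
  by apply/funext => -[[]|[]].
rewrite e dbl_starP; move: (b \o _) (b \o _) (b \o _) (b \o _) => z' t z s.
rewrite -[X in _ <-> X]/(reachX (supp fpump)
  (areindex (@tau I) (pr (pr s t) (pr z z')) \o inl)
  (areindex (@tau I) (pr (pr s t) (pr z z')) \o inr)).
by rewrite tauE.
Qed.
End Star2.

Lemma good2_star (I : finType) (F : fam (I + I)) :
  good2 F -> mono2 (dbl F) -> good2 (fstar F).
Proof.
move=> [gF [G gG eG]] m2; split; first exact: good_star gF (mono2_mono gF m2).
exists (fpre (areindex (@tau I)) zv (fstar (fpump F G))); last exact: esym (dbl_star eG).
apply/good_pre/good_star; first exact: good_pump gF gG m2.
exact: mono_pump gF eG m2.
Qed.

Lemma mono2_star (I : finType) (F : fam (I + I)) :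
  good2 F -> mono2 (dbl F) -> mono2 (dbl (fstar F)).
Proof.
move=> [gF [G gG eG]] m2 s t z z' a a'.
move=> /(dbl_starP eG) h; apply/(dbl_starP eG).
by have := reach_shift (mono_pump gF eG m2) (pr a a') h; rewrite !addv_pr.
Qed.

(** * Flat runs *)

(* The parameter of type [nat -> nat] collects the numbers of iterations.     *)
Definition pvec (I : Type) := (nat -> nat) -> I -> nat.

Definition pline (I : Type) (x : (I -> nat) * (I -> nat) * ((nat -> nat) -> nat)) : pvec I :=
  fun n => addv x.1.1 (scv (x.2 n) x.1.2).

Definition plines (I : Type) (l : seq ((I -> nat) * (I -> nat) * ((nat -> nat) -> nat))) : pvec I :=
  fun n => foldr (fun x a => addv (pline x n) a) zv l.

(** Several lines are added up because linear relations have several generators, and one flat run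
    has to serve all their iteration counts at once. *)
Definition flatp (I : Type) (pfl : pvec I -> pvec I -> Prop) (b : I + I -> nat)
    (D : set ((I + I) + (I + I) -> nat)) : Prop :=
  forall l, allp (fun x => D (pr x.1.1 x.1.2)) l ->
    pfl (fun n => addv (b \o inl) (plines l n \o inl))
        (fun n => addv (b \o inr) (plines l n \o inr)).

(* [pfl a b] stands for: for all [n], [b n] is reached from [a n] by a flat   *)
(* run that does not depend on [n] except for the numbers of iterations.      *)
Definition flat_comp (I : Type) (pfl : pvec I -> pvec I -> Prop) :=
  forall a b c, pfl a b -> pfl b c -> pfl a c.
Definition flat_shift (I : Type) (pfl : pvec I -> pvec I -> Prop) :=
  forall a b c, pfl a b -> pfl (fun n => addv (a n) (c n)) (fun n => addv (b n) (c n)).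
Definition flat_loop (I : Type) (pfl : pvec I -> pvec I -> Prop) (R : (I -> nat) -> (I -> nat) -> Prop) :=
  forall s z z' (k : (nat -> nat) -> nat), R (addv s z) (addv s z') ->
    pfl (fun n => addv s (scv (k n) z)) (fun n => addv s (scv (k n) z')).

Lemma allp_sub (A : Type) (D D' : A -> Prop) l :
  (forall x, D x -> D' x) -> allp D l -> allp D' l.
Proof. by move=> h; elim: l => //= x l IH [/h ? /IH]. Qed.

Lemma flatp_sub (I : Type) (pfl : pvec I -> pvec I -> Prop) b D D' :
  D `<=` D' -> flatp pfl b D' -> flatp pfl b D.
Proof. by move=> h hf l hl; apply: hf; apply: allp_sub hl => x; exact: h. Qed.

(** Every line of the composite factors through a line of middle points, with the same iteration
    count on both sides. *)
Lemma flatp_comp (I : Type) (pfl : pvec I -> pvec I -> Prop) s u t D E :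
  flat_comp pfl -> flatp pfl (pr s u) D -> flatp pfl (pr u t) E ->
  flatp pfl (pr s t) (dcomp D E).
Proof.
move=> hc hD hE l hl.
have [l1 [l2 [h1 h2 e]]] : exists l1 l2, [/\ allp (fun x => D (pr x.1.1 x.1.2)) l1,
   allp (fun x => E (pr x.1.1 x.1.2)) l2 & forall n, [/\ plines l1 n \o inl = plines l n \o inl,
     plines l1 n \o inr = plines l2 n \o inl & plines l2 n \o inr = plines l n \o inr]].
  elim: l hl => [|[[a q] k] l IH] /=; first by move=> _; exists [::], [::].
  move=> [[x [y [Dxy Exy]]] /IH[l1 [l2 [h1 h2 e]]]].
  exists ((pr (a \o inl) x, pr (q \o inl) y, k) :: l1), ((pr x (a \o inr), pr y (q \o inr), k) :: l2).
  split=> //= n; have [e1 e2 e3] := e n.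
  have ad (v w : I + I -> nat) : (addv v w \o inl = addv (v \o inl) (w \o inl)) /\
    (addv v w \o inr = addv (v \o inr) (w \o inr)) by [].
  by rewrite !(ad _ _).1 !(ad _ _).2 e1 e2 e3.
have e1 n : plines l n \o inl = plines l1 n \o inl by have [] := e n.
have e2 n : plines l n \o inr = plines l2 n \o inr by have [] := e n.
have e3 n : plines l2 n \o inl = plines l1 n \o inr by have [] := e n.
under eq_fun do rewrite e1; under [X in pfl _ X]eq_fun do rewrite e2.
apply: (hc _ _ _ (hD _ h1)); have := hE _ h2.
by under eq_fun do rewrite e3.
Qed.

(** [H zv P] makes each period the direction of a line through the base itself. *)
Lemma pline_one (I : Type) (pfl : pvec I -> pvec I -> Prop) b H P q k :
  flatp pfl b (dbl H) -> H zv P -> P q ->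
  pfl (fun n => addv (b \o inl) (scv (k n) (q \o inl)))
      (fun n => addv (b \o inr) (scv (k n) (q \o inr))).
Proof.
move=> hf hP Pq; have h : allp (fun x => dbl H (pr x.1.1 x.1.2)) [:: (zv, q, k)].
  by split=> //; exists P.
have := hf _ h; congr pfl; apply/funext => n; apply/funext => i;
  by rewrite /plines /= /pline /addv /scv /zv /=; lia.
Qed.

Lemma good3_comp (I : finType) (pfl : pvec I -> pvec I -> Prop) (F G : fam (I + I)) :
  flat_comp pfl -> good3 (flatp pfl) F -> good3 (flatp pfl) G ->
  good3 (flatp pfl) (fcomp F G).
Proof.
move=> hc gF gG.
apply: good3_weak (good3_img (@a13 I) zv (good3_inter (good3_pre (@a12 I) zv gF) (good3_pre (@a23 I) zv gG))).
move=> b D [b' [D0 [-> [D1 [D2 [[E1 f1 ->] [E2 f2 ->] ->]]] ->]]].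
rewrite !add0v in f1 f2 *.
have e : b' = pr (b' \o inl) (pr (b' \o (inr \o inl)) (b' \o (inr \o inr))).
  by apply/funext => -[|[]].
rewrite e a12E in f1; rewrite e a13E.
have {}f2 : flatp pfl (pr (b' \o (inr \o inl)) (b' \o (inr \o inr))) E2.
  by congr (flatp pfl): f2; apply/funext => -[].
apply: flatp_sub (flatp_comp hc f1 f2).
move=> _ [w [h1 h2] <-].
exists (w \o (inl \o (inr \o inl))), (w \o (inr \o (inr \o inl))); split.
  by congr E1: h1; apply/funext => -[[]|[]].
by congr E2: h2; apply/funext => -[[]|[]].
Qed.

Section FlatStar.
Variables (I : finType) (F : fam (I + I)) (pfl : pvec I -> pvec I -> Prop).
Hypothesis hcomp : flat_comp pfl.
Hypothesis hshift : flat_shift pfl.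
Hypothesis hloop : flat_loop pfl (reachX (supp F)).
Hypothesis gF : good3 (flatp pfl) F.
Hypothesis m2 : mono2 (dbl F).

Lemma flat_id s : pfl (fun=> s) (fun=> s).
Proof.
have := @hloop s zv zv (fun=> 0%N) (reach0 _ _).
by congr pfl; apply/funext => n; apply/funext => i; rewrite /addv /scv addn0.
Qed.

Lemma flat_idp (a : pvec I) : pfl a a.
Proof. by have := hshift a (flat_id zv). Qed.

(** A multiple of a production is the iteration of one loop; a multiple of a letter's period is a
    line whose flatness [good3] records. *)
Lemma flat_piece s w t z z' k : lettersF F w -> chain s w t -> piece F s w (pr z z') ->
  pfl (fun n => addv s (scv (k n) z)) (fun n => addv t (scv (k n) z')).
Proof.
elim: w s z => [|x w IH] s z /=; first by move=> _ -> h; exact: hloop.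
move=> [Fx Fw] [es h] [z1 p1 [z2 p2 p3]].
apply: (hcomp (hloop k p1)); apply: hcomp (IH _ _ Fw h p3).
have [H [_ _ h3 h4]] := gF.2 _ _ Fx.
by have := pline_one k h4 h3 p2; rewrite es.
Qed.

Definition aid (J : Type) : amap J J := areindex id.

Lemma dbl_section s u q :
  dbl (fpre (aid (I + I)) (pr s s) (fstar F)) (pr u q) <->
  dbl (fstar F) (pr (addv (pr s s) u) q).
Proof.
rewrite dbl_pre /= ; have -> : addv (pr (pr s s) zv) (asum (aid (I + I)) (aid (I + I)) (pr u q)) =
   pr (addv (pr s s) u) q by apply/funext => -[].
by [].
Qed.

(** The lines are executed one after another: the first runs while the others rest at their left
    ends, then the others run with the first at its right end. *)
Lemma flat_section s : flatp pfl (pr s s) (dbl (fpre (aid (I + I)) (pr s s) (fstar F))).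
Proof.
elim=> [|[[u q] k] l IH] /=; first by move=> _; exact: flat_idp.
move=> [/dbl_section[_ [w [Fw cw ->]] Pq] /IH h].
have h1 := flat_piece k Fw cw (eq_ind_r _ Pq (pr_eta q)).
have h2 := hshift (fun n => plines l n \o inl) h1.
have h3 := hshift (fun n => addv (u \o inr) (scv (k n) (q \o inr))) h.
apply: (@hcomp _ (fun n => addv (addv s (addv (u \o inr) (scv (k n) (q \o inr)))) (plines l n \o inl))).
  congr pfl: h2; apply/funext => n; apply/funext => i;
    rewrite /plines /pline /addv /scv /=; lia.
congr pfl: h3; apply/funext => n; apply/funext => i;
  rewrite /plines /pline /addv /scv /=; lia.
Qed.

Lemma good2_section s : good2 (fpre (aid (I + I)) (pr s s) (fstar F)).
Proof. by apply/good2_pre/good2_star => //; case: gF. Qed.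

Lemma supp_section s : supp (fpre (aid (I + I)) (pr s s) (fstar F)) = Prod (supp F) s.
Proof. by rewrite supp_pre supp_star. Qed.

Lemma section_zv s : fpre (aid (I + I)) (pr s s) (fstar F) zv (Prod (supp F) s).
Proof.
exists (Prod (supp F) s) => //.
have -> : addv (pr s s) (aid (I + I) zv) = pr s s by rewrite an0 addv0.
by exists [::].
Qed.

Lemma good3_star : good3 (flatp pfl) (fstar F).
Proof.
split; first by apply: good2_star => //; case: gF.
move=> b _ [w [Fw cw ->]]; rewrite -{3}(pr_eta b); move: (b \o inl) (b \o inr) cw => s t.
elim: w s Fw => [|x w IH] s /=.
  move=> _ <-; exists (fpre (aid (I + I)) (pr s s) (fstar F)); split.
  - exact: good2_section.
  - exact: supp_section.
  - exact: section_zv.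
  - exact: flat_section.
move=> [Fx Fw] [es h]; have [H [h1 h2 h3 h4]] := IH _ Fw h.
have [H' [h1' h2' h3' h4']] := gF.2 _ _ Fx.
rewrite -[x.1]pr_eta es in h4'.
exists (fcomp (fpre (aid (I + I)) (pr s s) (fstar F)) (fcomp H' H)); split.
- by apply: good2_comp; [exact: good2_section|exact: good2_comp].
- by rewrite !supp_comp supp_section h2 h2'.
- by apply: fcomp_zv; [exact: section_zv|exact: fcomp_zv].
- rewrite !dbl_comp; apply: flatp_comp (@flat_section s) _ => //.
  exact: flatp_comp h4' h4.
Qed.
End FlatStar.

(** * Runs by priority *)

Lemma good3_bigunion (I : finType) (T : finType) (A : pred T) Fl (S : T -> fam I) :
  (forall t, A t -> good3 Fl (S t)) ->
  good3 Fl (fun b P => exists2 t, A t & S t b P).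
Proof.
move=> h.
have : forall l : seq T, good3 Fl (fun b P => exists t, [/\ A t, t \in l & S t b P]).
  elim=> [|t l IH].
    have -> : (fun b P => exists t, [/\ A t, t \in [::] & S t b P]) = @fempty I.
      by apply/funext => b; apply/funext => P; apply/propext; split=> // -[t []].
    exact: good3_empty.
  case: (boolP (A t)) => At.
    have -> : (fun b P => exists u, [/\ A u, u \in t :: l & S u b P]) =
        funion (S t) (fun b P => exists u, [/\ A u, u \in l & S u b P]).
      apply/funext => b; apply/funext => P; apply/propext; split.
        move=> [u [Au]]; rewrite inE => /orP[/eqP->|ul] h1; [by left|by right; exists u].
      by move=> [h1|[u [Au ul h1]]]; [exists t|exists u]; rewrite inE ?eqxx ?ul ?orbT.
    by apply: good3_union => //; exact: h.
  have -> // : (fun b P => exists u, [/\ A u, u \in t :: l & S u b P]) =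
        (fun b P => exists u, [/\ A u, u \in l & S u b P]).
  apply/funext => b; apply/funext => P; apply/propext; split.
    move=> [u [Au]]; rewrite inE => /orP[/eqP eu|ul] h1; last by exists u.
    by rewrite -eu Au in At.
  by move=> [u [Au ul h1]]; exists u; rewrite inE ul orbT.
move=> /(_ (enum T)); congr good3; apply/funext => b; apply/funext => P; apply/propext.
split; first by move=> [t [? _ ?]]; exists t.
by move=> [t ? ?]; exists t; split=> //; rewrite mem_enum.
Qed.

Section Levels.
Variables (d : nat) (V : pvass d).
Local Notation E := (edge V).
Local Notation vec := ('I_d -> nat).

Definition vstep (e : E) (x y : vec) : Prop :=
  (forall j : 'I_d, (j < priority e)%N -> x j = 0%N) /\
  forall j, (y j)%:Z = (x j)%:Z + effect e 0 j.

Fixpoint vrun (w : seq E) (x y : vec) : Prop :=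
  if w is e :: w' then exists2 z, vstep e x z & vrun w' z y else x = y.

Definition vstar (w : seq E) (x y : vec) : Prop := exists k, vrun (flatten (nseq k w)) x y.

Fixpoint vflat (ws : seq (seq E)) (x y : vec) : Prop :=
  if ws is w :: ws' then exists2 z, vstar w x z & vflat ws' z y else x = y.

Definition low (m : nat) (w : seq E) : bool := all (fun e => (priority e < m)%N) w.

Definition zin (m : nat) (a : vec) : Prop := forall j : 'I_d, (j < m)%N -> a j = 0%N.

Lemma vrun_cat w w' x y z : vrun w x y -> vrun w' y z -> vrun (w ++ w') x z.
Proof. by elim: w x => [|e w IH] x /= => [->//|[u h1 h2] h]; exists u => //; exact: IH. Qed.

Lemma vflat_cat w w' x y z : vflat w x y -> vflat w' y z -> vflat (w ++ w') x z.
Proof. by elim: w x => [|e w IH] x /= => [->//|[u h1 h2] h]; exists u => //; exact: IH. Qed.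

Lemma vstep_shift e x y a : zin (priority e) a -> vstep e x y -> vstep e (addv x a) (addv y a).
Proof.
move=> za [h1 h2]; split=> j; first by move=> hj; rewrite /addv h1 // za.
by have := h2 j; rewrite /addv !PoszD => ->; ring.
Qed.

Lemma zin_le m k a : (k <= m)%N -> zin m a -> zin k a.
Proof. by move=> km h j jk; apply: h; exact: leq_trans jk km. Qed.

(** Priorities below [m.+1] test at most the first [m] coordinates, where [a] vanishes. *)
Lemma vrun_shift m w x y a : low m.+1 w -> zin m a -> vrun w x y ->
  vrun w (addv x a) (addv y a).
Proof.
move=> + za; elim: w x => [|e w IH] x /=; first by move=> _ ->.
move=> /andP[he hw] [z h1 h2]; exists (addv z a); last exact: IH.
by apply: vstep_shift h1; apply: zin_le za; rewrite -ltnS.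
Qed.

Lemma low_cat m w w' : low m (w ++ w') = low m w && low m w'.
Proof. exact: all_cat. Qed.

Lemma low_flatten m k w : low m w -> low m (flatten (nseq k w)).
Proof. by move=> h; elim: k => //= k IH; rewrite low_cat h. Qed.

Lemma low_le m k w : (m <= k)%N -> low m w -> low k w.
Proof. by move=> mk; apply: sub_all => e h; exact: leq_trans mk. Qed.

Lemma vstar1 w x y : vrun w x y -> vstar w x y.
Proof. by exists 1%N; rewrite /= cats0. Qed.

Lemma vflat_shift m ws x y a : all (low m.+1) ws -> zin m a -> vflat ws x y ->
  vflat ws (addv x a) (addv y a).
Proof.
move=> + za; elim: ws x => [|w ws IH] x /=; first by move=> _ ->.
move=> /andP[hw hws] [z [k hk] h]; exists (addv z a); last exact: IH.
exists k; apply: (vrun_shift (m := m)) => //; exact: low_flatten.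
Qed.

Lemma vrun_pump m w s z z' k : low m.+1 w -> zin m z -> zin m z' ->
  vrun w (addv s z) (addv s z') -> vstar w (addv s (scv k z)) (addv s (scv k z')).
Proof.
move=> hw hz hz' h; exists k; elim: k => [|k IH] /=.
  by apply/funext => i; rewrite /addv /scv !mul0n.
rewrite !scvS !addvA.
have zk : zin m (scv k z) by move=> j jm; rewrite /scv hz // muln0.
apply: (vrun_cat (vrun_shift hw zk h)).
rewrite addvAC (addvAC s z').
by apply: (vrun_shift (m := m)) => //; exact: low_flatten.
Qed.

Definition Rlow (m : nat) (x y : vec) : Prop := exists2 w, low m w & vrun w x y.

Definition pfl (m : nat) (a b : pvec 'I_d) : Prop :=
  exists2 ws, all (low m) ws & forall n, vflat ws (a n) (b n).

Lemma pfl_comp m : flat_comp (pfl m).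
Proof.
move=> a b c [ws h1 h2] [ws' h1' h2']; exists (ws ++ ws'); first by rewrite all_cat h1.
by move=> n; exact: vflat_cat (h2 n) (h2' n).
Qed.

Lemma pfl_le m k a b : (m <= k)%N -> pfl m a b -> pfl k a b.
Proof.
move=> mk [ws h1 h2]; exists ws => //; apply: sub_all h1 => w; exact: low_le.
Qed.

Definition mono2z (m : nat) (D : set (('I_d + 'I_d) + ('I_d + 'I_d) -> nat)) :=
  forall s t z z' a a', zin m a -> zin m a' -> D (pr (pr s t) (pr z z')) ->
    D (pr (pr (addv s a) (addv t a)) (pr (addv z a') (addv z' a'))).

Lemma mono2z_comp m D D' : mono2z m D -> mono2z m D' -> mono2z m (dcomp D D').
Proof.
move=> h h' s t z z' a a' za za' [x [y [h1 h2]]]; exists (addv x a), (addv y a').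
by split; [exact: h h1|exact: h' h2].
Qed.

Section Iota.
Variable m : nat.
Local Notation J := {i : 'I_d | (m <= i)%N}.

(** Configurations that vanish on the first [m] coordinates are all the vectors over the remaining
    index type; there the loops are compatible with every addition, as [fstar] requires. *)
Definition up (x : J -> nat) : vec := fun i => if insub i is Some j then x j else 0%N.

Definition aup : amap J 'I_d.
Proof.
refine (@AMap J 'I_d up (fun x i => if insub i is Some j then x j else 0) _ _ _).
- by move=> x y; apply/funext => i; rewrite /up /addv; case: insub.
- by move=> a b u v; apply/funext => i; rewrite /lcomb; case: insub => // ; ring.
- by move=> x; apply/funext => i; rewrite /up /toq; case: insub.
Defined.

Lemma up_zin x : zin m (up x).
Proof. by move=> j jm; rewrite /up insubN // -ltnNge. Qed.

Lemma up_sur a : zin m a -> exists b, a = up b.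
Proof.
move=> za; exists (fun j => a (val j)); apply/funext => i; rewrite /up.
case: insubP => [j _ <-//|]; by rewrite -ltnNge => /za.
Qed.

Definition aup2 : amap (J + J) ('I_d + 'I_d) := asum aup aup.

Lemma aup2E x y : aup2 (pr x y) = pr (up x) (up y).
Proof. by apply/funext => -[]. Qed.

Definition pflJ (k : nat) (a b : pvec J) : Prop :=
  pfl k (fun n => up (a n)) (fun n => up (b n)).

Lemma plines_up l n : plines [seq (aup2 x.1.1, aup2 x.1.2, x.2) | x <- l] n =
  aup2 (plines l n).
Proof.
elim: l => [|x l IH]; first exact: (esym (an0 aup2)).
transitivity (addv (addv (aup2 x.1.1) (scv (x.2 n) (aup2 x.1.2)))
  (plines [seq (aup2 x.1.1, aup2 x.1.2, x.2) | x <- l] n)); first by [].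
by rewrite IH -an_scv -!an_add.
Qed.

Lemma up_inl (x : J + J -> nat) : aup2 x \o inl = up (x \o inl).
Proof. by []. Qed.
Lemma up_inr (x : J + J -> nat) : aup2 x \o inr = up (x \o inr).
Proof. by []. Qed.
Lemma upD (x y : J -> nat) : up (addv x y) = addv (up x) (up y).
Proof. exact: (an_add aup). Qed.

Lemma flatp_up k b D : flatp (pfl k) (aup2 b) D ->
  flatp (pflJ k) b [set w | D (asum aup2 aup2 w)].
Proof.
move=> h l hl; have hl' : allp (fun x => D (pr x.1.1 x.1.2)) [seq (aup2 x.1.1, aup2 x.1.2, x.2) | x <- l].
  elim: l hl => //= x l IH [Dx /IH hl]; split=> //; congr D: Dx.
have := h _ hl'; congr pfl; apply/funext => n; rewrite plines_up.
  by rewrite !up_inl -upD.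
by rewrite !up_inr -upD.
Qed.

Lemma flatp_img k b D : flatp (pflJ k) b D ->
  flatp (pfl k) (aup2 b) [set asum aup2 aup2 w | w in D].
Proof.
move=> h l hl.
have [l' [hl' el]] : exists l', allp (fun x => D (pr x.1.1 x.1.2)) l' /\
    l = [seq (aup2 x.1.1, aup2 x.1.2, x.2) | x <- l'].
  elim: l hl => [|[[u q] c] l IH] /=; first by exists [::].
  move=> [[w Dw e] /IH[l' [h1 h2]]]; exists ((w \o inl, w \o inr, c) :: l').
  split; first by split=> //=; rewrite pr_eta.
  by rewrite h2 /=; congr (_ :: _); move/pr_inj: e => [<- <-].
have := h _ hl'; rewrite /pflJ el; congr pfl; apply/funext => n; rewrite plines_up.
  by rewrite !up_inl -upD.
by rewrite !up_inr -upD.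
Qed.
End Iota.
End Levels.

Section Levels.
Variables (d : nat) (V : pvass d).
Local Notation E := (edge V).
Local Notation vec := ('I_d -> nat).
Local Notation J m := {i : 'I_d | (m <= i)%N}.
Local Notation pflV := (@pfl d V).

Definition adiag (m : nat) : amap (J m) ('I_d + 'I_d).
Proof.
refine (@AMap (J m) ('I_d + 'I_d) (fun u => pr (up u) (up u))
  (fun u => pr (aq (aup d m) u) (aq (aup d m) u)) _ _ _).
- by move=> x y; rewrite addv_pr -upD.
- move=> a b u v; apply/funext => -[i|i] /=.
    by rewrite -[RHS]/(lcomb a b (aq (aup d m) u) (aq (aup d m) v) i) -aq_lin.
  by rewrite -[RHS]/(lcomb a b (aq (aup d m) u) (aq (aup d m) v) i) -aq_lin.
- by move=> x; rewrite aq_nat; apply/funext => -[].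
Defined.
Arguments adiag : simpl never.

Lemma adiagE m u : adiag m u = pr (up u) (up u).
Proof. by []. Qed.

(** Presents single edges, with [c] the pair of tokens consumed and added, and for [m = 0] and
    [c = 0] the identity. *)
Definition fshift (m : nat) (c : 'I_d + 'I_d -> nat) : fam ('I_d + 'I_d) :=
  fimg (adiag m) c (@ffull (J m)).

Lemma supp_shift m x y s t : supp (fshift m (pr x y)) (pr s t) <->
  exists a, [/\ zin m a, s = addv x a & t = addv y a].
Proof.
rewrite supp_img supp_full; split.
  move=> [u _]; rewrite adiagE addv_pr => /pr_inj[<- <-].
  by exists (up u); split=> //; exact: up_zin.
by move=> [_ [/up_sur[u ->] -> ->]]; exists u => //; rewrite adiagE addv_pr.
Qed.

Lemma mono2z_shift m c : mono2z m (dbl (fshift m c)).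
Proof.
move=> s t z z' _ _ /up_sur[u ->] /up_sur[v ->]; rewrite dbl_img dbl_full.
have e w : addv (pr c zv) (asum (adiag m) (adiag m) w) =
    pr (addv c (adiag m (w \o inl))) (adiag m (w \o inr)) by apply/funext => -[].
move=> [w _]; rewrite e => /pr_inj[e1 e2].
exists (pr (addv (w \o inl) u) (addv (w \o inr) v)) => //; rewrite e.
rewrite -[_ \o inl]/(addv (w \o inl) u) -[_ \o inr]/(addv (w \o inr) v).
by rewrite !an_add !adiagE addvA -!adiagE e1 e2 !adiagE !addv_pr.
Qed.

Lemma good3_shift m k x y (ws : seq (seq E)) : all (low k) ws ->
  (forall a, zin m a -> vflat ws (addv x a) (addv y a)) ->
  good3 (flatp (pflV k)) (fshift m (pr x y)).
Proof.
move=> hws hv; have h := @good3_full (J m) (fun _ _ => True) (fun _ => Logic.I).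
apply: good3_weak (good3_img (adiag m) (pr x y) h) => b D [b' [D' [-> _ ->]]] l hl.
exists ws => // n.
have [u eu] : exists u, plines l n = adiag m u.
  elim: l hl => [|[[a q] c] l IH] /=; first by exists zv; exact: esym (an0 (adiag m)).
  move=> [[w _ /pr_inj[<- <-]] /IH[u eu]].
  exists (addv (addv (w \o inl) (scv (c n) (w \o inr))) u).
  transitivity (addv (addv (adiag m (w \o inl)) (scv (c n) (adiag m (w \o inr)))) (plines l n)).
    by [].
  by rewrite eu -an_scv -!an_add.
have zz : zin m (addv (up b') (up u)) by rewrite -upD; exact: up_zin.
by have := hv _ zz; rewrite eu adiagE addv_pr !addvA.
Qed.

Definition fm (e : E) : vec := fun i =>
  if effect e 0 i is Negz n then n.+1 else 0%N.
Definition fp (e : E) : vec := fun i =>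
  if effect e 0 i is Posz n then n else 0%N.

Lemma fpm e i : effect e 0 i = (fp e i)%:Z - (fm e i)%:Z.
Proof. by rewrite /fp /fm; case: (effect e 0 i) => n; rewrite ?NegzE ?subr0 ?sub0r. Qed.

Lemma fpm0 e i : fp e i = 0%N \/ fm e i = 0%N.
Proof. by rewrite /fp /fm; case: (effect e 0 i); [right|left]. Qed.

Lemma vstepP (e : E) x y : vstep e x y <-> zin (priority e) (fm e) /\
  exists a, [/\ zin (priority e) a, x = addv (fm e) a & y = addv (fp e) a].
Proof.
split.
  move=> [z0 h].
  have le i : (fm e i <= x i)%N.
    by have := h i; rewrite fpm; have := fpm0 e i; move: (fp e i) (fm e i) (x i) (y i) => p m u v; lia.
  split; first by move=> j /z0 xj; have := le j; rewrite xj leqn0 => /eqP.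
  exists (fun i => (x i - fm e i)%N); split.
  - by move=> j /z0 ->.
  - by apply/funext => i; rewrite /addv subnKC.
  - apply/funext => i; have := h i; rewrite fpm /addv; have := le i.
    by move: (fp e i) (fm e i) (x i) (y i) => p m u v; lia.
move=> [zm [a [za -> ->]]]; split=> [j jp|j]; first by rewrite /addv zm // za.
by rewrite fpm /addv !PoszD; ring.
Qed.

(** An edge that consumes from a coordinate it tests for zero can never be taken, so its family is
    empty. *)
Definition fedge (e : E) : fam ('I_d + 'I_d) := fun b P =>
  zin (priority e) (fm e) /\ fshift (priority e) (pr (fm e) (fp e)) b P.

Lemma supp_edge e x y : supp (fedge e) (pr x y) <-> vstep e x y.
Proof.
rewrite vstepP -supp_shift; split; first by move=> [P [? ?]]; split=> //; exists P.
by move=> [? [P ?]]; exists P.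
Qed.

Lemma good3_edge e : good3 (flatp (pflV (priority e).+1)) (fedge e).
Proof.
case: (pselect (zin (priority e) (fm e))) => hz; last first.
  have -> : fedge e = @fempty _; last exact: good3_empty.
  by apply/funext => b; apply/funext => P; apply/propext; split=> // -[].
have -> : fedge e = fshift (priority e) (pr (fm e) (fp e)).
  by apply/funext => b; apply/funext => P; apply/propext; split=> // -[].
apply: (@good3_shift _ _ _ _ [:: [:: e]]); first by rewrite /= /low /= ltnSn.
move=> a za; exists (addv (fp e) a) => //; apply: vstar1 => /=.
by exists (addv (fp e) a) => //; apply/vstepP; split=> //; exists a.
Qed.

Lemma mono2z_edge e : mono2z (priority e) (dbl (fedge e)).
Proof.
move=> s t z z' a a' za za' [P [hz hP] hP'].
have [P1 h1 h2] : dbl (fshift (priority e) (pr (fm e) (fp e)))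
  (pr (pr (addv s a) (addv t a)) (pr (addv z a') (addv z' a'))).
  by apply: mono2z_shift => //; exists P.
by exists P1.
Qed.

Section OneLevel.
Variables (m : nat) (F : fam ('I_d + 'I_d)).
Hypothesis gF : good3 (flatp (pflV m)) F.
Hypothesis sF : forall x y, supp F (pr x y) <-> @Rlow d V m x y.
Hypothesis mF : mono2z m (dbl F).

Definition ftest : fam ('I_d + 'I_d) := fun b P =>
  exists2 e : E, nat_of_ord (priority e) == m & fedge e b P.

Lemma good3_test : good3 (flatp (pflV m.+1)) ftest.
Proof.
apply: good3_bigunion => e /eqP em; rewrite -em; exact: good3_edge.
Qed.

Lemma supp_test x y : supp ftest (pr x y) <->
  exists2 e : E, nat_of_ord (priority e) = m & vstep e x y.
Proof.
split.
  by move=> [P [e /eqP em hP]]; exists e => //; apply/supp_edge; exists P.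
by move=> [e em /supp_edge[P hP]]; exists P, e; rewrite ?em.
Qed.

Lemma mono2z_test : mono2z m (dbl ftest).
Proof.
move=> s t z z' a a' za za' [P [e em hP] hP'].
rewrite -(eqP em) in za za'.
have [P1 h1 h2] : dbl (fedge e) (pr (pr (addv s a) (addv t a)) (pr (addv z a') (addv z' a'))).
  by apply: mono2z_edge => //; exists P.
by exists P1 => //; exists e.
Qed.

Lemma gF' : good3 (flatp (pflV m.+1)) F.
Proof.
apply: good3_weak gF => b D h l /h; exact: pfl_le.
Qed.

Definition fbase : fam ('I_d + 'I_d) := fcomp ftest F.

Definition floop : fam (J m + J m) := fpre (aup2 d m) zv fbase.

Lemma good3_base : good3 (flatp (pflV m.+1)) fbase.
Proof. apply: good3_comp; [exact: pfl_comp|exact: good3_test|exact: gF']. Qed.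

Local Notation pflJm := (@pflJ d V m m.+1).

Lemma good3_loop : good3 (flatp pflJm) floop.
Proof.
apply: good3_weak (good3_pre (aup2 d m) zv good3_base) => b D [D' h ->].
exact: flatp_up.
Qed.

Lemma supp_loop x y : supp floop (pr x y) <->
  exists2 e : E, nat_of_ord (priority e) = m &
    exists2 z, vstep e (up x) z & @Rlow d V m z (up y).
Proof.
have -> : supp floop (pr x y) = supp fbase (pr (up x) (up y)) by rewrite supp_pre -aup2E.
rewrite supp_comp; split.
  by move=> [z /supp_test[e em h1] /sF h2]; exists e => //; exists z.
move=> [e em [z h1 h2]]; apply: (@comp_pr _ _ _ _ z); last exact/sF.
by apply/supp_test; exists e.
Qed.

Lemma mono2_loop : mono2 (dbl floop).
Proof.
move=> s t z z' a a'; rewrite dbl_pre /= => h.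
have e (s1 t1 z1 z1' : J m -> nat) :
    addv (pr zv zv) (asum (aup2 d m) (aup2 d m) (pr (pr s1 t1) (pr z1 z1'))) =
    pr (pr (up s1) (up t1)) (pr (up z1) (up z1')).
  by rewrite pr0 add0v; apply/funext => -[[]|[]].
rewrite e in h; rewrite e !upD; move: h; rewrite dbl_comp.
apply: (mono2z_comp mono2z_test mF); exact: up_zin.
Qed.

Lemma loop_run x y : reachX (supp floop) x y -> @Rlow d V m.+1 (up x) (up y).
Proof.
elim=> [u|u v w /supp_loop[e em [z h1 [l hl hv]]] _ [l' hl' hv']]; first by exists [::].
exists ((e :: l) ++ l').
  by rewrite low_cat hl' andbT /low /= em ltnSn; exact: low_le hl.
by apply: vrun_cat hv'; exists z.
Qed.

Lemma flat_loopJ : flat_loop pflJm (reachX (supp floop)).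
Proof.
move=> s z z' k /loop_run[w hw hv]; exists [:: w]; first by rewrite /= hw.
move=> n; exists (up (addv s (scv (k n) z'))) => //.
rewrite !upD in hv *.
have sc (x : J m -> nat) : up (scv (k n) x) = scv (k n) (up x) by exact: (an_scv (aup d m)).
by rewrite !sc; apply: (vrun_pump (m := m)) hv => //; exact: up_zin.
Qed.

Lemma flat_compJ : flat_comp pflJm.
Proof. move=> a b c; exact: pfl_comp. Qed.

Lemma flat_shiftJ : flat_shift pflJm.
Proof.
move=> a b c [ws h1 h2]; exists ws => // n; rewrite !upD.
by apply: (vflat_shift (m := m)) => //; exact: up_zin.
Qed.

Lemma good3_loopstar : good3 (flatp pflJm) (fstar floop).
Proof.
apply: good3_star; [exact: flat_compJ|exact: flat_shiftJ|exact: flat_loopJ|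
  exact: good3_loop|exact: mono2_loop].
Qed.

Definition fupstar : fam ('I_d + 'I_d) := fimg (aup2 d m) zv (fstar floop).

Lemma good3_upstar : good3 (flatp (pflV m.+1)) fupstar.
Proof.
apply: good3_weak (good3_img (aup2 d m) zv good3_loopstar) => b D [b' [D' [-> h ->]]].
exact: flatp_img.
Qed.

Lemma supp_upstar x y : supp fupstar (pr x y) <->
  exists x' y', [/\ x = up x', y = up y' & reachX (supp floop) x' y'].
Proof.
rewrite supp_img supp_star; split.
  move=> [w h]; rewrite add0v -(pr_eta w) aup2E => /pr_inj[<- <-].
  by exists (w \o inl), (w \o inr).
by move=> [x' [y' [-> -> h]]]; exists (pr x' y') => //; rewrite add0v aup2E.
Qed.

Lemma mono2z_upstar : mono2z m (dbl fupstar).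
Proof.
move=> s t z z' _ _ /up_sur[u ->] /up_sur[v ->]; rewrite dbl_img.
have e (w : (J m + J m) + (J m + J m) -> nat) :
    addv (pr zv zv) (asum (aup2 d m) (aup2 d m) w) =
    pr (pr (up (w \o (inl \o inl))) (up (w \o (inl \o inr))))
       (pr (up (w \o (inr \o inl))) (up (w \o (inr \o inr)))).
  by rewrite pr0 add0v; apply/funext => -[[]|[]].
move=> [w hw]; rewrite e => /pr_inj[/pr_inj[<- <-] /pr_inj[<- <-]].
exists (pr (pr (addv (w \o (inl \o inl)) u) (addv (w \o (inl \o inr)) u))
  (pr (addv (w \o (inr \o inl)) v) (addv (w \o (inr \o inr)) v))).
  have := mono2_star good3_loop.1 mono2_loop; apply.
  by congr (dbl (fstar floop)): hw; apply/funext => -[[]|[]].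
by rewrite e -!upD.
Qed.

(** Cut a run at its edges of priority [m], each of which starts where the first [m] coordinates
    vanish: lower priorities lead to the first such configuration, loops join it to the last one,
    and a final test is followed by lower priorities to an unrestricted end. *)
Definition fnext : fam ('I_d + 'I_d) :=
  funion F (fcomp F (fcomp fupstar fbase)).

Lemma good3_next : good3 (flatp (pflV m.+1)) fnext.
Proof.
apply: good3_union; first exact: gF'.
apply: good3_comp; [exact: pfl_comp|exact: gF'|].
by apply: good3_comp; [exact: pfl_comp|exact: good3_upstar|exact: good3_base].
Qed.

Lemma mono2z_next : mono2z m.+1 (dbl fnext).
Proof.
suff h : mono2z m (dbl fnext).
  by move=> s t z z' a a' za za'; apply: h; exact: zin_le (leqnSn m) _.
move=> s t z z' a a' za za'; rewrite dbl_union !dbl_comp => -[h|h].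
  by left; exact: mF.
right; move: h; apply: (mono2z_comp mF (mono2z_comp mono2z_upstar (mono2z_comp mono2z_test mF))) => //.
Qed.

Lemma Rlow_cat k x y z : @Rlow d V k x y -> @Rlow d V k y z -> @Rlow d V k x z.
Proof.
move=> [w h1 h2] [w' h1' h2']; exists (w ++ w'); first by rewrite low_cat h1.
exact: vrun_cat h2 h2'.
Qed.

Lemma supp_next x y : supp fnext (pr x y) <-> @Rlow d V m.+1 x y.
Proof.
have up1 u v : @Rlow d V m u v -> @Rlow d V m.+1 u v.
  by move=> [w h1 h2]; exists w => //; exact: low_le h1.
have R0 k u : @Rlow d V k u u by exists [::].
have base1 u v : supp fbase (pr u v) <-> exists2 e : E, nat_of_ord (priority e) = m &
    exists2 z, vstep e u z & @Rlow d V m z v.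
  rewrite supp_comp; split.
    by move=> [z /supp_test[e em h1] /sF h2]; exists e => //; exists z.
  move=> [e em [z h1 h2]]; apply: (@comp_pr _ _ _ _ z); last exact/sF.
  by apply/supp_test; exists e.
split.
  rewrite supp_union supp_comp => -[/sF|]; first exact: up1.
  move=> [u /sF/up1 h1]; rewrite supp_comp.
  move=> [v /supp_upstar[x' [y' [e1 e2 /loop_run h2]]] /base1[e em [z h3 /up1 h4]]].
  apply: (Rlow_cat h1); rewrite -e1 -e2 in h2; apply: (Rlow_cat h2); apply: Rlow_cat h4.
  by exists [:: e]; [rewrite /low /= em ltnSn|exists z].
move=> [w]; elim: w x => [|e w IH] x /=.
  by move=> _ ->; rewrite supp_union; left; apply/sF.
move=> /andP[he hw] [z hz /(IH _ hw)]; move: he; rewrite ltnS leq_eqVlt => /orP[/eqP em|em].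
  have [x' ex] : exists x', x = up (m := m) x'.
    by apply: up_sur => j jm; have [h _] := hz; apply: h; rewrite em.
  rewrite supp_union => -[/sF h|].
    right; rewrite supp_comp.
    apply: (@comp_pr _ _ _ _ x); first exact/sF.
    rewrite supp_comp; apply: (@comp_pr _ _ _ _ x).
      by apply/supp_upstar; exists x', x'; split=> //; exact: reach0.
    apply/base1; exists e => //; by exists z.
  rewrite supp_comp => -[u /sF h1]; rewrite supp_comp => -[v /supp_upstar[u' [v' [e1 e2 h2]]] h3].
  right; rewrite supp_comp.
  apply: (@comp_pr _ _ _ _ x); first exact/sF.
  rewrite ?supp_comp; apply: (@comp_pr _ _ _ _ v); last by rewrite -?supp_comp.
  apply/supp_upstar; exists x', v'; split=> //; apply: reachS h2.
  apply/supp_loop; exists e => //; rewrite -ex -e1; by exists z.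
have st : @Rlow d V m x z by exists [:: e]; [rewrite /low /= em|exists z].
rewrite !supp_union => -[/sF h|]; first by left; apply/sF; exact: Rlow_cat st h.
rewrite !supp_comp => -[u /sF h1 h2]; right.
apply: (@comp_pr _ _ _ _ u); last exact: h2.
by apply/sF; exact: Rlow_cat st h1.
Qed.
End OneLevel.

Lemma good_level m : exists F : fam ('I_d + 'I_d),
  [/\ good3 (flatp (pflV m)) F, forall x y, supp F (pr x y) <-> @Rlow d V m x y &
      mono2z m (dbl F)].
Proof.
elim: m => [|m [F [gF sF mF]]]; last first.
  by exists (fnext m F); split; [exact: good3_next|exact: supp_next|exact: mono2z_next].
(* No edge has priority below 0, so the relation at level 0 is the identity. *)
exists (fshift 0 (pr zv zv)); split.
- exact: (@good3_shift 0 0 zv zv [::]).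
- move=> x y; rewrite supp_shift; split.
    by move=> [a [_ -> ->]]; exists [::].
  move=> [[|e w]] //= _ ->; exists y; by split.
- exact: mono2z_shift.
Qed.
End Levels.

(** * Smoothness *)

(* Environments are functions on nat, only the first [n] values of which      *)
(* matter; this avoids casts between row vectors of equal lengths.            *)
Definition fod (n : nat) (S : (nat -> rat) -> Prop) : Prop :=
  exists phi : fo_form n, forall (v : 'rV[rat]_n) (r : nat -> rat),
    (forall i : 'I_n, v 0 i = r i) -> (fo_holds phi v <-> S r).

Definition econs (a : rat) (r : nat -> rat) : nat -> rat :=
  fun k => if k is k'.+1 then r k' else a.

Definition eapp (N : nat) (y r : nat -> rat) : nat -> rat :=
  fun k => if (k < N)%N then y k else r (k - N)%N.

Lemma econs_row n a (v : 'rV[rat]_n) (r : nat -> rat) : (forall i : 'I_n, v 0 i = r i) ->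
  forall i : 'I_n.+1, (row_mx (const_mx a : 'rV_1) v : 'rV_(1 + n)) 0 i = econs a r i.
Proof.
move=> h i; rewrite mxE; case: splitP => j ->; first by rewrite mxE ord1.
by rewrite h.
Qed.

Lemma fod_eq n S S' : (forall r, S r <-> S' r) -> fod n S -> fod n S'.
Proof. by move=> h [phi hphi]; exists phi => v r hv; rewrite (hphi v r hv). Qed.

Lemma fod_not n S : fod n S -> fod n (fun r => ~ S r).
Proof. by move=> [phi hphi]; exists (FoNot phi) => v r hv /=; rewrite (hphi v r hv). Qed.

Lemma fod_and n S S' : fod n S -> fod n S' -> fod n (fun r => S r /\ S' r).
Proof.
move=> [phi hphi] [psi hpsi]; exists (FoAnd phi psi) => v r hv /=.
by rewrite (hphi v r hv) (hpsi v r hv).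
Qed.

Lemma fod_ex n S : fod n.+1 S -> fod n (fun r => exists a, S (econs a r)).
Proof.
move=> [phi hphi]; exists (FoEx phi) => v r hv /=.
by split=> -[a ha]; exists a; apply/(hphi _ (econs a r) (econs_row a hv)).
Qed.

Lemma fod_exN N n S : fod (N + n) S -> fod n (fun r => exists y, S (eapp N y r)).
Proof.
elim: N S => [|N IH] S hS.
  apply: fod_eq hS => r; have e y : eapp 0 y r = r.
    by apply/funext => k; rewrite /eapp ltn0 subn0.
  by split=> [h|[y]]; rewrite ?e //; exists (fun=> 0); rewrite e.
apply: fod_eq (IH _ (fod_ex hS)) => r; split.
  move=> [y [a h]]; exists (econs a y); congr S: h.
  by apply/funext => -[|k].
move=> [y h]; exists (fun k => y k.+1), (y 0%N); congr S: h.
by apply/funext => -[|k].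
Qed.

(** The signature has no zero, so an empty sum is not a term. The extra variable [a] repairs this
    and cancels between the two sides of an inequality. *)
Lemma fo_term_sum n (p : 'I_n -> nat) : exists t : fo_term n.+1,
  forall (v : 'rV[rat]_n.+1) a r, (forall i : 'I_n.+1, v 0 i = econs a r i) ->
    fo_eval v t = a + \sum_i (p i)%:R * r i.
Proof.
suff : forall l : seq 'I_n, exists t : fo_term n.+1,
  forall (v : 'rV[rat]_n.+1) a r, (forall i : 'I_n.+1, v 0 i = econs a r i) ->
    fo_eval v t = a + \sum_(i <- l) (p i)%:R * r i.
  by move=> /(_ (index_enum 'I_n)).
elim=> [|i l [t ht]].
  by exists (FoVar ord0) => v a r hv /=; rewrite hv big_nil addr0.
have : forall k, exists t : fo_term n.+1,
  forall (v : 'rV[rat]_n.+1) a r, (forall i : 'I_n.+1, v 0 i = econs a r i) ->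
    fo_eval v t = a + (k%:R * r i + \sum_(i <- l) (p i)%:R * r i).
  elim=> [|k [u hu]]; first by exists t => v a r hv; rewrite (ht v a r hv) mul0r add0r.
  exists (FoAdd u (FoVar (lift ord0 i))) => v a r hv /=.
  by rewrite (hu v a r hv) hv lift0 /= -natr1; ring.
move=> /(_ (p i))[u hu]; exists u => v a r hv.
by rewrite (hu v a r hv) big_cons.
Qed.

(** Clearing denominators and moving negative coefficients to the other side leaves natural
    multiples, which are repeated additions. *)
Lemma fod_ge n (c : 'I_n -> rat) : fod n (fun r => 0 <= \sum_i c i * r i).
Proof.
have [N [m [N0 hm]]] := rats_nat (fun i => normr_ge0 (c i)).
pose p i := if 0 <= c i then m i else 0%N.
pose q i := if 0 <= c i then 0%N else m i.
have hc i : N%:R * c i = (p i)%:R - (q i)%:R.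
  rewrite /p /q; case: (lerP 0 (c i)) => h; rewrite -hm.
    by rewrite ger0_norm // subr0.
  by rewrite ltr0_norm // sub0r; ring.
have [t ht] := fo_term_sum p; have [u hu] := fo_term_sum q.
pose S (r' : nat -> rat) : Prop :=
  r' 0%N + \sum_i (q i)%:R * r' (lift ord0 i) <= r' 0%N + \sum_i (p i)%:R * r' (lift ord0 i).
apply: (@fod_eq n (fun r => exists a, S (econs a r))).
  move=> r; have e : N%:R * (\sum_i c i * r i) = \sum_i (p i)%:R * r i - \sum_i (q i)%:R * r i.
    by rewrite mulr_sumr -sumrB; apply: eq_bigr => i _; rewrite mulrA hc mulrBl.
  have -> : (0 <= \sum_i c i * r i) = (\sum_i (q i)%:R * r i <= \sum_i (p i)%:R * r i).
    by rewrite -[RHS]subr_ge0 -e pmulr_rge0 // ltr0n.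
  by rewrite /S; split=> [[a]|h]; [rewrite /= lerD2l|exists 0; rewrite /= lerD2l].
apply: (@fod_ex n S); exists (FoGe t u) => v r hv /=.
have hv' i : v 0 i = econs (r 0%N) (fun k => r k.+1) i by rewrite hv; case: i => -[|k].
by rewrite (ht v _ _ hv') (hu v _ _ hv').
Qed.

Lemma fod_gt n (c : 'I_n -> rat) : fod n (fun r => 0 < \sum_i c i * r i).
Proof.
apply: fod_eq (fod_not (fod_ge (fun i => - c i))) => r.
under eq_bigr do rewrite mulNr.
by rewrite sumrN oppr_ge0 ltNge; split => /negP.
Qed.

Lemma fod_true n : fod n (fun=> True).
Proof.
apply: fod_eq (fod_ge (fun _ : 'I_n => 0)) => r; split=> // _.
by rewrite big1 // => i _; rewrite mul0r.
Qed.

Lemma fod_bigand n (T : finType) (S : T -> (nat -> rat) -> Prop) :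
  (forall t, fod n (S t)) -> fod n (fun r => forall t, S t r).
Proof.
move=> h.
have : fod n (fun r => forall t, t \in enum T -> S t r).
  elim: (enum T) => [|t l IH]; first by apply: fod_eq (fod_true n).
  apply: fod_eq (fod_and (h t) IH) => r; split.
    by move=> [h1 h2] u; rewrite inE => /orP[/eqP->//|/h2].
  by move=> h1; split=> [|u ul]; apply: h1; rewrite inE ?eqxx ?ul ?orbT.
by apply: fod_eq => r; split=> [h1 t|h1 t _] //; apply: h1; rewrite mem_enum.
Qed.

Lemma fod_bigor n (T : finType) (S : T -> (nat -> rat) -> Prop) :
  (forall t, fod n (S t)) -> fod n (fun r => exists t, S t r).
Proof.
move=> h; apply: fod_eq (fod_not (fod_bigand (fun t => fod_not (h t)))) => r.
split=> [h1|[t ht] h1]; last exact: h1 ht.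
by apply: contrapT => h2; apply: h1 => t ht; apply: h2; exists t.
Qed.

Lemma islin_coef (I : finType) (f : (I -> rat) -> rat) w : islin f ->
  f w = \sum_k f (fun i => (i == k)%:R) * w k.
Proof.
move=> lf.
have h : forall l : seq I, f (fun i => \sum_(k <- l) w k * (i == k)%:R) =
    \sum_(k <- l) f (fun i => (i == k)%:R) * w k.
  elim=> [|k l IH].
    by under eq_fun do rewrite big_nil; rewrite big_nil; exact: islin0.
  rewrite big_cons -IH; have := lf (w k) 1 (fun i => (i == k)%:R) (fun i => \sum_(k <- l) w k * (i == k)%:R).
  rewrite mul1r mulrC => <-; congr f; apply/funext => i.
  by rewrite /lcomb big_cons mul1r.
rewrite -(h (index_enum I)); congr f; apply/funext => i.
rewrite (bigD1 i) //= eqxx mulr1 big1 ?addr0 // => k; rewrite eq_sym => /negPf->.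
by rewrite mulr0.
Qed.

Lemma basic_fod n (C : set ('I_n -> rat)) : basic true C ->
  fod n (fun r => C (fun i => r i)).
Proof.
move=> [Y [F [s [f [lf _ hC]]]]].
pose N := #|Y|.
(* Quantifiers bind variable 0, so the auxiliary variables come before the free ones. *)
pose env (r : nat -> rat) (k : 'I_n + Y) : rat :=
  match k with inl i => r (N + i)%N | inr y => r (enum_rank y) end.
have main : fod (N + n) (fun r => forall k, sgnok (s k) (f k (env r))).
  apply: fod_bigand => k.
  pose c (j : 'I_(N + n)) : rat := match split j with
    | inl j' => f k (fun x => (x == inr (enum_val j'))%:R)
    | inr i => f k (fun x => (x == inl i)%:R) end.
  have e r : f k (env r) = \sum_j c j * r j.
    rewrite (islin_coef _ (lf k)) big_sumType /= big_split_ord /= addrC; congr (_ + _).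
      rewrite (reindex_onto (@enum_val _ Y) enum_rank) /=; last by move=> y _; exact: enum_rankK.
      apply: eq_big => [j|j _]; first by rewrite enum_valK eqxx.
      rewrite enum_valK /c; have -> : split (lshift n j) = inl j by exact: (unsplitK (inl j)).
      by [].
    apply: eq_bigr => i _; rewrite /c.
    by have -> : split (rshift N i) = inr i by exact: (unsplitK (inr i)).
  rewrite /sgnok; case: (s k).
    by apply: fod_eq (fod_gt c) => r; rewrite e.
  by apply: fod_eq (fod_ge c) => r; rewrite e.
apply: fod_eq (fod_exN main) => r; rewrite hC.
have e y : env (eapp N y r) = pr (fun i : 'I_n => r i) (fun x => y (enum_rank x)).
  apply/funext => -[i|x] /=; rewrite /eapp; first by rewrite ltnNge leq_addr addKn.
  by rewrite ltn_ord.
split=> -[y hy].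
  by exists (fun x => y (enum_rank x)) => k; rewrite -e.
exists (fun k => if insub k is Some j then y (enum_val (j : 'I_N)) else 0) => k.
rewrite e; have -> // : (fun x => (if insub (nat_of_ord (enum_rank x)) is Some j
  then y (enum_val (j : 'I_N)) else 0)) = y.
by apply/funext => x; rewrite valK enum_rankK.
Qed.

Lemma edef_fo n (C : set ('I_n -> rat)) : edef C ->
  fo_definable [set v : 'rV[rat]_n | C (v 0)].
Proof.
move=> [T [B [hB hC]]].
have [phi hphi] := fod_bigor (fun t => basic_fod (hB t)).
exists phi; apply/funext => v; apply/propext.
pose r k := if insub k is Some j then v 0 (j : 'I_n) else 0.
have hr (i : 'I_n) : v 0 i = r i by rewrite /r valK.
have er : (fun i : 'I_n => r i) = v 0 by apply/funext => i.
by rewrite /= (hphi v r hr) hC er.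
Qed.

Lemma good_cover (I : finType) (F : fam I) : good F ->
  exists k (b : 'I_k -> I -> nat) (P : 'I_k -> set (I -> nat)),
    (forall j, F (b j) (P j)) /\
    forall w, supp F w <-> exists j, exists2 p, P j p & w = addv (b j) p.
Proof.
move=> [G1 G2 G3 G4]; have [k [g [gF gc]]] := af_cover G3.
exists k, (fun j => (g j).1), (fun j => (g j).2); split=> // w; split.
  by move=> [P hP]; have [j [p Pp e]] := gc (w, P) hP; exists j, p.
by move=> [j [p Pp ->]]; exact: G2 (gF j) Pp.
Qed.

Definition dirf (I : Type) (P : set (I -> nat)) : set (I -> rat) :=
  [set v | exists (m : nat) (x : I -> rat), (0 < m)%N /\
     forall k : nat, exists2 p, P p & forall i, (p i)%:R = x i + m%:R * v i * k%:R].

Lemma dbl_line (I : finType) (H : fam I) u q : good H -> dbl H (pr u q) ->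
  forall k, supp H (addv u (scv k q)).
Proof.
move=> [G1 G2 _ _] [P hP Pq] k; apply: (G2 _ _ _ hP).
by apply: periodic_scv => //; exact: G1 hP.
Qed.

(** With a piece based at each point of the sequence, almost-fullness finds a point from which a
    period leads to a later one. *)
Lemma line_dbl (I : finType) (H : fam I) (a : nat -> I -> nat) : good H ->
  (forall k, supp H (a k)) ->
  exists k l, (k < l)%N /\ exists2 q, dbl H (pr (a k) q) & a l = addv (a k) q.
Proof.
move=> [_ _ G3 _] /choice[P hP].
have [k [l [kl [q Pq e]]]] := G3 (fun k => (a k, P k)) hP.
by exists k, l; split=> //; exists q; [exists (P k); [exact: hP|exact: Pq]|exact: e].
Qed.

(* A line in [P] contains two elements [a] and [a + q] with [(a, q)] in the   *)
(* doubled relation, hence [q] generates its direction. Conversely a          *)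
(* direction [beta + p] of a piece [(alpha, beta) + (p', p)] of the doubled   *)
(* relation is that of the line through [alpha + p'].                         *)
Lemma edef_dirf (I : finType) (H : fam I) : good2 H -> periodicv (supp H) ->
  edef (dirf (supp H)).
Proof.
move=> [gH [G gG eG]] pH; have [k [b [P [hb hc]]]] := good_cover gG.
have [G1 _ _ G4] := gG.
pose C j := [set v : I -> rat | exists z : unit + (I + I) -> rat,
   [/\ 0 < z (inl tt), coneP (P j) (z \o inr) &
       forall i, v i - (z (inl tt) * toq (b j \o inr) i + z (inr (inr i))) = 0]].
apply: (edef_eq _ (@edef_bigU _ _ C _)); last first.
  move=> j; pose D := [set z : I + (unit + (I + I)) -> rat |
   0 < z (inr (inl tt)) /\ (coneP (P j) (z \o (inr \o inr)) /\
       forall i, z (inl i) - (z (inr (inl tt)) * toq (b j \o inr) i + z (inr (inr (inr i)))) = 0)].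
  apply: (edef_eq _ (@edef_ex I _ D _)).
    by move=> v; split=> -[z]; [move=> [h1 [h2 h3]]|move=> [h1 h2 h3]]; exists z; split.
  apply: edefI; first exact: (basic_edef (basic_gt (islin_coord (inr (inl tt))))).
  apply: edefI.
    apply: (edef_pre (g := fun z : I + (unit + (I + I)) -> rat => z \o (inr \o inr))) => //.
    exact: G4 (hb j).
  apply: edef_bigI => i; apply: (@basic_edef true).
  apply: (@basic_zero _ _ (fun z : I + (unit + (I + I)) -> rat =>
    z (inl i) - (z (inr (inl tt)) * toq (b j \o inr) i + z (inr (inr (inr i)))))).
  by move=> a c u v; rewrite /lcomb; ring.
move=> v; split.
  move=> [j [z [z0 [N [p [N0 Pp ep]]] ev]]].
  have [M [a [M0 ea]]] := rat_nat (ltW z0).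
  have a0 : (0 < a)%N by rewrite -(ltr0n rat) -ea mulr_gt0 // ltr0n.
  pose al := b j \o inl; pose be := b j \o inr.
  have d1 : dbl H (pr al be) by rewrite pr_eta -eG; exists (P j).
  pose p' := scv M p.
  have d2 : dbl H (pr (addv al (p' \o inl)) (addv be (p' \o inr))).
    rewrite -addv_pr !pr_eta -eG hc; exists j, p' => //.
    by apply: periodic_scv => //; exact: G1 (hb j).
  (* The line in [supp H] adds [A] copies of the one through [al] along [be] and one copy of the
     line that [d2] provides. With [A.+1 = N * a], its direction is [N * a] times [be] plus the
     period half of [p'], that is [N * M] times [v]. *)
  pose A := (N * a).-1.
  have eA : (N * a = A.+1)%N by rewrite /A prednK // muln_gt0 N0.
  exists (N * M)%N, (toq (addv (scv A al) (addv al (p' \o inl)))); split; first by rewrite muln_gt0 N0.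
  move=> n; exists (addv (scv A (addv al (scv n be))) (addv (addv al (p' \o inl)) (scv n (addv be (p' \o inr))))).
    by apply: pH.2; [apply: periodic_scv => //; exact: dbl_line|exact: dbl_line].
  move=> i; have := ev i; have := ep (inr i); rewrite /= => e1 e2.
  have -> : v i = z (inl tt) * toq be i + z (inr (inr i)) by rewrite /be; lra.
  have eN : (N%:R * M%:R * (z (inl tt) * toq be i + z (inr (inr i)))) =
      A.+1%:R * toq be i + (p' (inr i))%:R :> rat.
    rewrite -eA /p' /scv !natrM -ea -e1; ring.
  rewrite natrM eN /toq /addv /scv /= !natrD !natrM !natrD !natrM -natr1; ring.
move=> [m [x [m0 hx]]].
have /choice[a ha] : forall n : nat, exists p, supp H p /\ forall i, (p i)%:R = x i + m%:R * v i * n%:R.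
  by move=> n; have [p] := hx n; exists p.
have [n [l [nl [q dq eq]]]] := line_dbl gH (fun n => (ha n).1).
move: dq; rewrite -eG => /hc[j [p Pp e]].
pose N := ((l - n) * m)%N; have N0 : (0 < N)%N by rewrite muln_gt0 subn_gt0 nl.
have nz : (N%:R : rat) != 0 by rewrite pnatr_eq0 -lt0n.
have eN i : N%:R * v i = (q i)%:R.
  have := (ha l).2 i; rewrite eq /addv natrD (ha n).2 /N natrM natrB; last exact: ltnW.
  move=> h; have -> : (q i)%:R = (x i + m%:R * v i * l%:R) - (x i + m%:R * v i * n%:R).
    by rewrite -h; ring.
  ring.
have eq' i : q i = (b j (inr i) + p (inr i))%N by have /(congr1 (@^~ (inr i))) := e.
exists j; exists (fun t => match t with inl _ => N%:R^-1 | inr t' => N%:R^-1 * (p t')%:R end); split.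
- by rewrite invr_gt0 ltr0n.
- by exists N, p; split=> // t; rewrite /= mulrA divff ?mul1r.
- move=> i; apply: (mulfI nz); rewrite mulr0 mulrBr eN eq' natrD mulrDr !mulrA divff // !mul1r /toq /=; ring.
Qed.

Lemma dirf0 (I : Type) (P : set (I -> nat)) : periodicv P -> dirf P (fun=> 0).
Proof.
by move=> [P0 _]; exists 1%N, (fun=> 0); split=> // k; exists zv => // i; rewrite mulr0 mul0r addr0.
Qed.

Lemma dirfD (I : Type) (P : set (I -> nat)) u v : periodicv P ->
  dirf P u -> dirf P v -> dirf P (fun i => u i + v i).
Proof.
move=> [_ PD] [m [x [m0 hx]]] [n [y [n0 hy]]].
exists (m * n)%N, (fun i => x i + y i); split; first by rewrite muln_gt0 m0.
move=> k; have [p Pp ep] := hx (n * k)%N; have [q Pq eq] := hy (m * k)%N.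
exists (addv p q); first exact: PD.
by move=> i; rewrite /addv natrD ep eq !natrM; ring.
Qed.

Lemma dirf_scale (I : Type) (P : set (I -> nat)) a v : 0 < a ->
  dirf P v -> dirf P (fun i => a * v i).
Proof.
move=> a0 [m [x [m0 hx]]]; have [N [n [N0 en]]] := rat_nat (ltW a0).
exists (m * N)%N, x; split; first by rewrite muln_gt0 m0.
move=> k; have [p Pp ep] := hx (n * k)%N; exists p => // i.
by rewrite ep !natrM -en; ring.
Qed.

Definition setV (n : nat) (P : set ('I_n -> nat)) : set 'rV[nat]_n := [set x | P (x 0)].

Definition rv (T : Type) (n : nat) (w : 'I_n -> T) : 'rV[T]_n := \row_i w i.

Lemma rvK (T : Type) n (w : 'I_n -> T) : rv w 0 = w.
Proof. by apply/funext => i; rewrite mxE. Qed.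

Lemma fvK (T : Type) n (x : 'rV[T]_n) : rv (x 0) = x.
Proof. by apply/rowP => i; rewrite mxE. Qed.

Lemma fvD n (x y : 'rV[nat]_n) : (x + y) 0 = addv (x 0) (y 0).
Proof. by apply/funext => i; rewrite mxE. Qed.

Lemma nat_mulrn (x n : nat) : x *+ n = (x * n)%N.
Proof. by elim: n => [|n IH]; rewrite ?mulr0n ?muln0 // mulrS IH mulnS. Qed.

Lemma dir_dirf n (P : set ('I_n -> nat)) : dir (setV P) = [set v | dirf P (v 0)].
Proof.
apply/funext => v; apply/propext; split.
  move=> [m [x [m0 hx]]]; exists m, (x 0); split=> // k.
  have [p Pp ep] := hx k; exists (p 0) => // i.
  by have /rowP/(_ i) := ep; rewrite !mxE mulmxnE !mxE mulr_natr.
move=> [m [x [m0 hx]]]; exists m, (rv x); split=> // k.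
have [p Pp ep] := hx k; exists (rv p); first by rewrite /setV /= rvK.
by apply/rowP => i; rewrite !mxE mulmxnE !mxE ep mulr_natr.
Qed.

Lemma setV_smooth n (H : fam 'I_n) : good2 H -> periodicv (supp H) ->
  smooth (setV (supp H)).
Proof.
move=> gH pH; have [P0 PD] := pH; split.
- split; first by rewrite /setV /=; congr (supp H): P0; apply/funext => i; rewrite mxE.
  by move=> x y hx hy; rewrite /setV /= fvD; exact: PD.
- rewrite dir_dirf; split.
  + by congr (dirf _): (dirf0 pH); apply/funext => i; rewrite mxE.
  + move=> u v hu hv; congr (dirf _): (dirfD pH hu hv).
    by apply/funext => i; rewrite mxE.
  + move=> a v a0 hv; congr (dirf _): (dirf_scale a0 hv).
    by apply/funext => i; rewrite mxE.
- by rewrite dir_dirf; apply: edef_fo; exact: edef_dirf.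
- move=> p /choice[Q hQ]; have [[G1 G2 G3 _] _] := gH.
  (* In a perfect subsequence for [fle], later terms differ from an earlier one by a period at the
     earlier term, and multiples of that period stay in the relation. *)
  have [h [hi hh]] := af_perfect (f := fun m => (p m 0, Q m)) G3 hQ.
  exists h; split=> // j k jk l.
  have [q [Qq eq]] : exists q, Q (h j) q /\ p (h k) 0 = addv (p (h j) 0) q.
    move: jk; rewrite leq_eqVlt => /orP[/eqP <-|/hh[q Qq eq]]; last by exists q.
    by exists zv; rewrite addv0; split=> //; exact: (G1 _ _ (hQ _)).1.
  exists (rv (addv (p (h j) 0) (scv l q))).
    rewrite /setV /= rvK; apply: (G2 _ _ _ (hQ (h j))).
    by apply: periodic_scv => //; exact: (G1 _ _ (hQ _)).
  apply/rowP => i; rewrite !mxE mulmxnE !mxE.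
  have e1 := congr1 (@^~ i) eq; rewrite /addv /= in e1; rewrite e1.
  by rewrite /addv /scv !PoszD PoszM -mulr_natl; ring.
Qed.

(** * Linear subsets and bundles of lines *)

Lemma periodic_sum (I : Type) (T : finType) (P : set (I -> nat)) (u : T -> I -> nat) :
  periodicv P -> (forall t, P (u t)) -> P (fun j => \sum_t u t j)%N.
Proof.
move=> [P0 PD] hu.
have : forall l : seq T, P (fun j => \sum_(t <- l) u t j)%N.
  elim=> [|t l IH]; first by under eq_fun do rewrite big_nil.
  by under eq_fun do rewrite big_cons; exact: PD.
exact.
Qed.

Lemma plinesE (I : Type) l n (j : I) : plines l n j = (\sum_(x <- l) pline x n j)%N.
Proof.
elim: l => [|x l IH]; first by rewrite big_nil.
by rewrite big_cons -IH.
Qed.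

(* Some multiple [m i] of each [g i] is a pumpable direction, so reducing the *)
(* coefficients modulo [m i] leaves finitely many bundles of lines.           *)
Lemma lines_cover (I : finType) (H : fam I) (r : nat) (b be : I -> nat) (g : 'I_r -> I -> nat) :
  good H -> periodicv (supp H) ->
  (forall c : 'I_r -> nat, exists2 x, supp H x &
     addv be (fun j => \sum_i c i * g i j)%N = addv b x) ->
  exists2 p, supp H p & exists (T : finType) (l : T -> seq ((I -> nat) * (I -> nat) * ((nat -> nat) -> nat))),
    (forall t, allp (fun x => dbl H (pr x.1.1 x.1.2)) (l t)) /\
    forall c : 'I_r -> nat, exists t n,
      addv b (plines (l t) n) = addv p (addv be (fun j => \sum_i c i * g i j)%N).
Proof.
move=> gH pH hL.
have [x0 Hx0] := hL (fun=> 0%N).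
have -> : addv be (fun j => \sum_(i < r) 0 * g i j)%N = be.
  by apply/funext => j; rewrite /addv big1 ?addn0 // => i _; rewrite mul0n.
move=> ebe.
have /choice[um hum] : forall i, exists um : (I -> nat) * nat,
    (0 < um.2)%N /\ dbl H (pr um.1 (scv um.2 (g i))).
  move=> i.
  (* Varying only the coefficient of [g i] gives a line in [supp H]; two of its points provide the
     period [(l - k) g i]. *)
  have ha k : supp H (addv x0 (scv k (g i))).
    have [x Hx] := hL (fun i' => if i' == i then k else 0%N).
    have -> : (fun j => \sum_i0 (if i0 == i then k else 0) * g i0 j)%N = scv k (g i).
      apply/funext => j; rewrite (bigD1 i) //= eqxx big1 ?addn0 // => i' /negPf->.
      by rewrite mul0n.
    by rewrite ebe -addvA => /addvI ->.
  have [k [l [kl [q dq eq]]]] := line_dbl gH ha.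
  exists (addv x0 (scv k (g i)), (l - k)%N); rewrite subn_gt0; split=> //=.
  congr (dbl H): dq; congr pr; apply/funext => j.
  by have /(congr1 (@^~ j)) := eq; rewrite /addv /scv mulnBl; lia.
pose u i := (um i).1; pose m i := (um i).2.
have m0 i : (0 < m i)%N := (hum i).1.
have du i : dbl H (pr (u i) (scv (m i) (g i))) := (hum i).2.
have su i : supp H (u i).
  have := dbl_line gH (du i) 0; congr (supp H); apply/funext => j.
  by rewrite /addv /scv mul0n addn0.
exists (fun j => \sum_i u i j)%N; first exact: periodic_sum.
(* Residues are below the [m i], hence at most [M]. The quotients become iteration counts, and the
   residual vector [x t] enters as a line with zero period. *)
pose M := (\max_i m i)%N.
have /choice[x hx] : forall t : {ffun 'I_r -> 'I_M.+1}, exists x, supp H x /\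
    addv be (fun j => \sum_i t i * g i j)%N = addv b x.
  by move=> t; have [x hx ex] := hL (fun i => t i); exists x.
pose line i : (I -> nat) * (I -> nat) * ((nat -> nat) -> nat) :=
  (u i, scv (m i) (g i), fun n : nat -> nat => n (nat_of_ord i)).
exists {ffun 'I_r -> 'I_M.+1},
  (fun t => (x t, zv, fun=> 0%N) :: [seq line i | i <- enum 'I_r]); split.
  move=> t; split; first by apply/(supp_dbl _ gH); exact: (hx t).1.
  by elim: (enum 'I_r) => //= i l IH.
move=> c; exists [ffun i => inord (c i %% m i)%N],
  (fun k => if insub k is Some i then (c i %/ m i)%N else 0%N).
set t := [ffun i => _].
have et i : t i = (c i %% m i)%N :> nat.
  rewrite ffunE inordK // ltnS; apply: leq_trans (ltnW (ltn_pmod _ (m0 i))) _.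
  exact: leq_bigmax.
have ex := (hx t).2; apply/funext => j.
have {}ex : (be j + \sum_i t i * g i j = b j + x t j)%N by have /(congr1 (@^~ j)) := ex.
rewrite /addv plinesE big_cons big_map big_enum /=.
have -> : pline (x t, zv, fun=> 0%N) (fun k => if insub k is Some i then (c i %/ m i)%N else 0%N) j = x t j.
  by rewrite /pline /addv /scv /= addn0.
have -> : (\sum_i pline (line i) (fun k => if insub k is Some i then (c i %/ m i)%N else 0) j =
   \sum_i u i j + \sum_i c i %/ m i * m i * g i j)%N.
  rewrite -big_split; apply: eq_bigr => i _; rewrite /pline /addv /scv /= valK mulnA.
  by [].
have -> : (\sum_i c i * g i j = \sum_i c i %/ m i * m i * g i j + \sum_i t i * g i j)%N.
  by rewrite -big_split /=; apply: eq_bigr => i _; rewrite et -mulnDl -divn_eq.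
move: ex; move: (\sum_i t i * g i j)%N (\sum_i c i %/ m i * m i * g i j)%N (\sum_i u i j)%N.
by move=> T W U; lia.
Qed.

(** * From vectors to configurations of a PVAS *)

Section Vas.
Variables (d : nat) (V : pvass d).
Hypothesis hV : is_pvas V.

Lemma state_uniq (q q' : state V) : q = q'.
Proof.
have : (#|state V| <= 1)%N by rewrite [#|_|]hV.
by move=> /fintype_le1P; apply.
Qed.

Lemma step_v (e : edge V) q q' x y : step e (q, x) (q', y) <-> vstep e (x 0) (y 0).
Proof.
split.
  move=> [_ _ h1 h2]; split=> // j.
  by have /rowP/(_ j) := h2; rewrite !mxE.
move=> [h1 h2]; split=> /=; [exact: state_uniq|exact: state_uniq|exact: h1|].
by apply/rowP => j; rewrite !mxE h2.
Qed.

Lemma run_v (w : seq (edge V)) q q' x y : run w (q, x) (q', y) <-> vrun w (x 0) (y 0).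
Proof.
elim: w q x => [|e w IH] q x /=.
  split; first by move=> [_ ->].
  by move=> h; rewrite -(fvK x) h fvK (state_uniq q q').
split.
  by move=> [[q1 z] [/step_v h1 /IH h2]]; exists (z 0).
move=> [z h1 h2]; exists (q, rv z); split.
  by apply/step_v; rewrite rvK.
by apply/IH; rewrite rvK.
Qed.

Lemma reach_v q q' x y : @reach d V (q, x) (q', y) <-> @Rlow d V d.+1 (x 0) (y 0).
Proof.
split.
  move=> h; have : forall c c', @reach d V c c' -> @Rlow d V d.+1 (c.2 0) (c'.2 0).
    move=> c c'; elim=> {c c'}.
    - move=> [p u] [p' v] [e /step_v h1]; exists [:: e]; last by exists (v 0).
      by rewrite /low /= ltn_ord.
    - by move=> c; exists [::].
    - move=> c1 c2 c3 _ [w hw h1] _ [w' hw' h2]; exists (w ++ w'); first by rewrite low_cat hw.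
      exact: vrun_cat h1 h2.
  by move/(_ _ _ h).
move=> [w _]; elim: w q x => [|e w IH] q x.
  by move=> /= h; rewrite -(fvK x) h fvK (state_uniq q q'); exact: rt_refl.
move=> [z h1 h2]; apply: (@rt_trans _ _ _ (q, rv z)).
  by apply: rt_step; exists e; apply/step_v; rewrite rvK.
by apply: IH; rewrite rvK.
Qed.

Lemma flat_v (ws : seq (seq (edge V))) (q q' : state V) (x y : 'rV[nat]_d) :
  vflat ws (x 0) (y 0) -> flat_run ws (q, x) (q', y).
Proof.
elim: ws q x => [|w ws IH] q x /=.
  by move=> h; rewrite -(fvK x) h fvK (state_uniq q q').
move=> [z [k hk] h]; exists (q, rv z); split; last by apply: IH; rewrite rvK.
elim: k x hk => [|k IHk] x /=; first by move=> <-; rewrite fvK; exact: rt_refl.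
move=> hk; have [z1 h1 h2] : exists2 z1, vrun w (x 0) z1 & vrun (flatten (nseq k w)) z1 z.
  move: (flatten _) hk => u; elim: (w) (x 0) => [|e w' IHw] x' /=; first by move=> hu; exists x'.
  by move=> [z2 h3 /IHw[z1 h4 h5]]; exists z1 => //; exists z2.
apply: (@rt_trans _ _ _ (q, rv z1)); last by apply: IHk; rewrite rvK.
by apply: rt_step; apply/run_v; rewrite rvK.
Qed.

Lemma vflat_id (ws : seq (seq (edge V))) x : vflat ws x x.
Proof. by elim: ws => //= w ws IH; exists x => //; exists 0%N. Qed.

(** Zero iterations let the run pass over the words of all other members. *)
Lemma vflat_flatten (T : eqType) (l : seq T) (ws : T -> seq (seq (edge V))) t x y :
  t \in l -> vflat (ws t) x y -> vflat (flatten [seq ws u | u <- l]) x y.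
Proof.
elim: l => //= u l IH; rewrite inE => /orP[/eqP <-|tl] h.
  by apply: vflat_cat h (vflat_id _ _).
by apply: vflat_cat (vflat_id _ _) (IH tl h).
Qed.

Definition alin (r n : nat) (p : 'I_r -> 'rV[nat]_n) : amap 'I_r 'I_n.
Proof.
refine (@AMap 'I_r 'I_n (fun c j => \sum_i c i * p i 0%R j)%N
  (fun c j => \sum_i c i * (p i 0 j)%:R) _ _ _).
- move=> x y; apply/funext => j; rewrite /addv -big_split; apply: eq_bigr => i _.
  by rewrite mulnDl.
- move=> a b u v; apply/funext => j; rewrite /lcomb !mulr_sumr -big_split.
  by apply: eq_bigr => i _ /=; ring.
- by move=> x; apply/funext => j; rewrite /toq natr_sum; apply: eq_bigr => i _; rewrite natrM.
Defined.
Arguments alin : simpl never.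

Lemma alinE r n (p : 'I_r -> 'rV[nat]_n) c : (\sum_(i < r) p i *+ c i) 0 = alin p c.
Proof.
apply/funext => j; rewrite summxE; apply: eq_bigr => i _.
by rewrite mulmxnE nat_mulrn mulnC.
Qed.

Lemma good3_linear n (L : set 'rV[nat]_n) : linear_set L ->
  exists2 F : fam 'I_n, good3 (fun _ _ => True) F & forall x, L x <-> supp F (x 0).
Proof.
move=> [r [b [p ->]]].
exists (fimg (alin p) (b 0) (@ffull 'I_r)).
  by apply: good3_weak (good3_img _ _ (good3_full (Fl := fun _ _ => True) (fun _ => Logic.I))).
move=> x; rewrite supp_img supp_full; split.
  by move=> [c _ <-]; exists c => //; rewrite fvD alinE.
move=> [c _ e]; exists c => //; rewrite -(fvK x) -e -alinE -fvD fvK.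
by [].
Qed.

Definition asplit : amap ('I_d + 'I_d) 'I_(d + d) := areindex (@split d d).

Lemma asplitK (w : 'I_(d + d) -> nat) : asplit (w \o @unsplit d d) = w.
Proof. by apply/funext => i; rewrite -[LHS]/(w (unsplit (split i))) splitK. Qed.

Lemma asplit_unsplit (w : 'I_d + 'I_d -> nat) : asplit w \o @unsplit d d = w.
Proof. by apply/funext => i; rewrite -[LHS]/(w (split (unsplit i))) unsplitK. Qed.

Lemma supp_split (F : fam ('I_d + 'I_d)) w :
  supp (fimg asplit zv F) w <-> supp F (w \o @unsplit d d).
Proof.
rewrite supp_img; split; first by move=> [u hu <-]; rewrite add0v asplit_unsplit.
by move=> h; exists (w \o @unsplit d d) => //; rewrite add0v asplitK.
Qed.

Lemma unsplit_pr (z : 'rV[nat]_(d + d)) :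
  z 0 \o @unsplit d d = pr (lsubmx z 0) (rsubmx z 0).
Proof. by apply/funext => -[i|i] /=; rewrite mxE. Qed.

(** [lines_cover] leaves finitely many bundles of lines. Each has one flat run for all iteration
    counts, and the concatenation of these runs serves the whole of [p + L]. *)
Lemma flattable_lines (b : 'I_(d + d) -> nat) (H : fam 'I_(d + d)) (b' : 'I_d + 'I_d -> nat) D' L :
  good2 H -> periodicv (supp H) -> b = asplit b' ->
  flatp (@pfl d V d.+1) b' D' -> dbl H `<=` [set asum asplit asplit w | w in D'] ->
  linear_set L -> L `<=` translate (rv b) (setV (supp H)) ->
  exists p, setV (supp H) p /\ flattable V (translate p L).
Proof.
move=> [gH _] pH eb hf hD [r [be [g ->]]] hL.
have [|p Hp [T [l [hl hc]]]] := @lines_cover _ H r b (be 0) (fun i => g i 0) gH pH.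
  move=> c; have [x Hx e] := hL _ (ex_intro2 _ _ c Logic.I erefl).
  by exists (x 0) => //; move/(congr1 (fun M : 'rV[nat]_(d + d) => M 0)): e; rewrite !fvD rvK alinE => ->.
exists (rv p); split; first by rewrite /setV /= rvK.
pose ls t := [seq (x.1.1 \o @unsplit d d, x.1.2 \o @unsplit d d, x.2) | x <- l t].
have hls t : allp (fun x => D' (pr x.1.1 x.1.2)) (ls t).
  have := hl t; rewrite /ls; elim: (l t) => //= x l' IH [/hD[w Dw e] /IH]; split=> //.
  move/pr_inj: e => [<- <-].
  by rewrite !asplit_unsplit pr_eta.
have els t n : plines (ls t) n = plines (l t) n \o @unsplit d d.
  apply/funext => j; rewrite /= !plinesE big_map; apply: eq_bigr => x _.
  by rewrite /pline.
have /choice[ws hws] : forall t, exists ws : seq (seq (edge V)), forall n,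
    vflat ws (addv (b' \o inl) (plines (ls t) n \o inl)) (addv (b' \o inr) (plines (ls t) n \o inr)).
  by move=> t; have [ws _ h] := hf _ (hls t); exists ws.
have [q0 _] : exists q : state V, True.
  have /card_gt0P[q _] : (0 < #|state V|)%N by rewrite [#|_|]hV.
  by exists q.
exists (flatten [seq ws t | t <- enum T]) => z [y [c _ <-] <-].
exists q0, q0; apply: flat_v; have [t [n e]] := hc c.
apply: (vflat_flatten (t := t)); first by rewrite mem_enum.
have ez : (rv p + (be + \sum_(i < r) g i *+ c i)) 0 \o @unsplit d d =
    addv b' (plines (ls t) n).
  rewrite !fvD rvK alinE -[alin g c]/(fun j => \sum_i c i * g i 0%R j)%N -e els eb.
  by rewrite -[LHS]/(addv (asplit b' \o @unsplit d d) (plines (l t) n \o @unsplit d d)) asplit_unsplit.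
move: ez; rewrite unsplit_pr => ez.
have -> : lsubmx (rv p + (be + \sum_(i < r) g i *+ c i)) 0 = addv (b' \o inl) (plines (ls t) n \o inl).
  by have /(congr1 (fun w => w \o inl)) := ez.
have -> : rsubmx (rv p + (be + \sum_(i < r) g i *+ c i)) 0 = addv (b' \o inr) (plines (ls t) n \o inr).
  by have /(congr1 (fun w => w \o inr)) := ez.
exact: hws.
Qed.
End Vas.

Theorem theorem31 (d : nat) (V : pvass d) (hV : is_pvas V)
    (S : set 'rV[nat]_(d + d)) (hS : semilinear_set S) :
  exists (k : nat) (b : 'I_k -> 'rV[nat]_(d + d))
         (P : 'I_k -> set 'rV[nat]_(d + d)),
    vec_rel (@reach d V) `&` S = \bigcup_i translate (b i) (P i) /\
    forall i : 'I_k,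
      smooth (P i) /\
      forall L : set 'rV[nat]_(d + d),
        linear_set L -> L `<=` translate (b i) (P i) ->
        exists p, P i p /\ flattable V (translate p L).
Proof.
(* Priorities are at most [d], so level [d.+1] contains all edges. *)
have [F [gF sF _]] := good_level V d.+1.
have [n [Ls [lin ->]]] := hS.
have /choice[FL hFL] : forall i, exists F : fam 'I_(d + d), good3 (fun _ _ => True) F /\
    forall x, Ls i x <-> supp F (x 0).
  by move=> i; have [G g1 g2] := good3_linear (lin i); exists G.
have gS := @good3_bigunion _ 'I_n predT (fun _ _ => True) FL (fun i _ => (hFL i).1).
set FS := (fun b P => _) in gS.
have gR := good3_img (@asplit d) zv gF.
have gX := good3_inter gR gS.
set X := finter _ _ in gX.
have sX (x : 'rV[nat]_(d + d)) : supp X (x 0) <-> (vec_rel (@reach d V) `&` \bigcup_i Ls i) x.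
  rewrite supp_inter; split.
    move=> [/supp_split h1 [P [i _ h2]]]; split.
      move: h1; rewrite unsplit_pr => /sF h1.
      have /card_gt0P[q _] : (0 < #|state V|)%N by rewrite [#|_|]hV.
      by exists q, q; apply/(reach_v hV).
    by exists i => //; apply/(hFL i).2; exists P.
  move=> [[q [q' /(reach_v hV) h1]] [i _ /(hFL i).2[P h2]]]; split; last by exists P, i.
  by apply/supp_split; rewrite unsplit_pr; apply/sF.
have [k [b [P [hb hc]]]] := good_cover gX.1.1.
exists k, (fun i => rv (b i)), (fun i => setV (P i)); split.
  apply/funext => x; apply/propext; rewrite -sX hc; split.
    move=> [j [p Pp e]]; exists j => //; exists (rv p); first by rewrite /setV /= rvK.
    by rewrite -(fvK x) e; apply/rowP => i; rewrite !mxE.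
  move=> [j _ [p Pp <-]]; exists j, (p 0) => //.
  by rewrite fvD rvK.
(* Flatness comes from the reachability half of the intersection, which contains the doubled
   relation of the periods. *)
move=> j; have [H [gH sH _ [D1 [D2 [[b' [D' [eb hf ->]]] _ eD]]]]] := gX.2 _ _ (hb j).
have pP : periodicv (P j) by have [[G1 _ _ _] _] := gX.1; exact: G1 (hb j).
rewrite -sH in pP *; split; first exact: setV_smooth.
move=> L linL hL.
rewrite add0v in eb; apply: (flattable_lines hV gH pP eb hf _ linL hL).
by rewrite eD => w [].
Qed.
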